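(* Let $\Lambda$ be a basic, indecomposable, finite-dimensional algebra over an algebraically closed field $K$. If $\Lambda$ has finite right selfinjective dimension, i.e. $\mathrm{inj.dim}\,\Lambda_\Lambda<\infty$, then the singularity category $\mathsf{D}_{\mathsf{sg}}(\Lambda)$ admits no non-zero silting object. In particular, if $\Lambda$ is Iwanaga--Gorenstein, then the stable category $\underline{\mathsf{CM}}\,\Lambda$ of the category of Cohen--Macaulay $\Lambda$-modules has no non-zero silting object.
   Context: Modules are finitely generated right modules. The singularity category is the Verdier quotient $\mathsf{D}_{\mathsf{sg}}(\Lambda)=\mathsf{D^b}(\mathsf{mod}\,\Lambda)/\mathsf{K^b}(\mathsf{proj}\,\Lambda)$, where $\mathsf{mod}\,\Lambda$ is the category of finitely generated modules and $\mathsf{proj}\,\Lambda$ the full subcategory of projective modules. An object $T$ of a triangulated category $\mathcal{T}$ is silting if $\mathrm{Hom}_{\mathcal T}(T,T[i])=0$ for all $i>0$ and $\mathcal{T}=\mathsf{thick}\,T$, where $\mathsf{thick}\,T$ is the smallest thick subcategory of $\mathcal T$ containing $T$. $\Lambda$ is Iwanaga--Gorenstein if it has finite right and finite left selfinjective dimension. A module $M$ is Cohen--Macaulay if $\mathrm{Ext}^i_\Lambda(M,\Lambda)=0$ for all $i>0$. For $\Lambda$ Iwanaga--Gorenstein, $\underline{\mathsf{CM}}\,\Lambda$ is the stable category (morphisms modulo those factoring through projectives) of the full subcategory of $\mathsf{mod}\,\Lambda$ of Cohen--Macaulay modules, with its standard triangulated structure. *)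

(* Defs.v *)
From HB Require Import structures.
From mathcomp Require Import all_boot all_order all_algebra all_field.
From mathcomp Require Import zify.
From Stdlib Require Import ClassicalEpsilon.

Set Implicit Arguments.
Unset Strict Implicit.
Unset Printing Implicit Defensive.

Import GRing.Theory.
Local Open Scope ring_scope.

(* Morphism sets are setoids: [heq] is equality of morphisms.  The records
   carry the data of a triangulated category (composition, zero morphisms,
   shift, distinguished triangles) and not its axioms: no definition below
   uses the axioms, and the records are only instantiated with K^b(mod),
   D^b(mod), D_sg and the stable category of Cohen-Macaulay modules. *)
Record scat := SCat {
  ob :> Type;
  hom : ob -> ob -> Type;
  heq : forall X Y, hom X Y -> hom X Y -> Prop;
  idm : forall X, hom X X;
  comp : forall X Y Z, hom Y Z -> hom X Y -> hom X Z;
  zerom : forall X Y, hom X Y;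
  sh : ob -> ob;
  shm : forall X Y, hom X Y -> hom (sh X) (sh Y)
}.
Arguments hom {s} X Y.
Arguments heq {s X Y} f g.
Arguments idm {s} X.
Arguments comp {s X Y Z} g f.
Arguments zerom {s} X Y.
Arguments sh {s} X.
Arguments shm {s X Y} f.

Declare Scope tricat_scope.
Delimit Scope tricat_scope with C.
Notation "f =h g" := (heq f g) (at level 70) : tricat_scope.
Notation "g \oc f" := (comp g f) (at level 50, left associativity) : tricat_scope.
Local Open Scope tricat_scope.

Definition zero_obj (C : scat) (X : C) := idm X =h zerom X X.

Definition is_iso (C : scat) (X Y : C) (f : hom X Y) :=
  exists g : hom Y X, g \oc f =h idm X /\ f \oc g =h idm Y.

Definition isomorphic (C : scat) (X Y : C) := exists f : hom X Y, is_iso f.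

Definition is_direct_sum (C : scat) (X X' Y : C) (i : hom X Y) (i' : hom X' Y) :=
  forall (Z : C) (f : hom X Z) (f' : hom X' Z),
    (exists h : hom Y Z, h \oc i =h f /\ h \oc i' =h f') /\
    (forall h k : hom Y Z,
        h \oc i =h f -> h \oc i' =h f' -> k \oc i =h f -> k \oc i' =h f' ->
        h =h k).

Definition direct_summand (C : scat) (X Y : C) :=
  exists (X' : C) (i : hom X Y) (i' : hom X' Y), is_direct_sum i i'.

Record triangle (C : scat) := Triangle {
  tX : C; tY : C; tZ : C;
  tu : hom tX tY;
  tv : hom tY tZ;
  tw : hom tZ (sh tX)
}.
Arguments Triangle {C tX tY tZ} tu tv tw.

Definition triangle_iso (C : scat) (s t : triangle C) :=
  exists (a : hom (tX s) (tX t)) (b : hom (tY s) (tY t)) (c : hom (tZ s) (tZ t)),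
    [/\ is_iso a, is_iso b & is_iso c] /\
    [/\ b \oc tu s =h tu t \oc a, c \oc tv s =h tv t \oc b
      & shm a \oc tw s =h tw t \oc c].

Record tricat := TriCat {
  tcat :> scat;
  dist : triangle tcat -> Prop
}.

(* Full subcategories are predicates on objects.  Closure under the inverse
   shift is expressed by the equivalence in the second clause. *)
Definition thick_subcat (C : tricat) (S : C -> Prop) :=
  [/\ forall X Y : C, isomorphic X Y -> S X -> S Y,
      forall X : C, S X <-> S (sh X),
      forall t : triangle C, dist t -> S (tX t) -> S (tY t) -> S (tZ t)
    & forall X Y : C, direct_summand X Y -> S Y -> S X].

Definition in_thick (C : tricat) (T X : C) :=
  forall S : C -> Prop, thick_subcat S -> S T -> S X.

Definition silting (C : tricat) (T : C) :=
  (forall i : nat, (0 < i)%N ->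
     forall f : hom T (iter i (@sh C) T), f =h zerom _ _) /\
  (forall X : C, in_thick T X).

(* Gabriel-Zisman localization: morphisms are formal composites of morphisms
   of C and of formal inverses of the morphisms in W, modulo the congruence
   [loc_eq]. *)
Section Localization.
Variables (C : scat) (W : forall X Y : C, hom X Y -> Prop).

Inductive loc_hom : C -> C -> Type :=
| Loc X Y (f : hom X Y) : loc_hom X Y
| Inv X Y (s : hom X Y) (Ws : W s) : loc_hom Y X
| Comp X Y Z (g : loc_hom Y Z) (f : loc_hom X Y) : loc_hom X Z.

Inductive loc_eq : forall X Y, loc_hom X Y -> loc_hom X Y -> Prop :=
| LocRefl X Y (f : loc_hom X Y) : loc_eq f f
| LocSym X Y (f g : loc_hom X Y) : loc_eq f g -> loc_eq g f
| LocTrans X Y (f g h : loc_hom X Y) : loc_eq f g -> loc_eq g h -> loc_eq f h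
| LocCongr X Y Z (g g' : loc_hom Y Z) (f f' : loc_hom X Y) :
    loc_eq g g' -> loc_eq f f' -> loc_eq (Comp g f) (Comp g' f')
| LocAssoc X Y Z T (h : loc_hom Z T) (g : loc_hom Y Z) (f : loc_hom X Y) :
    loc_eq (Comp h (Comp g f)) (Comp (Comp h g) f)
| LocIdl X Y (f : loc_hom X Y) : loc_eq (Comp (Loc (idm Y)) f) f
| LocIdr X Y (f : loc_hom X Y) : loc_eq (Comp f (Loc (idm X))) f
| LocHeq X Y (f g : hom X Y) : f =h g -> loc_eq (Loc f) (Loc g)
| LocComp X Y Z (g : hom Y Z) (f : hom X Y) :
    loc_eq (Loc (g \oc f)) (Comp (Loc g) (Loc f))
| LocInvl X Y (s : hom X Y) (Ws : W s) :
    loc_eq (Comp (Inv Ws) (Loc s)) (Loc (idm X))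
| LocInvr X Y (s : hom X Y) (Ws : W s) :
    loc_eq (Comp (Loc s) (Inv Ws)) (Loc (idm Y)).

Hypothesis W_sh : forall (X Y : C) (s : hom X Y), W s -> W (shm s).

Fixpoint loc_shm X Y (f : loc_hom X Y) : loc_hom (sh X) (sh Y) :=
  match f in loc_hom X Y return loc_hom (sh X) (sh Y) with
  | Loc _ _ f => Loc (shm f)
  | Inv _ _ s Ws => Inv (W_sh Ws)
  | Comp _ _ _ g f => Comp (loc_shm g) (loc_shm f)
  end.

Definition localization : scat := {|
  ob := C;
  hom := loc_hom;
  heq := loc_eq;
  idm := fun X => Loc (idm X);
  comp := Comp;
  zerom := fun X Y => Loc (zerom X Y);
  sh := @sh C;
  shm := loc_shm
|}.

Definition loc_triangle (t : triangle C) : triangle localization :=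
  @Triangle localization _ _ _ (Loc (tu t)) (Loc (tv t)) (Loc (tw t)).

End Localization.

(* The morphisms with a cone in S.  The second constructor lets the shift act
   on formal inverses; it adds no morphism when C is triangulated and S is a
   triangulated subcategory. *)
Inductive cone_in (C : tricat) (S : C -> Prop) :
    forall X Y : C, hom X Y -> Prop :=
| ConeIn X Y Z (u : hom X Y) (v : hom Y Z) (w : hom Z (sh X)) :
    dist (Triangle u v w) -> S Z -> cone_in S u
| ConeInSh X Y (u : hom X Y) : cone_in S u -> cone_in S (shm u).

Definition verdier (C : tricat) (S : C -> Prop) : tricat :=
  @TriCat (localization (@ConeInSh C S))
    (fun t => exists2 t0 : triangle C,
       dist t0 & triangle_iso t (loc_triangle (@ConeInSh C S) t0)).

(* Everything is written for left modules over a ring R; right modules over A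
   are left modules over the converse ring A^c. *)
Section Modules.
Variable R : nzRingType.

Definition finitely_generated (M : lmodType R) :=
  exists (n : nat) (g : 'I_n -> M),
    forall x : M, exists c : 'I_n -> R, x = \sum_i c i *: g i.

Record fgmod := FgMod {
  fgmod_sort :> lmodType R;
  fgmodP : finitely_generated fgmod_sort
}.

Lemma fg_regular : finitely_generated R^o.
Proof.
exists 1%N, (fun=> 1) => x; exists (fun=> x).
by rewrite big_ord1 /GRing.scale /= mulr1.
Qed.

Definition regular_mod : fgmod := FgMod fg_regular.

Lemma fg_prod (M N : fgmod) : finitely_generated (M * N)%type.
Proof.
have [m [g gP]] := fgmodP M; have [n [h hP]] := fgmodP N.
exists (m + n)%N,
  (fun k => match split k with inl i => (g i, 0) | inr j => (0, h j) end).
case=> x y; have [a ->] := gP x; have [b ->] := hP y.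
exists (fun k => match split k with inl i => a i | inr j => b j end).
rewrite big_split_ord /=.
have splitl i : split (lshift n i) = inl i := unsplitK (inl i).
have splitr j : split (rshift m j) = inr j := unsplitK (inr j).
rewrite (eq_bigr (fun i => (a i *: g i, 0))); last first.
  by move=> i _; rewrite splitl; congr pair; rewrite /= scaler0.
rewrite [X in _ = _ + X](eq_bigr (fun j => (0, b j *: h j))); last first.
  by move=> j _; rewrite splitr; congr pair; rewrite /= scaler0.
by congr pair; rewrite /= !raddf_sum /= big1_eq ?addr0 ?add0r.
Qed.

Definition prod_mod (M N : fgmod) : fgmod := FgMod (fg_prod M N).

Definition zero_mod (M : fgmod) := forall x : M, x = 0.

Definition iso_mod (M N : fgmod) := exists f : {linear M -> N}, bijective f.

Definition surjective_map (M N : fgmod) (f : {linear M -> N}) :=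
  forall y, exists x, f x = y.

Definition exact_at (L M N : fgmod) (f : {linear L -> M}) (g : {linear M -> N}) :=
  forall x, g x = 0 <-> exists y, f y = x.

Definition indecomposable_mod (M : fgmod) :=
  ~ zero_mod M /\
  forall A B : fgmod, iso_mod M (prod_mod A B) -> zero_mod A \/ zero_mod B.

Definition projective (P : fgmod) :=
  forall (M N : fgmod) (p : {linear M -> N}) (f : {linear P -> N}),
    surjective_map p -> exists g : {linear P -> M}, p \o g =1 f.

Definition injective_mod (I : fgmod) :=
  forall (M N : fgmod) (i : {linear M -> N}) (f : {linear M -> I}),
    injective i -> exists g : {linear N -> I}, g \o i =1 f.

Record projective_resolution (M : fgmod) := ProjRes {
  pr_mod :> nat -> fgmod;
  pr_d : forall n, {linear pr_mod n.+1 -> pr_mod n};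
  pr_aug : {linear pr_mod 0%N -> M};
  pr_proj : forall n, projective (pr_mod n);
  pr_surj : surjective_map pr_aug;
  pr_exact0 : exact_at (pr_d 0%N) pr_aug;
  pr_exactS : forall n, exact_at (pr_d n.+1) (pr_d n)
}.

Record injective_resolution (M : fgmod) := InjRes {
  ir_mod :> nat -> fgmod;
  ir_d : forall n, {linear ir_mod n -> ir_mod n.+1};
  ir_aug : {linear M -> ir_mod 0%N};
  ir_injective : forall n, injective_mod (ir_mod n);
  ir_inj : injective ir_aug;
  ir_exact0 : exact_at ir_aug (ir_d 0%N);
  ir_exactS : forall n, exact_at (ir_d n) (ir_d n.+1)
}.

Definition finite_injdim (M : fgmod) :=
  exists (I : injective_resolution M) (d : nat),
    forall n, (d < n)%N -> zero_mod (I n).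

(* Ext^{n+1}(M, N) = 0: the cohomology of Hom(P, N) vanishes in degree n+1. *)
Definition extS_vanishes (n : nat) (M N : fgmod) :=
  forall (P : projective_resolution M) (f : {linear P n.+1 -> N}),
    (forall x, f (pr_d P n.+1 x) = 0) ->
    exists g : {linear P n -> N}, forall x, f x = g (pr_d P n x).

Definition cohen_macaulay (M : fgmod) :=
  forall n, extS_vanishes n M regular_mod.

End Modules.

Arguments zero_mod {R} M.

Section Complexes.
Variable R : nzRingType.

Record cplx := Cplx {
  cmod :> int -> fgmod R;
  cd : forall i : int, {linear cmod i -> cmod (i + 1)};
  cdd : forall i x, cd (i + 1) (cd i x) = 0;
  cbounded : exists n : nat, forall i : int, (n < absz i)%N -> zero_mod (cmod i)
}.

Record cmap (X Y : cplx) := CMap {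
  cfun :> forall i : int, {linear X i -> Y i};
  cfunP : forall i x, cfun (i + 1) (cd X i x) = cd Y i (cfun i x)
}.

(* All differences of consecutive degrees are of the form (i + 1, i), so that
   no transport between X i and X (i - 1 + 1) is needed. *)
Definition homotopic (X Y : cplx) (f g : cmap X Y) :=
  exists h : forall i : int, {linear X (i + 1) -> Y i},
    forall i (x : X (i + 1)),
      f (i + 1) x - g (i + 1) x = cd Y i (h i x) + h (i + 1) (cd X (i + 1) x).

Definition cmap_id (X : cplx) : cmap X X :=
  @CMap X X (fun i => idfun) (fun _ _ => erefl).

Lemma cmap_comp_subproof X Y Z (g : cmap Y Z) (f : cmap X Y) i x :
  g (i + 1) (f (i + 1) (cd X i x)) = cd Z i (g i (f i x)).
Proof. by rewrite !cfunP. Qed.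

Definition cmap_comp X Y Z (g : cmap Y Z) (f : cmap X Y) : cmap X Z :=
  @CMap X Z (fun i => g i \o f i) (cmap_comp_subproof g f).

Lemma cmap_zero_subproof (X Y : cplx) i (x : X i) : 0 = cd Y i 0.
Proof. by rewrite linear0. Qed.

Definition cmap_zero (X Y : cplx) : cmap X Y :=
  @CMap X Y (fun i => \0) (@cmap_zero_subproof X Y).

Lemma cshift_dd (X : cplx) i (x : X (i + 1)) :
  - cd X (i + 1 + 1) (- cd X (i + 1) x) = 0.
Proof. by rewrite linearN opprK cdd. Qed.

Lemma cshift_bounded (X : cplx) :
  exists n : nat, forall i : int, (n < absz i)%N -> zero_mod (X (i + 1)).
Proof.
have [n nP] := cbounded X; exists n.+1 => i lt_ni; apply: nP.
by case: i lt_ni => [m|[|m]] //= lt_nm; rewrite ?NegzE; lia.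
Qed.

(* X[1]^i = X^{i+1} with differential -d. *)
Definition cshift (X : cplx) : cplx :=
  @Cplx (fun i => X (i + 1)) (fun i => \- cd X (i + 1)) (@cshift_dd X)
    (cshift_bounded X).

Lemma cshift_map_subproof X Y (f : cmap X Y) i (x : X (i + 1)) :
  f (i + 1 + 1) (- cd X (i + 1) x) = - cd Y (i + 1) (f (i + 1) x).
Proof. by rewrite linearN cfunP. Qed.

Definition cshift_map X Y (f : cmap X Y) : cmap (cshift X) (cshift Y) :=
  @CMap (cshift X) (cshift Y) (fun i => f (i + 1)) (cshift_map_subproof f).

Section Cone.
Variables (X Y : cplx) (f : cmap X Y).

Definition cone_mod (i : int) := prod_mod (X (i + 1)) (Y i).

Definition cone_fun i (u : cone_mod i) : cone_mod (i + 1) :=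
  (- cd X (i + 1) u.1, f (i + 1) u.1 + cd Y i u.2).

Lemma cone_fun_linear i : linear (@cone_fun i).
Proof.
move=> a [x y] [x' y']; rewrite /cone_fun /= !linearP.
by congr pair; rewrite /= ?opprD ?scalerN // scalerDr addrACA.
Qed.

HB.instance Definition _ i :=
  GRing.isLinear.Build R (cone_mod i) (cone_mod (i + 1)) _ (@cone_fun i)
    (@cone_fun_linear i).

Definition cone_d i : {linear cone_mod i -> cone_mod (i + 1)} := @cone_fun i.

Lemma cone_dd i (u : cone_mod i) : cone_d (i + 1) (cone_d i u) = 0.
Proof.
rewrite /= /cone_fun /=; congr pair; first by rewrite linearN opprK cdd.
by rewrite linearN linearD cfunP cdd addr0 addNr.
Qed.

Lemma cone_bounded :
  exists n : nat, forall i : int, (n < absz i)%N -> zero_mod (cone_mod i).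
Proof.
have [m mP] := cshift_bounded X; have [n nP] := cbounded Y.
exists (maxn m n) => i; rewrite gtn_max => /andP[lt_mi lt_ni] [x y].
by congr pair; [exact: mP|exact: nP].
Qed.

Definition cone : cplx := @Cplx cone_mod cone_d cone_dd cone_bounded.

Definition cone_in_fun i (y : Y i) : cone i := (0, y).

Lemma cone_in_linear i : linear (@cone_in_fun i).
Proof. by move=> a y y'; congr pair; rewrite /= scaler0 addr0. Qed.

HB.instance Definition _ i :=
  GRing.isLinear.Build R (Y i) (cone i) _ (@cone_in_fun i) (@cone_in_linear i).

Lemma cone_in_subproof i (y : Y i) :
  cone_in_fun (cd Y i y) = cd cone i (cone_in_fun y).
Proof. by congr pair; rewrite !linear0 ?oppr0 ?add0r. Qed.

Definition cone_incl : cmap Y cone :=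
  @CMap Y cone (fun i => @cone_in_fun i) cone_in_subproof.

Definition cone_proj : cmap cone (cshift X) :=
  @CMap cone (cshift X) (fun i => fst) (fun _ _ => erefl).

End Cone.

Definition acyclic (X : cplx) := forall i : int, exact_at (cd X i) (cd X (i + 1)).

Definition perfect (X : cplx) := forall i : int, projective (X i).

Definition Kb_cat : scat := {|
  ob := cplx;
  hom := cmap;
  heq := homotopic;
  idm := cmap_id;
  comp := cmap_comp;
  zerom := cmap_zero;
  sh := cshift;
  shm := cshift_map
|}.

Definition cone_triangle (X Y : cplx) (f : cmap X Y) : triangle Kb_cat :=
  @Triangle Kb_cat X Y (cone f) f (cone_incl f) (cone_proj f).

(* K^b(mod R), D^b(mod R) = K^b(mod R) / {acyclic complexes} and
   D_sg(R) = D^b(mod R) / K^b(proj R). *)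
Definition Kb : tricat :=
  @TriCat Kb_cat (fun t => exists (X Y : cplx) (f : cmap X Y),
                    triangle_iso t (cone_triangle f)).

Definition Db : tricat := @verdier Kb acyclic.

Definition Dsg : tricat := @verdier Db perfect.

End Complexes.

(* The triangulated structure is that of the stable category of a Frobenius
   category: X[1] is the cokernel of a chosen admissible monomorphism
   X -> I(X) with I(X) projective, and the standard triangles are given by the
   pushouts of these monomorphisms. *)
Section StableCategory.
Variable R : nzRingType.

Record cmmod := CMMod {
  cmmod_sort :> fgmod R;
  cmmodP : cohen_macaulay cmmod_sort
}.

Definition stable_eq (M N : fgmod R) (f g : {linear M -> N}) :=
  exists (P : fgmod R) (a : {linear M -> P}) (b : {linear P -> N}),
    projective P /\ forall x, f x - g x = b (a x).

Record cosyzygy_data (X : cmmod) := CosyzData {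
  cs_mid : fgmod R;
  cs_coker : cmmod;
  cs_inj : {linear X -> cs_mid};
  cs_proj : {linear cs_mid -> cs_coker}
}.

Definition is_cosyzygy (X : cmmod) (c : cosyzygy_data X) :=
  [/\ projective (cs_mid c), injective (cs_inj c),
      exact_at (cs_inj c) (cs_proj c) & surjective_map (cs_proj c)].

(* The inhabitant passed to [epsilon] is only reached when X has no cosyzygy
   sequence, which does not happen over an Iwanaga-Gorenstein ring. *)
Definition cosyzygy (X : cmmod) : cosyzygy_data X :=
  epsilon (inhabits (@CosyzData X X X idfun idfun)) (@is_cosyzygy X).

Definition cm_shift (X : cmmod) : cmmod := cs_coker (cosyzygy X).

Definition cm_shift_map (X Y : cmmod) (f : {linear X -> Y}) :
    {linear cm_shift X -> cm_shift Y} :=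
  epsilon (inhabits (\0 : {linear cm_shift X -> cm_shift Y}))
    (fun g => exists h : {linear cs_mid (cosyzygy X) -> cs_mid (cosyzygy Y)},
       (forall x, h (cs_inj (cosyzygy X) x) = cs_inj (cosyzygy Y) (f x)) /\
       (forall x, g (cs_proj (cosyzygy X) x) = cs_proj (cosyzygy Y) (h x))).

Definition stCM_cat : scat := {|
  ob := cmmod;
  hom := fun X Y => {linear X -> Y};
  heq := fun X Y => @stable_eq X Y;
  idm := fun X => idfun;
  comp := fun X Y Z g f => g \o f;
  zerom := fun X Y => \0;
  sh := cm_shift;
  shm := cm_shift_map
|}.

(* Z is the pushout of X -> I(X) and u : X -> Y, through j : I(X) -> Z and
   v : Y -> Z, and w : Z -> X[1] is induced by I(X) -> X[1] and 0 : Y -> X[1]. *)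
Definition pushout_triangle (X Y Z : cmmod) (u : {linear X -> Y})
    (v : {linear Y -> Z}) (w : {linear Z -> cm_shift X}) :=
  let c := cosyzygy X in
  exists j : {linear cs_mid c -> Z},
    [/\ forall e y, j e + v y = 0 <-> exists x, e = cs_inj c x /\ y = - u x,
        forall z, exists e y, z = j e + v y,
        forall e, w (j e) = cs_proj c e
      & forall y, w (v y) = 0].

Definition stCM : tricat :=
  @TriCat stCM_cat
    (fun t => exists (X Y Z : cmmod) (u : {linear X -> Y}) (v : {linear Y -> Z})
                     (w : {linear Z -> cm_shift X}),
       pushout_triangle u v w /\
       triangle_iso t (@Triangle stCM_cat X Y Z u v w)).

End StableCategory.

Section Algebras.
Variables (K : fieldType) (A : falgType K).

Definition right_regular : fgmod A^c := regular_mod A^c.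
Definition left_regular : fgmod A := regular_mod A.

(* A_A is a direct sum of pairwise non-isomorphic indecomposable modules. *)
Definition basic_algebra :=
  exists (n : nat) (P : 'I_n -> fgmod A^c)
         (inc : forall i, {linear P i -> right_regular})
         (prj : forall i, {linear right_regular -> P i}),
    [/\ forall i x, prj i (inc i x) = x,
        forall i j x, i != j -> prj j (inc i x) = 0,
        forall x, x = \sum_i inc i (prj i x),
        forall i, indecomposable_mod (P i)
      & forall i j, i != j -> ~ iso_mod (P i) (P j)].

(* Algebras in falgType are non-zero. *)
Definition indecomposable_algebra :=
  forall (B C : falgType K) (f : {lrmorphism A -> B * C}), ~ bijective f.

Definition iwanaga_gorenstein :=
  finite_injdim right_regular /\ finite_injdim left_regular.

End Algebras.

(* Main.v *)
(* Let T be silting in D_sg and P -> T a projective resolution.  The objects X with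
   Hom(T, X[k]) = 0 for k >> 0 form a thick subcategory containing T, hence all objects.
   Take X to be a right ideal W of the algebra.  A map P -> W[k] vanishing in D_sg factors
   through a perfect complex Q; only the part of Q in degrees at most -k matters, and P has
   no non-zero map to it when k exceeds the injective dimension.  Thus Ext^k(T, W) = 0 for
   k >> 0, uniformly for all modules since simple modules are subquotients of the algebra.
   So a syzygy of T is projective, T is perfect, and T = 0 in D_sg.

   The same argument with Ext^k(T, -) applies to Cohen-Macaulay modules: T has finite
   projective dimension and is Cohen-Macaulay, hence projective. *)
Require Import Defs.
From HB Require Import structures.
From mathcomp Require Import all_boot all_order all_algebra all_field.
From mathcomp Require Import zify.
From Stdlib Require Import ClassicalEpsilon.

Set Implicit Arguments.
Unset Strict Implicit.
Unset Printing Implicit Defensive.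

Import GRing.Theory.
Local Open Scope ring_scope.

Local Open Scope tricat_scope.
Local Notation hom := Defs.hom.

(** * Modules and submodules *)

(** Morphisms of [Dsg] are formal zigzags modulo a generated congruence, so neither their vanishing
    nor their existence can be read off directly. Two bridges to chain maps replace a calculus of
    fractions. First, every zigzag acts, as a relation, on chain maps from right-bounded complexes
    of projectives, taken up to homotopy and up to covers (iterated cocones of maps to perfect
    complexes); a zero morphism acts as zero. Second, every chain map from a cover of P to Y is the
    value at P -> T of some zigzag T -> Y. So Hom(T, T[k]) = 0 becomes the statement
    [locally_trivial] about chain maps, and the thick subcategory is formed on that side. Covers
    disappear only at the end: a map that is null on a cover of P factors, on P itself, through a
    perfect complex.

    The bound for Ext must be uniform in the module, because the syzygy to which it is applied
    depends on the bound. One descending chain of right ideals, chosen before any module is given,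
    serves all simple modules.

    For the stable category the extra work lies in the existence of cosyzygies, which needs finite
    injective dimension on both sides. *)

Definition pb (P : Prop) : bool :=
  if excluded_middle_informative P then true else false.

Lemma pbP P : reflect P (pb P).
Proof. by rewrite /pb; case: excluded_middle_informative => h; constructor. Qed.

Lemma choice_fun (S : Type) (T : S -> Type) (rho : forall x, T x -> Prop) :
  (forall x, exists y, rho x y) -> exists f : forall x, T x, forall x, rho x (f x).
Proof.
move=> h; exists (fun x => sval (constructive_indefinite_description _ (h x))).
by move=> x; case: constructive_indefinite_description.
Qed.

Section MakeLinear.
Variables (R : pzRingType) (M N : lmodType R) (f : M -> N).
Hypothesis fL : linear f.
Definition mklin_fun of linear f := f.
HB.instance Definition _ :=
  GRing.isLinear.Build R M N _ (mklin_fun fL) fL.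
Definition mklin : {linear M -> N} := mklin_fun fL.
End MakeLinear.

Lemma ex_linear (R : pzRingType) (M N : lmodType R) (f : M -> N) :
  (forall a x y, f (a *: x + y) = a *: f x + f y) ->
  exists g : {linear M -> N}, g =1 f.
Proof. by move=> fL; exists (mklin fL). Qed.

(** Serves for maps defined by choosing representatives. The difference of two values at the same
    point is a value at 0, so the last hypothesis makes the linear relation single-valued. *)
Lemma linear_of_rel (R : pzRingType) (M N : lmodType R) (rho : M -> N -> Prop) :
  (forall x, exists y, rho x y) ->
  (forall a x x' y y', rho x y -> rho x' y' -> rho (a *: x + x') (a *: y + y')) ->
  (forall y, rho 0 y -> y = 0) ->
  exists f : {linear M -> N}, forall x, rho x (f x).
Proof.
move=> tot lin fn.
have [f fP] := choice_fun tot.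
have uniq x y y' : rho x y -> rho x y' -> y = y'.
  move=> h h'; have := lin (-1) _ _ _ _ h h'.
  by rewrite !scaleN1r addNr => /fn /eqP; rewrite addrC subr_eq0 => /eqP.
have fL : linear f by move=> a x y; apply: (uniq (a *: x + y)) => //; exact: lin.
by exists (mklin fL).
Qed.

Record subm (R : pzRingType) (M : lmodType R) := Subm {
  sm_pred :> M -> Prop;
  sm0 : sm_pred 0;
  smL : forall a x y, sm_pred x -> sm_pred y -> sm_pred (a *: x + y)
}.

Section Submodule.
Variables (R : pzRingType) (M : lmodType R) (W : subm M).

Definition sm_mem : {pred M} := fun x => pb (W x).

Lemma sm_closed : submod_closed sm_mem.
Proof.
split=> [|a x y]; first by apply/pbP; exact: sm0.
by move=> /pbP hx /pbP hy; apply/pbP; exact: smL.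
Qed.

HB.instance Definition _ := GRing.isSubmodClosed.Build R M sm_mem sm_closed.

Record subm_sort := SubmSort { subm_val : M; _ : subm_val \in sm_mem }.

HB.instance Definition _ := [isSub for subm_val].
HB.instance Definition _ := [Choice of subm_sort by <:].
HB.instance Definition _ := [SubChoice_isSubLmodule of subm_sort by <:].

Lemma subm_inc_ex : exists f : {linear subm_sort -> M}, forall x, f x = val x.
Proof. by exists val. Qed.

(* Opaque, so that simplification does not expose the underlying projection. *)
Definition subm_inc : {linear subm_sort -> M} :=
  sval (constructive_indefinite_description _ subm_inc_ex).

Lemma subm_incE x : subm_inc x = val x.
Proof. by rewrite /subm_inc; case: constructive_indefinite_description. Qed.

Lemma subm_incP (x : subm_sort) : W (subm_inc x).
Proof. by rewrite subm_incE; apply/pbP; exact: (valP x). Qed.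

Lemma subm_inc_inj : injective subm_inc.
Proof. by move=> x y; rewrite !subm_incE => /val_inj. Qed.

Lemma subm_incK x : W x -> exists y : subm_sort, subm_inc y = x.
Proof. by move/pbP=> Wx; exists (SubmSort Wx); rewrite subm_incE. Qed.

Lemma subm_corestr (N : lmodType R) (f : {linear N -> M}) :
  (forall x, W (f x)) ->
  exists g : {linear N -> subm_sort}, forall x, subm_inc (g x) = f x.
Proof.
move=> Wf; apply: (linear_of_rel (rho := fun x y => subm_inc y = f x)) => //.
- by move=> x; exact: subm_incK.
- by move=> a x x' y y' h h'; rewrite !linearP h h'.
- by move=> y; rewrite linear0 => h; apply: subm_inc_inj; rewrite h linear0.
Qed.

Lemma smD x y : W x -> W y -> W (x + y).
Proof. by move=> hx hy; rewrite -[x]scale1r; exact: smL. Qed.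

Lemma smZ a x : W x -> W (a *: x).
Proof. by move=> hx; rewrite -[_ *: _]addr0; apply: smL => //; exact: sm0. Qed.

Lemma smN x : W x -> W (- x).
Proof. by rewrite -scaleN1r; exact: smZ. Qed.

Lemma smB x y : W x -> W y -> W (x - y).
Proof. by move=> hx hy; apply: smD => //; exact: smN. Qed.

Lemma sm_sum (I : Type) (r : seq I) (P : pred I) (F : I -> M) :
  (forall i, P i -> W (F i)) -> W (\sum_(i <- r | P i) F i).
Proof. by move=> h; elim/big_ind: _ => //; [exact: sm0 | exact: smD]. Qed.

End Submodule.
Arguments subm_inc {R M W}.

Section LinearSub.
Variables (R : pzRingType) (M N : lmodType R) (f : {linear M -> N}).

Lemma ker_subm_L a x y : f x = 0 -> f y = 0 -> f (a *: x + y) = 0.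
Proof. by move=> hx hy; rewrite linearP hx hy scaler0 addr0. Qed.
Definition ker_subm : subm M := Subm (linear0 f) ker_subm_L.

Lemma im_subm_0 : exists x, f x = 0. Proof. by exists 0; rewrite linear0. Qed.
Lemma im_subm_L a y y' :
  (exists x, f x = y) -> (exists x, f x = y') -> exists x, f x = a *: y + y'.
Proof. by case=> x <- [x' <-]; exists (a *: x + x'); rewrite linearP. Qed.
Definition im_subm : subm N := Subm im_subm_0 im_subm_L.

Lemma ker_sub0 : (forall x, f x = 0 -> x = 0) -> injective f.
Proof.
move=> h x y e; apply/eqP; rewrite -subr_eq0; apply/eqP/h.
by rewrite linearB e subrr.
Qed.

Lemma factor_image (I : lmodType R) (phi : {linear M -> I}) :
  (forall x, f x = 0 -> phi x = 0) ->
  exists g : {linear subm_sort im_subm -> I},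
    forall x y, subm_inc y = f x -> g y = phi x.
Proof.
move=> h.
have [g gP] : exists g : {linear subm_sort im_subm -> I},
    forall y, exists x, subm_inc y = f x /\ g y = phi x.
  apply: (linear_of_rel (rho := fun (y : subm_sort im_subm) z =>
            exists x, subm_inc y = f x /\ z = phi x)).
  - by move=> y; have [x e] := subm_incP y; exists (phi x), x.
  - move=> a y y' z z' [x [e ->]] [x' [e' ->]].
    by exists (a *: x + x'); rewrite !linearP e e'.
  - by move=> z [x [e ->]]; apply: h; rewrite -e linear0.
exists g => x y e; have [x' [e' ->]] := gP y.
by apply/eqP; rewrite -subr_eq0 -linearB h // linearB -e' e subrr.
Qed.
End LinearSub.

Lemma exact_comp0 (R : nzRingType) (L M N : fgmod R) (f : {linear L -> M})
  (g : {linear M -> N}) : exact_at f g -> forall x, g (f x) = 0.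
Proof. by move=> h x; apply/h; exists x. Qed.

(** This keeps kernels and other submodules inside [fgmod R]. *)
Definition noeth (R : nzRingType) :=
  forall (M : fgmod R) (W : subm M), finitely_generated (subm_sort W).

Lemma fg_surj (R : nzRingType) (M : fgmod R) (N : lmodType R)
  (f : {linear M -> N}) : (forall y, exists x, f x = y) -> finitely_generated N.
Proof.
move=> fs; have [n [g gP]] := fgmodP M; exists n, (fun i => f (g i)) => y.
have [x <-] := fs y; have [c ->] := gP x; exists c.
by rewrite linear_sum; apply: eq_bigr => i _; rewrite linearZ.
Qed.

Lemma fg_image (R : nzRingType) (M : fgmod R) (N : lmodType R)
  (f : {linear M -> N}) : finitely_generated (subm_sort (im_subm f)).
Proof.
have [g gP] : exists g : {linear M -> subm_sort (im_subm f)},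
  forall x, subm_inc (g x) = f x by apply: subm_corestr => x; exists x.
apply: (fg_surj (f := g)) => y; have [x e] := subm_incP y.
by exists x; apply: subm_inc_inj; rewrite gP.
Qed.

Definition image_mod (R : nzRingType) (M N : fgmod R) (f : {linear M -> N}) :
  fgmod R := FgMod (fg_image f).

Section Image.
Variables (R : nzRingType) (M N : fgmod R) (f : {linear M -> N}).

Definition image_inc : {linear image_mod f -> N} := @subm_inc _ _ (im_subm f).

Lemma image_inc_inj : injective image_inc. Proof. exact: subm_inc_inj. Qed.

Lemma image_incP y : exists x, f x = image_inc y.
Proof. exact: (@subm_incP _ _ (im_subm f) y). Qed.

Lemma image_corestr : exists g : {linear M -> image_mod f},
  forall x, image_inc (g x) = f x.
Proof. by apply: (@subm_corestr _ _ (im_subm f) M f) => x; exists x. Qed.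
End Image.
Arguments image_inc {R M N f}.

(** * Lifting and extension for projective and injective modules *)

Section Projectives.
Variable R : nzRingType.
Implicit Types M N P Q I : fgmod R.

(** [projective] speaks of surjections only; corestricting both maps to the image of [d] gives the
    form needed for lifting into exact complexes. *)
Lemma projective_lift P M N (d : {linear M -> N}) (phi : {linear P -> N}) :
  projective P -> (forall x, exists y, d y = phi x) ->
  exists g : {linear P -> M}, forall x, d (g x) = phi x.
Proof.
move=> Pp h.
have [phi' e] : exists phi' : {linear P -> image_mod d},
  forall x, subm_inc (phi' x) = phi x by apply: subm_corestr.
have [d' e'] : exists d' : {linear M -> image_mod d},
  forall x, subm_inc (d' x) = d x by apply: subm_corestr => x; exists x.
have [|g gP] := Pp M (image_mod d) d' phi'.
  move=> y; have [x ex] := subm_incP y.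
  by exists x; apply: subm_inc_inj; rewrite e'.
by exists g => x; rewrite -e' -e -gP.
Qed.

(** [phi] descends to the image of [f] and is extended along its inclusion, so no quotient by the
    kernel is formed. *)
Lemma injective_extend M N I (f : {linear M -> N}) (phi : {linear M -> I}) :
  injective_mod I -> (forall x, f x = 0 -> phi x = 0) ->
  exists g : {linear N -> I}, forall x, g (f x) = phi x.
Proof.
move=> Ii h; have [p pP] := factor_image h.
have [|g gP] := Ii (image_mod f) N (@subm_inc _ _ (im_subm f)) p.
  exact: subm_inc_inj.
exists g => x; have [y e] : exists y : image_mod f, subm_inc y = f x.
  by apply: subm_incK; exists x.
by rewrite -e; apply: etrans (gP y) _; exact: pP.
Qed.

Lemma projective_retract P Q (i : {linear Q -> P}) (r : {linear P -> Q}) :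
  (forall x, r (i x) = x) -> projective P -> projective Q.
Proof.
move=> ri Pp M N p f ps; have [g gP] := Pp M N p (f \o r) ps.
by exists (g \o i) => x; apply: etrans (gP (i x)) _; rewrite /= ri.
Qed.

Lemma projective_zero P : zero_mod P -> projective P.
Proof. by move=> Pz M N p f ps; exists \0 => x /=; rewrite (Pz x) !linear0. Qed.

Lemma projective_prod P Q :
  projective P -> projective Q -> projective (prod_mod P Q).
Proof.
move=> Pp Qp M N p f ps.
have i1L : linear (fun x : P => ((x, 0) : prod_mod P Q)).
  by move=> a x y; congr pair; rewrite /= scaler0 addr0.
have i2L : linear (fun x : Q => ((0, x) : prod_mod P Q)).
  by move=> a x y; congr pair; rewrite /= scaler0 addr0.
have [g1 h1] := Pp M N p (f \o mklin i1L) ps.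
have [g2 h2] := Qp M N p (f \o mklin i2L) ps.
have [g gE] : exists g : {linear prod_mod P Q -> M},
    forall u, g u = g1 u.1 + g2 u.2.
  by apply: ex_linear => a x y /=; rewrite !linearP scalerDr addrACA.
exists g => -[x y] /=; rewrite gE linearD /=.
rewrite [p (g1 x)](h1 x) [p (g2 y)](h2 y) /= -linearD; congr (f _).
by congr pair; rewrite /= ?addr0 ?add0r.
Qed.

Definition free_basis n (i : 'I_n) : {ffun 'I_n -> R^o} := [ffun j => (i == j)%:R].

Lemma free_decomp n (f : {ffun 'I_n -> R^o}) :
  f = \sum_i (f i : R) *: free_basis i.
Proof.
apply/ffunP=> j; rewrite sum_ffunE (bigD1 j) //= !ffunE eqxx.
rewrite big1 ?addr0 => [|i ij]; last first.
  by rewrite !ffunE (negbTE ij) scaler0.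
by rewrite /GRing.scale /= mulr1.
Qed.

Lemma free_fg n : finitely_generated ({ffun 'I_n -> R^o} : lmodType R).
Proof.
by exists n, (@free_basis n) => x; exists x; exact: free_decomp.
Qed.

Definition freemod n : fgmod R := FgMod (free_fg n).

Lemma free_map_ex n (M : lmodType R) (v : 'I_n -> M) :
  exists g : {linear freemod n -> M}, forall f, g f = \sum_i (f i : R) *: v i.
Proof.
apply: ex_linear => a x y; rewrite scaler_sumr -big_split; apply: eq_bigr => i _.
by rewrite !ffunE scalerDl scalerA.
Qed.

Definition free_map n (M : lmodType R) (v : 'I_n -> M) : {linear freemod n -> M} :=
  sval (constructive_indefinite_description _ (free_map_ex v)).

Lemma free_mapE n (M : lmodType R) (v : 'I_n -> M) f :
  free_map v f = \sum_i (f i : R) *: v i.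
Proof. by rewrite /free_map; case: constructive_indefinite_description. Qed.

Lemma free_map_basis n (M : lmodType R) (v : 'I_n -> M) i :
  free_map v (free_basis i) = v i.
Proof.
rewrite free_mapE (bigD1 i) //= ffunE eqxx scale1r big1 ?addr0 // => j ji.
by rewrite ffunE eq_sym (negbTE ji) scale0r.
Qed.

Lemma free_ext n (M : lmodType R) (f g : {linear freemod n -> M}) :
  (forall i, f (free_basis i) = g (free_basis i)) -> f =1 g.
Proof.
move=> h x; rewrite [x]free_decomp !linear_sum; apply: eq_bigr => i _.
by rewrite !linearZ h.
Qed.

Lemma free_projective n : projective (freemod n).
Proof.
move=> M N p f ps.
have [v vP] := choice_fun (fun i : 'I_n => ps (f (free_basis i))).
exists (free_map v); apply: (free_ext (f := p \o free_map v)) => i /=.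
by rewrite free_map_basis vP.
Qed.

Lemma fg_free_surj (M : fgmod R) : exists n (g : {linear freemod n -> M}),
  forall y, exists x, g x = y.
Proof.
have [n [v vP]] := fgmodP M; exists n, (free_map v) => y.
have [c ->] := vP y; exists [ffun i => c i].
by rewrite free_mapE; apply: eq_bigr => i _; rewrite ffunE.
Qed.

Lemma projective_free_retract P : projective P ->
  exists n (i : {linear P -> freemod n}) (r : {linear freemod n -> P}),
    forall x, r (i x) = x.
Proof.
move=> Pp; have [n [g gs]] := fg_free_surj P.
have [|i iP] := @projective_lift P (freemod n) P g idfun Pp; first by move=> x; exact: gs.
by exists n, i, g.
Qed.

End Projectives.

(** * Uniform vanishing of Ext over rings of finite length *)

Arguments pr_proj {R M} p n : rename.
Arguments pr_exactS {R M} p n : rename.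
Arguments pr_exact0 {R M} p : rename.
Arguments pr_surj {R M} p : rename.
Arguments ir_injective {R M} i n : rename.
Arguments ir_exactS {R M} i n : rename.
Arguments ir_exact0 {R M} i : rename.
Arguments ir_inj {R M} i : rename.

Definition subfg (R : nzRingType) (H : noeth R) (M : fgmod R) (W : subm M) :
  fgmod R := FgMod (H M W).

Section Subfg.
Variables (R : nzRingType) (H : noeth R) (M : fgmod R) (W : subm M).

Definition subfg_inc : {linear subfg H W -> M} := @subm_inc _ _ W.

Lemma subfg_inc_inj : injective subfg_inc. Proof. exact: subm_inc_inj. Qed.

Lemma subfg_incP y : W (subfg_inc y).
Proof. exact: (@subm_incP _ _ W y). Qed.

Lemma subfg_incK x : W x -> exists y, subfg_inc y = x.
Proof. exact: subm_incK. Qed.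

Lemma subfg_corestr (N : fgmod R) (f : {linear N -> M}) : (forall x, W (f x)) ->
  exists g : {linear N -> subfg H W}, forall x, subfg_inc (g x) = f x.
Proof. exact: (@subm_corestr _ _ W N f). Qed.
End Subfg.
Arguments subfg_inc {R H M W}.

Definition smle (R : pzRingType) (M : lmodType R) (U W : subm M) :=
  forall x, U x -> W x.
Definition smlt (R : pzRingType) (M : lmodType R) (U W : subm M) :=
  smle U W /\ exists x, W x /\ ~ U x.

(** A bounded, strictly monotone rank on submodules stands in for a composition series. Over a
    finite-dimensional algebra it will be the dimension of the preimage in a free cover. *)
Definition finite_length (R : pzRingType) (M : lmodType R) :=
  exists (l : subm M -> nat) (L : nat),
    (forall U W, smlt U W -> (l U < l W)%N) /\ forall U, (l U <= L)%N.

Definition maximal_in (R : pzRingType) (M : lmodType R) (U W : subm M) :=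
  smlt U W /\ forall V, smle U V -> smlt V W -> smle V U.

Lemma smle_nlt (R : pzRingType) (M : lmodType R) (U W : subm M) :
  smle U W -> ~ smlt U W -> smle W U.
Proof.
move=> UW nUW x Wx; apply: NNPP => nUx; apply: nUW; split=> //.
by exists x.
Qed.

Lemma ex_maximal (R : pzRingType) (M : lmodType R) (U W : subm M) :
  finite_length M -> smlt U W -> exists V, maximal_in V W.
Proof.
case=> l [L [lS lL]].
have [k] : exists k, (L - l U <= k)%N by exists (L - l U)%N.
elim: k U => [|k IH] U.
  move=> hk UW; have := lS _ _ UW; have := lL W; lia.
move=> hk UW; case: (classic (exists V, smlt U V /\ smlt V W)) => [[V [UV VW]]|h].
  by apply: (IH V) => //; have := lS _ _ UV; have := lL V; lia.
exists U; split=> // V UV VW; apply: smle_nlt => // UV'.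
by apply: h; exists V.
Qed.

(** * Vanishing of Ext along an exact sequence of projectives *)

Section Chain.
Variables (R : nzRingType) (P : nat -> fgmod R).
Variable d : forall n, {linear P n.+1 -> P n}.
Hypothesis Pp : forall n, projective (P n).
Hypothesis Pex : forall n, exact_at (d n.+1) (d n).
Arguments Pp : clear implicits.
Arguments Pex : clear implicits.

(* For a projective resolution P of M this says Ext^{n+1}(M, N) = 0. *)
Definition ext_vanish (n : nat) (N : fgmod R) :=
  forall phi : {linear P n.+1 -> N}, (forall x, phi (d n.+1 x) = 0) ->
  exists psi : {linear P n -> N}, forall x, phi x = psi (d n x).

Lemma chain_dd n x : d n (d n.+1 x) = 0.
Proof. exact: exact_comp0 (Pex n) x. Qed.

Lemma chain_factor n (I : fgmod R) (phi : {linear P n.+1 -> I}) :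
  (forall x, phi (d n.+1 x) = 0) -> forall x, d n x = 0 -> phi x = 0.
Proof. by move=> h x /Pex[y <-]. Qed.

Lemma ext_vanish_injres N (I : injective_resolution N) D :
  (forall n, (D < n)%N -> zero_mod (I n)) ->
  forall n, (D <= n)%N -> ext_vanish n N.
Proof.
move=> Iz.
(* Dimension shifting: maps into the kernel of [ir_d I j] have values in the [j]-th cosyzygy of [N].
   Trading [n.+1, j] for [n, j.+1] leads to [n = 0], where [I j.+1] is zero. *)
have key n : forall j, (D <= n + j)%N -> forall phi : {linear P n.+1 -> I j},
    (forall x, ir_d I j (phi x) = 0) -> (forall x, phi (d n.+1 x) = 0) ->
    exists psi : {linear P n -> I j},
      (forall x, ir_d I j (psi x) = 0) /\ forall x, phi x = psi (d n x).
  elim: n => [|n IH] j hj phi cphi zphi.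
    have [chi chiE] := injective_extend (ir_injective I j) (chain_factor zphi).
    by exists chi; split=> // x; apply: Iz; lia.
  have [chi chiE] := injective_extend (ir_injective I j) (chain_factor zphi).
  have hj' : (D <= n + j.+1)%N by lia.
  have [||om [com omE]] := IH j.+1 hj' (ir_d I j \o chi).
  - by move=> x /=; exact: exact_comp0 (ir_exactS I j) _.
  - by move=> x /=; rewrite chiE cphi.
  have [|om' om'E] := @projective_lift _ _ _ _ (ir_d I j) om (Pp n).
    by move=> x; have /ir_exactS[y <-] := com x; exists y.
  (* The correction moves [chi] into the kernel of [ir_d I j] and vanishes after composition with
     [d n.+1]. *)
  exists (chi \- (om' \o d n)); split=> x /=.
    by rewrite linearB om'E -omE /= subrr.
  by rewrite chain_dd linear0 subr0 chiE.
move=> n Dn phi zphi.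
have Dn0 : (D <= n + 0)%N by rewrite addn0.
have [||psi [cpsi psiE]] := key n 0%N Dn0 (ir_aug I \o phi).
- by move=> x /=; exact: exact_comp0 (ir_exact0 I) _.
- by move=> x /=; rewrite zphi linear0.
have [|psi' psi'E] := @projective_lift _ _ _ _ (ir_aug I) psi (Pp n).
  by move=> x; have /ir_exact0[y <-] := cpsi x; exists y.
by exists psi' => x; apply: (ir_inj I); rewrite psi'E -psiE.
Qed.

Lemma ext_vanish_retract n (M N : fgmod R) (i : {linear N -> M})
  (r : {linear M -> N}) : (forall x, r (i x) = x) ->
  ext_vanish n M -> ext_vanish n N.
Proof.
move=> ri EM phi zphi; have [|psi psiE] := EM (i \o phi).
  by move=> x /=; rewrite zphi linear0.
by exists (r \o psi) => x /=; rewrite -psiE /= ri.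
Qed.

Lemma ext_vanish_free n k : ext_vanish n (regular_mod R) -> ext_vanish n (freemod R k).
Proof.
move=> E phi zphi.
have [c cE] : exists c : 'I_k -> {linear freemod R k -> regular_mod R},
    forall i f, c i f = f i.
  apply: (choice_fun (rho := fun i (c : {linear freemod R k -> regular_mod R}) =>
     forall f, c f = f i)) => i.
  by apply: ex_linear => a x y; rewrite !ffunE.
have [i|psi psiE] := choice_fun (rho := fun i (psi : {linear P n -> regular_mod R})
   => forall x, c i (phi x) = psi (d n x)).
  have [|psi psiE] := E (c i \o phi); last by exists psi.
  by move=> x /=; rewrite zphi linear0.
have [g gE] : exists g : {linear P n -> freemod R k}, forall x, g x = [ffun i => psi i x].
  by apply: ex_linear => a x y; apply/ffunP=> i; rewrite !ffunE linearP.
by exists g => x; apply/ffunP=> i; rewrite gE ffunE -psiE cE.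
Qed.

Lemma ext_vanish_projective n Q :
  ext_vanish n (regular_mod R) -> projective Q -> ext_vanish n Q.
Proof.
move=> E /projective_free_retract[k [i [r ri]]].
by apply: (ext_vanish_retract ri); apply: ext_vanish_free.
Qed.

(** The corestriction of [d n] to its image is a cocycle, and extending it along [d n] is the same
    as retracting [P n] onto that image. *)
Lemma syzygy_split n : ext_vanish n (image_mod (d n)) ->
  exists psi : {linear P n -> image_mod (d n)}, forall y, psi (image_inc y) = y.
Proof.
move=> E.
have [g gE] := image_corestr (d n).
have [|psi psiE] := E g.
  by move=> x; apply: image_inc_inj; rewrite gE chain_dd linear0.
exists psi => y; have [x e] := image_incP y.
by rewrite -e -psiE; apply: image_inc_inj; rewrite gE.
Qed.

Lemma syzygy_projective n :
  ext_vanish n (image_mod (d n)) -> projective (image_mod (d n)).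
Proof.
move=> /syzygy_split[psi psiE].
apply: (projective_retract psiE); exact: Pp.
Qed.

(** The retraction splits 0 -> im(d n) -> P n -> N -> 0 at both ends; the section sends [e p] to [p]
    minus its component in the image. *)
Lemma cosyzygy_projective n (N : fgmod R) (e : {linear P n -> N}) :
  ext_vanish n (image_mod (d n)) -> surjective_map e -> exact_at (d n) e ->
  projective N.
Proof.
move=> /syzygy_split[psi psiE] es ex.
have [s sP] : exists s : {linear N -> P n},
    forall y, exists p, y = e p /\ s y = p - image_inc (psi p).
  apply: (linear_of_rel (rho := fun y z =>
            exists p, y = e p /\ z = p - image_inc (psi p))).
  - by move=> y; have [p <-] := es y; exists (p - image_inc (psi p)), p.
  - move=> a y y' z z' [p [-> ->]] [p' [-> ->]]; exists (a *: p + p').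
    split; first by rewrite linearP.
    have -> : psi (a *: p + p') = a *: psi p + psi p' by rewrite linearP.
    have -> : image_inc (a *: psi p + psi p') =
      a *: image_inc (psi p) + image_inc (psi p') by rewrite linearP.
    by rewrite scalerBr opprD addrACA.
  - move=> z [p [/esym/ex[q qE] ->]].
    have [t tE] := image_corestr (d n).
    by rewrite -qE -tE psiE subrr.
apply: (projective_retract (i := s) (r := e)) (Pp n) => y.
have [p [-> ->]] := sP y; rewrite linearB.
have [q <-] := image_incP (psi p).
by rewrite (exact_comp0 ex) subr0.
Qed.

Definition ext_vanish_sub n (M : fgmod R) (N : subm M) :=
  forall phi : {linear P n.+1 -> M}, (forall x, N (phi x)) ->
    (forall x, phi (d n.+1 x) = 0) ->
  exists psi : {linear P n -> M},
    (forall x, N (psi x)) /\ forall x, phi x = psi (d n x).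

(** Ext vanishing with coefficients in [N1 / N2]. Maps from projectives to a quotient lift, so
    everything is phrased with maps into [M] and congruences modulo [N2]. *)
Definition ext_vanish_quo n (M : fgmod R) (N1 N2 : subm M) :=
  forall phi : {linear P n.+1 -> M}, (forall x, N1 (phi x)) ->
    (forall x, N2 (phi (d n.+1 x))) ->
  exists psi : {linear P n -> M},
    (forall x, N1 (psi x)) /\ forall x, N2 (phi x - psi (d n x)).

Variable nth : noeth R.
Hypothesis fl : forall M : fgmod R, finite_length M.

Lemma ext_vanish_subfg n (M : fgmod R) (N : subm M) :
  ext_vanish n (subfg nth N) -> ext_vanish_sub n N.
Proof.
move=> E phi Nphi zphi.
have [g gE] := subfg_corestr nth Nphi.
have [|psi psiE] := E g.
  by move=> x; apply: subfg_inc_inj; rewrite gE zphi linear0.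
exists (subfg_inc \o psi); split=> x /=; first exact: subfg_incP.
by rewrite -psiE gE.
Qed.

(** Multiplication by [x] identifies [W / W'] with [N1 / N2], and the piece Ext^{n+1}(W) ->
    Ext^{n+1}(W/W') -> Ext^{n+2}(W') of the long exact sequence is run by hand: lift [phi] to [h] in
    [W], subtract [chi] in [W'] to get a cocycle, extend that in [W]. *)
Lemma ext_vanish_quo_cyclic n (M : fgmod R) (N1 N2 : subm M) (x : M)
    (W W' : subm (regular_mod R)) :
  (forall w, W w -> N1 ((w : R) *: x)) ->
  (forall y, N1 y -> exists w, W w /\ N2 (y - (w : R) *: x)) ->
  (forall w, W' w -> W w /\ N2 ((w : R) *: x)) ->
  (forall w, W w -> N2 ((w : R) *: x) -> W' w) ->
  ext_vanish_sub n W -> ext_vanish_sub n.+1 W' -> ext_vanish_quo n N1 N2.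
Proof.
move=> WN1 sur W'W WW' EW EW' phi phi1 phi2.
have [f fE] : exists f : {linear prod_mod (subfg nth W) (subfg nth N2) -> M},
    forall u, f u = (subfg_inc u.1 : R) *: x + subfg_inc u.2.
  apply: ex_linear => a u v; rewrite /= !linearP scalerDr scalerDl addrACA.
  by rewrite scalerA.
have [|g gE] := @projective_lift _ _ _ _ f phi (Pp n.+1).
  move=> p; have [w [Ww N2w]] := sur _ (phi1 p).
  have [u uE] := subfg_incK nth Ww; have [v vE] := subfg_incK nth N2w.
  by exists (u, v); rewrite fE /= uE vE addrC subrK.
pose h : {linear P n.+1 -> regular_mod R} := subfg_inc \o (fst \o g).
have hW p : W (h p) by exact: subfg_incP.
have hE p : N2 (phi p - (h p : R) *: x).
  by rewrite -gE fE addrC addKr; exact: subfg_incP.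
have [||chi [W'chi chiE]] := EW' (h \o d n.+1).
- move=> p; apply: WW'; first exact: hW.
  by have := smB (phi2 p) (hE (d n.+1 p)); rewrite subKr.
- by move=> p; apply: etrans (congr1 h (chain_dd _)) (linear0 h).
have [||psi [Wpsi psiE]] := EW (h \- chi).
- move=> p; apply: smB; first exact: hW.
  by have [] := W'W _ (W'chi p).
- by move=> p; rewrite /= -chiE subrr.
have [psx psxE] : exists psx : {linear P n -> M}, forall p, psx p = (psi p : R) *: x.
  apply: ex_linear => a p q; rewrite linearP.
  by rewrite scalerDl -scalerA.
exists psx; split=> p; first by rewrite psxE; exact: WN1.
have [_ N2chi] := W'W _ (W'chi p).
rewrite psxE -psiE scalerBl opprB addrCA addrC -addrA addrA addrAC.
have := smD (hE p) N2chi; congr (N2 _).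
by rewrite addrAC.
Qed.

(* Every simple module is a quotient W/W' of right ideals of R, so that induction on W
   yields one bound for all simple modules. *)
Lemma ext_vanish_quo_uniform :
  (forall W : subm (regular_mod R), exists n0, forall n, (n0 <= n)%N ->
      ext_vanish n (subfg nth W)) ->
  exists n0, forall n, (n0 <= n)%N ->
    forall (M : fgmod R) (N1 N2 : subm M) (x : M), maximal_in N2 N1 ->
    N1 x -> ~ N2 x -> ext_vanish_quo n N1 N2.
Proof.
move=> EW.
have [l [L [lS lL]]] := fl (regular_mod R).
have key k : forall W : subm (regular_mod R), (l W < k)%N ->
    exists n0, forall n, (n0 <= n)%N ->
    forall (M : fgmod R) (N1 N2 : subm M) (x : M), maximal_in N2 N1 ->
    (forall w, W w -> N1 ((w : R) *: x)) ->
    (exists w, W w /\ ~ N2 ((w : R) *: x)) -> ext_vanish_quo n N1 N2.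
  elim: k => [//|k IH] W lW.
  pose Z : subm (regular_mod R) := ker_subm idfun.
  case: (classic (smlt Z W)) => [ZW|nZW]; last first.
    exists 0%N => n _ M N1 N2 x _ _ [w [Ww nN2]]; case: nN2.
    have /(_ w Ww) w0 : smle W Z.
      by apply: smle_nlt => // y /= ->; exact: sm0.
    by rewrite (w0 : w = 0) scale0r; exact: sm0.
  have [W' [W'W W'max]] := ex_maximal (fl _) ZW.
  have [|n1 n1P] := IH W'; first by have := lS _ _ W'W; lia.
  have [nW nWP] := EW W; have [nW' nW'P] := EW W'.
  (* The bound is fixed before [M], [N1], [N2] and [x] enter; this is the uniformity. *)
  exists (maxn n1 (maxn nW nW')) => n; rewrite !geq_max => /and3P[hn1 hnW hnW'].
  move=> M N1 N2 x [N21 N2max] WN1 [w [Ww nN2w]].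
  (* Either [W'] still moves [x] outside [N2] and the induction takes over, or, by maximality, [W']
     is the whole kernel of multiplication by [x] from [W] to [N1 / N2]. *)
  case: (classic (exists w, W' w /\ ~ N2 ((w : R) *: x))) => [h|h].
    by apply: (n1P n hn1 M N1 N2 x) => // v /(proj1 W'W)/WN1.
  have W'N2 v : W' v -> N2 ((v : R) *: x).
    by move=> W'v; apply: NNPP => nN2; apply: h; exists v.
  apply: (@ext_vanish_quo_cyclic n M N1 N2 x W W') => //.
  - move=> y N1y; apply: NNPP => ny.
    (* [V] is [N2 + W x]. If it missed [y], maximality of [N2] would force [V] into [N2], against
       the choice of [w]. *)
    have Vsub : exists V : subm M, forall z, V z <->
        exists v, W v /\ N2 (z - (v : R) *: x).
      have V0 : exists v, W v /\ N2 (0 - (v : R) *: x).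
        by exists 0; split; [exact: sm0|rewrite scale0r subr0; exact: sm0].
      have VL a z z' : (exists v, W v /\ N2 (z - (v : R) *: x)) ->
          (exists v, W v /\ N2 (z' - (v : R) *: x)) ->
          exists v, W v /\ N2 (a *: z + z' - (v : R) *: x).
        move=> [v [Wv N2v]] [v' [Wv' N2v']]; exists (a *: v + v').
        split; first exact: smL.
        rewrite scalerDl opprD addrACA -scalerA -scalerBr; exact: smL.
      by exists (Subm (sm_pred := fun z => exists v, W v /\ N2 (z - (v : R) *: x)) V0 VL).
    have [V VE] := Vsub.
    apply: nN2w; apply: (N2max V).
    + move=> z N2z; apply/VE; exists 0.
      by split; [exact: sm0|rewrite scale0r subr0].
    + split; last by exists y; split=> //; move/VE.
      move=> z /VE[v [Wv N2v]]; rewrite -[z](subrK ((v : R) *: x)).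
      by apply: smD; [apply: (proj1 N21)|exact: WN1].
    + by apply/VE; exists w; split=> //; rewrite subrr; exact: sm0.
  - by move=> v W'v; split; [exact: (proj1 W'W)|exact: W'N2].
  - have [V VE] : exists V : subm (regular_mod R), forall v, V v <->
        W v /\ N2 ((v : R) *: x).
      have V0 : W 0 /\ N2 ((0 : R) *: x).
        by split; [exact: sm0|rewrite scale0r; exact: sm0].
      have VL a z z' : (W z /\ N2 ((z : R) *: x)) ->
          (W z' /\ N2 ((z' : R) *: x)) ->
          W (a *: z + z') /\ N2 ((a *: z + z' : R) *: x).
        move=> [Wz N2z] [Wz' N2z']; split; first exact: smL.
        rewrite scalerDl -scalerA; exact: smL.
      by exists (Subm (sm_pred := fun v => W v /\ N2 ((v : R) *: x)) V0 VL).
    move=> v Wv N2v; apply: (W'max V).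
    + by move=> u W'u; apply/VE; split; [exact: (proj1 W'W)|exact: W'N2].
    + by split=> [u /VE[]//|]; exists w; split=> // /VE[].
    + by apply/VE.
  - by apply: ext_vanish_subfg; apply: nWP.
  - by apply: ext_vanish_subfg; apply: nW'P; lia.
pose T : subm (regular_mod R) := @ker_subm _ _ (regular_mod R) \0.
have [n0 n0P] := key _ T (ltnSn _).
exists n0 => n hn M N1 N2 x mx N1x nN2x; apply: (n0P n hn M N1 N2 x) => //.
- by move=> w _; exact: smZ.
- by exists 1; split=> //; rewrite scale1r.
Qed.

(** Descent along a composition series of [M]: solve modulo a maximal submodule [N'], then treat the
    error, which has values in [N']. The bound for simple subquotients is independent of [M] and
    does not change on the way. *)
Lemma ext_vanish_uniform :
  (forall W : subm (regular_mod R), exists n0, forall n, (n0 <= n)%N ->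
      ext_vanish n (subfg nth W)) ->
  exists n0, forall n, (n0 <= n)%N -> forall N : fgmod R, ext_vanish n N.
Proof.
move=> /ext_vanish_quo_uniform[n0 n0P]; exists n0 => n hn M.
have [l [L [lS lL]]] := fl M.
have key k : forall N : subm M, (l N < k)%N -> ext_vanish_sub n N.
  elim: k => [//|k IH] N lN phi Nphi zphi.
  pose Z : subm M := ker_subm idfun.
  case: (classic (smlt Z N)) => [ZN|nZN]; last first.
    exists \0; split=> [x|x /=]; first exact: sm0.
    suff: smle N Z by apply.
    by apply: smle_nlt => // y /= ->; exact: sm0.
  have [N' mN'] := ex_maximal (fl _) ZN.
  have [N'N [x [Nx nN'x]]] := proj1 mN'.
  have [|psi [Npsi psiE]] := n0P n hn M N N' x mN' Nx nN'x phi Nphi.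
    by move=> y; rewrite zphi; exact: sm0.
  have lN' : (l N' < k)%N by have := lS _ _ (proj1 mN'); lia.
  have [||psi' [N'psi' psi'E]] := IH N' lN' (phi \- (psi \o d n)).
  - by [].
  - by move=> y /=; rewrite zphi chain_dd linear0 subr0.
  exists (psi \+ psi'); split=> y /=.
    by apply: smD => //; exact: N'N.
  by rewrite -psi'E /= addrC subrK.
move=> phi zphi.
pose T : subm M := @ker_subm _ _ (regular_mod R) \0.
have [||psi [_ psiE]] := key _ T (ltnSn _) phi => //.
by exists psi.
Qed.

End Chain.

(** * Finite-dimensional algebras *)

(** Starting from 0, missing vectors are adjoined until none is left; the codimension bounds the
    number of steps. *)
Lemma vspace_of_pred (K : fieldType) (V : vectType K) (p : V -> Prop) :
  p 0 -> (forall a x y, p x -> p y -> p (a *: x + y)) ->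
  exists U : {vspace V}, forall v, v \in U <-> p v.
Proof.
move=> p0 pL.
suff key k : forall U : {vspace V}, (forall v, v \in U -> p v) ->
    (\dim {:V} - \dim U <= k)%N -> exists U : {vspace V}, forall v, v \in U <-> p v.
  apply: (key (\dim {:V}) 0%VS) => [v|]; last exact: leq_subr.
  by rewrite memv0 => /eqP->.
elim: k => [|k IH] U pU hk.
  exists U => v; split; first exact: pU.
  have -> : U = fullv.
    by apply/eqP; rewrite -(geq_leqif (dimv_leqif_eq (subvf U))) -subn_eq0 -leqn0.
  by rewrite memvf.
case: (classic (exists v, p v /\ v \notin U)) => [[v [pv nUv]]|h].
  apply: (IH (U + <[v]>)%VS).
    move=> _ /memv_addP[u Uu [w /vlineP[a ->] ->]].
    by rewrite addrC; apply: pL => //; exact: pU.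
  have : (\dim U < \dim (U + <[v]>))%N.
    rewrite (ltn_leqif (dimv_leqif_eq (addvSl U _))); apply: contraNneq nUv => ->.
    exact: (subvP (addvSr _ _)) _ (memv_line v).
  have := dimvS (subvf (U + <[v]>)%VS); lia.
exists U => v; split; first exact: pU.
by move=> pv; apply/negPn/negP => nUv; apply: h; exists v.
Qed.

(* A ring B that is, along tau, a finite-dimensional vector space on which the scalars
   act by left multiplications; both A and its converse ring are of this kind. *)
Section FiniteDimensional.
Variables (K : fieldType) (A : vectType K) (B : nzRingType).
Variables (iota : K -> B) (tau : A -> B) (sig : B -> A).
Hypothesis sigK : cancel sig tau.
Hypothesis tauD : forall x y, tau (x + y) = tau x + tau y.
Hypothesis tauZ : forall a x, tau (a *: x) = iota a * tau x.

Definition to_freemod n (v : {ffun 'I_n -> A}) : freemod B n :=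
  [ffun i => (tau (v i) : B^o)].

Lemma to_freemodP n a (u v : {ffun 'I_n -> A}) :
  to_freemod (a *: u + v) = iota a *: to_freemod u + to_freemod v.
Proof. by apply/ffunP=> i; rewrite !ffunE tauD tauZ. Qed.

Lemma to_freemod_surj n (f : freemod B n) : exists v, to_freemod v = f.
Proof. by exists [ffun i => sig (f i)]; apply/ffunP=> i; rewrite !ffunE sigK. Qed.

Lemma to_freemod0 n : to_freemod (0 : {ffun 'I_n -> A}) = 0.
Proof.
have tau0 : tau 0 = 0 by apply: (@addrI _ (tau 0)); rewrite -tauD !addr0.
by apply/ffunP=> i; rewrite !ffunE.
Qed.

Lemma subm_vspace n (M : lmodType B) (g : {linear freemod B n -> M}) (W : subm M) :
  exists U : {vspace {ffun 'I_n -> A}}, forall v, v \in U <-> W (g (to_freemod v)).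
Proof.
apply: vspace_of_pred; first by rewrite to_freemod0 linear0; exact: sm0.
by move=> a x y Wx Wy; rewrite to_freemodP linearP; exact: smL.
Qed.

(** A vector space basis of the preimage of [W] in a free cover maps to generators of [W]. *)
Lemma finite_dim_noeth : noeth B.
Proof.
move=> M W; have [n [g gs]] := fg_free_surj M.
have [U UE] := subm_vspace g W.
have bW (i : 'I_(\dim U)) :
    exists y : subm_sort W, subm_inc y = g (to_freemod (vbasis U)`_i).
  by apply/subm_incK/UE/vbasis_mem/mem_nth; rewrite size_tuple.
have [y yE] := choice_fun bW.
exists (\dim U), y => x; have [f fE] := gs (subm_inc x).
have [v vE] := to_freemod_surj f.
have Uv : v \in U by apply/UE; rewrite vE fE; exact: subm_incP.
exists (fun i => iota (coord (vbasis U) i v)).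
apply: subm_inc_inj; rewrite -fE -vE {1}(coord_vbasis Uv) [RHS]linear_sum.
have sumE (I : Type) (r : seq I) (c : I -> K) (b : I -> {ffun 'I_n -> A}) :
    g (to_freemod (\sum_(i <- r) c i *: b i)) =
    \sum_(i <- r) iota (c i) *: g (to_freemod (b i)).
  elim: r => [|i r IH]; first by rewrite !big_nil to_freemod0 linear0.
  by rewrite !big_cons to_freemodP linearP IH.
rewrite (sumE 'I_(\dim U)); apply: eq_bigr => i _.
by rewrite linearZ yE.
Qed.

Lemma finite_dim_length (M : fgmod B) : finite_length M.
Proof.
have [n [g gs]] := fg_free_surj M.
have [U UE] := choice_fun (subm_vspace g).
exists (fun W => \dim (U W)), (\dim {:{ffun 'I_n -> A}}).
split=> [W W' [WW' [x [W'x nWx]]]|W]; last exact/dimvS/subvf.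
have sUU : (U W <= U W')%VS by apply/subvP=> v /UE/WW'/UE.
rewrite (ltn_leqif (dimv_leqif_sup sUU)); apply/subvP=> sU'U.
have [f fE] := gs x; have [v vE] := to_freemod_surj f.
apply: nWx; rewrite -fE -vE; apply/UE/sU'U/UE.
by rewrite vE fE.
Qed.

End FiniteDimensional.

(** * Unbounded complexes *)

Lemma int_succ (j : int) : exists i : int, j = i + 1.
Proof. by exists (j - 1); rewrite subrK. Qed.

(** [i - 1 + 1] is not convertible to [i]. The transport is confined to this proof, so that families
    known in degrees [i + 1] can be used in all degrees. *)
Lemma reindex_succ (T : int -> Type) (f : forall i, T (i + 1)) :
  exists h : forall j, T j, forall i, h (i + 1) = f i.
Proof.
exists (fun j => eq_rect (j - 1 + 1) T (f (j - 1)) j (subrK 1 j)) => i.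
have gen k (ek : k = i) (e : k + 1 = i + 1) : eq_rect (k + 1) T (f k) (i + 1) e = f i.
  by subst k; rewrite (eq_irrelevance e erefl).
by apply: gen; rewrite addrK.
Qed.

(** Dependent choice towards decreasing degrees. The [n]-th approximation is correct from degree
    [b - n] on and is not altered there later, so reading degree [i] at stage [absz (b - i)] gives a
    well-defined limit. *)
Lemma downward_choice (T : int -> Type) (C : forall i, T i -> T (i + 1) -> Prop)
    (t0 : forall i, T i) (b : int) :
  (forall i : int, (b <= i)%R -> C i (t0 i) (t0 (i + 1))) ->
  (forall i (y : T (i + 1)) (z : T (i + 1 + 1)), C (i + 1) y z ->
     exists x, C i x y) ->
  exists t : forall i, T i, (forall i, C i (t i) (t (i + 1))) /\
    forall i, (b <= i)%R -> t i = t0 i.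
Proof.
move=> C0 step.
pose good (n : nat) (t : forall i, T i) := forall i : int, (b - n%:Z <= i)%R -> C i (t i) (t (i + 1)).
have next n t : good n t -> exists t', good n.+1 t' /\
    forall i : int, (b - n%:Z <= i)%R -> t' i = t i.
  move=> gt; pose i0 : int := b - n%:Z - 1.
  have [x xP] : exists x, C i0 x (t (i0 + 1)).
    by apply: (step i0 (t (i0 + 1)) (t (i0 + 1 + 1))); apply: gt; rewrite /i0; lia.
  exists (dfwith t x); split=> [i hi|i hi]; last first.
    by rewrite dfwith_out // /i0; lia.
  rewrite (@dfwith_out _ _ t i0 x (i + 1)); last by rewrite /i0; lia.
  have [e|ne] := eqVneq i0 i; last by rewrite dfwith_out //; apply: gt; move: ne; rewrite /i0; lia.
  by subst i; rewrite dfwith_in.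
pose st n := {t : forall i, T i | good n t}.
have g0 : good 0%N t0 by move=> i hi; apply: C0; lia.
have nextT n (s : st n) : {s' : st n.+1 |
    forall i : int, (b - n%:Z <= i)%R -> sval s' i = sval s i}.
  apply: constructive_indefinite_description.
  by case: s => t gt; have [t' [gt' e]] := next n t gt; exists (exist _ t' gt').
pose s := fix s n : st n :=
  if n is n'.+1 then sval (nextT n' (s n')) else exist _ t0 g0.
have sE n m i : (b - n%:Z <= i)%R -> sval (s (n + m)%N) i = sval (s n) i.
  move=> hi; elim: m => [|m IH]; first by rewrite addn0.
  rewrite addnS -IH /=; case: (nextT _ _) => s' /= e; apply: e; lia.
pose N (i : int) : nat := absz (b - i).
have NP i : (b - (N i)%:Z <= i)%R by rewrite /N; lia.
exists (fun i => sval (s (N i)) i); split=> i; last first.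
  by move=> bi; apply: (sE 0%N (N i) i); lia.
pose m := (N i + N (i + 1)%R)%N.
have e1 : sval (s (N i)) i = sval (s m) i by rewrite sE.
have e2 : sval (s (N (i + 1)%R)) (i + 1) = sval (s m) (i + 1).
  by rewrite /m addnC sE.
by rewrite e1 e2; apply: (svalP (s m)); rewrite /m; have := NP i; lia.
Qed.

Section UnboundedComplexes.
Variable R : nzRingType.

(** [cplx] has boundedness built in, whereas projective resolutions of complexes are unbounded
    below. *)
Record ucplx := UCplx {
  umod :> int -> fgmod R;
  ud : forall i : int, {linear umod i -> umod (i + 1)};
  udd : forall i x, ud (i + 1) (ud i x) = 0
}.

Record ucmap (X Y : ucplx) := UCMap {
  ufun :> forall i : int, {linear X i -> Y i};
  ufunP : forall i x, ufun (i + 1) (ud X i x) = ud Y i (ufun i x)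
}.

Definition ucplx_of (X : cplx R) : ucplx := UCplx (@cdd R X).
Coercion ucplx_of : cplx >-> ucplx.

Definition ucmap_of (X Y : cplx R) (f : cmap X Y) : ucmap X Y :=
  @UCMap X Y f (cfunP f).
Coercion ucmap_of : cmap >-> ucmap.

Definition cmap_of (X Y : cplx R) (f : ucmap X Y) : cmap X Y :=
  @CMap R X Y f (@ufunP _ _ f).

Implicit Types X Y Z D : ucplx.

Definition uhom X Y (f g : ucmap X Y) :=
  exists h : forall i : int, {linear X (i + 1) -> Y i},
    forall i (x : X (i + 1)),
      f (i + 1) x - g (i + 1) x = ud Y i (h i x) + h (i + 1) (ud X (i + 1) x).

Definition unull X Y (f : ucmap X Y) :=
  exists h : forall i : int, {linear X (i + 1) -> Y i},
    forall i (x : X (i + 1)),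
      f (i + 1) x = ud Y i (h i x) + h (i + 1) (ud X (i + 1) x).

Definition uid X : ucmap X X := @UCMap X X (fun i => idfun) (fun _ _ => erefl).

Lemma ucomp_subproof X Y Z (g : ucmap Y Z) (f : ucmap X Y) i x :
  g (i + 1) (f (i + 1) (ud X i x)) = ud Z i (g i (f i x)).
Proof. by rewrite !ufunP. Qed.

Definition ucomp X Y Z (g : ucmap Y Z) (f : ucmap X Y) : ucmap X Z :=
  @UCMap X Z (fun i => g i \o f i) (ucomp_subproof g f).

Lemma uzero_subproof X Y i (x : X i) : 0 = ud Y i 0.
Proof. by rewrite linear0. Qed.

Definition uzero X Y : ucmap X Y := @UCMap X Y (fun i => \0) (@uzero_subproof X Y).

Lemma usub_subproof X Y (f g : ucmap X Y) i x :
  f (i + 1) (ud X i x) - g (i + 1) (ud X i x) = ud Y i (f i x - g i x).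
Proof. by rewrite !ufunP linearB. Qed.

Definition usub X Y (f g : ucmap X Y) : ucmap X Y :=
  @UCMap X Y (fun i => f i \- g i) (usub_subproof f g).

Lemma ush_dd X i (x : X (i + 1)) : - ud X (i + 1 + 1) (- ud X (i + 1) x) = 0.
Proof. by rewrite linearN opprK udd. Qed.

Definition ush X : ucplx :=
  @UCplx (fun i => X (i + 1)) (fun i => \- ud X (i + 1)) (@ush_dd X).

Lemma ush_map_subproof X Y (f : ucmap X Y) i (x : X (i + 1)) :
  f (i + 1 + 1) (- ud X (i + 1) x) = - ud Y (i + 1) (f (i + 1) x).
Proof. by rewrite linearN ufunP. Qed.

Definition ush_map X Y (f : ucmap X Y) : ucmap (ush X) (ush Y) :=
  @UCMap (ush X) (ush Y) (fun i => f (i + 1)) (ush_map_subproof f).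

Lemma uhom_eq X Y (f g : ucmap X Y) :
  (forall i x, f (i + 1) x = g (i + 1) x) -> uhom f g.
Proof. by move=> e; exists (fun=> \0) => i x /=; rewrite e linear0 subrr addr0. Qed.

Lemma uhom_refl X Y (f : ucmap X Y) : uhom f f.
Proof. exact: uhom_eq. Qed.

Lemma uhom_sym X Y (f g : ucmap X Y) : uhom f g -> uhom g f.
Proof.
case=> h hP; exists (fun i => \- h i) => i x.
by rewrite /= linearN -opprD -hP opprB.
Qed.

Lemma uhom_trans X Y (g f h : ucmap X Y) : uhom f g -> uhom g h -> uhom f h.
Proof.
case=> k kP [l lP]; exists (fun i => k i \+ l i) => i x.
by rewrite /= linearD addrACA -kP -lP addrA subrK.
Qed.

Lemma uhom_comp X Y Z (g g' : ucmap Y Z) (f f' : ucmap X Y) :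
  uhom g g' -> uhom f f' -> uhom (ucomp g f) (ucomp g' f').
Proof.
case=> k kP [l lP].
exists (fun i => (k i \o f (i + 1)) \+ (g' i \o l i)) => i x /=.
rewrite linearD addrACA (ufunP f) -kP -(ufunP g') -linearD -lP linearB.
by rewrite addrA subrK.
Qed.

Lemma uhom_compl X Y Z (g : ucmap Y Z) (f f' : ucmap X Y) :
  uhom f f' -> uhom (ucomp g f) (ucomp g f').
Proof. by move=> h; apply: uhom_comp => //; exact: uhom_refl. Qed.

Lemma uhom_compr X Y Z (g g' : ucmap Y Z) (f : ucmap X Y) :
  uhom g g' -> uhom (ucomp g f) (ucomp g' f).
Proof. by move=> h; apply: uhom_comp => //; exact: uhom_refl. Qed.

Lemma unullE X Y (f : ucmap X Y) : unull f <-> uhom f (uzero X Y).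
Proof. by split=> -[h hP]; exists h => i x; have := hP i x; rewrite /= subr0. Qed.

Lemma uhom_sub X Y (f g : ucmap X Y) : uhom f g <-> unull (usub f g).
Proof. by []. Qed.

Lemma uhom_zero_compl X Y Z (g : ucmap Y Z) : uhom (ucomp g (uzero X Y)) (uzero X Z).
Proof. by apply: uhom_eq => i x /=; rewrite linear0. Qed.

Lemma uhom_zero_compr X Y Z (f : ucmap X Y) : uhom (ucomp (uzero Y Z) f) (uzero X Z).
Proof. exact: uhom_eq. Qed.

Lemma unull_compl X Y Z (g : ucmap Y Z) (f : ucmap X Y) :
  unull f -> unull (ucomp g f).
Proof.
move=> /unullE h; apply/unullE; apply: uhom_trans (uhom_compl g h) _.
exact: uhom_zero_compl.
Qed.

Lemma unull_hom X Y (f g : ucmap X Y) : uhom f g -> unull g -> unull f.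
Proof. by move=> h /unullE h'; apply/unullE; exact: uhom_trans h h'. Qed.

Lemma ucmap_reindex X Y (f : forall i, {linear X (i + 1) -> Y (i + 1)}) :
  (forall i x, f (i + 1) (ud X (i + 1) x) = ud Y (i + 1) (f i x)) ->
  exists g : ucmap X Y, forall i x, g (i + 1) x = f i x.
Proof.
move=> fP; have [g gE] := @reindex_succ (fun j => {linear X j -> Y j}) f.
have gP i (x : X i) : g (i + 1) (ud X i x) = ud Y i (g i x).
  by have [j e] := int_succ i; subst i; rewrite !gE.
by exists (UCMap gP) => i x /=; rewrite gE.
Qed.

Lemma boundary_map X Y (h : forall i : int, {linear X (i + 1) -> Y i}) :
  exists g : ucmap X Y, forall i x,
    g (i + 1) x = ud Y i (h i x) + h (i + 1) (ud X (i + 1) x).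
Proof.
apply: (ucmap_reindex (f := fun i => (ud Y i \o h i) \+ (h (i + 1) \o ud X (i + 1)))).
by move=> i x /=; rewrite udd linear0 addr0 linearD udd add0r.
Qed.

Definition uacyclic X := forall i : int, exact_at (ud X i) (ud X (i + 1)).

(* Morphisms of D^b(mod R) are tested on maps from these complexes up to homotopy. *)
Record probe := Probe {
  probe_cplx :> ucplx;
  probe_proj : forall i, projective (probe_cplx i);
  probe_bdd : exists b : int, forall i : int, (b < i)%R -> zero_mod (probe_cplx i)
}.

(** The homotopy is built downwards from the degree above which the probe is zero. At each step the
    obstruction is a cycle of [Z], hence a boundary, and projectivity lifts it. *)
Lemma acyclic_null (D : probe) (Z : ucplx) (f : ucmap D Z) : uacyclic Z -> unull f.
Proof.
move=> Zex; have [b bP] := probe_bdd D.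
pose C i (h : {linear D (i + 1) -> Z i}) (h' : {linear D (i + 1 + 1) -> Z (i + 1)}) :=
  forall x, f (i + 1) x = ud Z i (h x) + h' (ud D (i + 1) x).
have [||h [hP _]] := @downward_choice (fun i => {linear D (i + 1) -> Z i}) C (fun i => \0) b;
  last by exists h.
  move=> i hi x /=; rewrite (bP (i + 1) _ x); last by lia.
  by rewrite !linear0 addr0.
move=> i h' h'' hP.
have [|h hE] := @projective_lift R (D (i + 1)) (Z i) (Z (i + 1)) (ud Z i)
    (f (i + 1) \- (h' \o ud D (i + 1))) (@probe_proj D _).
  move=> x; have cyc : ud Z (i + 1) (f (i + 1) x - h' (ud D (i + 1) x)) = 0.
    by rewrite linearB -ufunP hP udd linear0 addr0 subrr.
  by have [y yE] := proj1 (Zex i _) cyc; exists y.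
by exists h => x; rewrite hE /= subrK.
Qed.

Lemma probe_shift_bdd (D : probe) :
  exists b : int, forall i : int, (b < i)%R -> zero_mod (ush D i).
Proof. by have [b bP] := probe_bdd D; exists b => i hi; apply: bP; lia. Qed.

Definition psh (D : probe) : probe :=
  @Probe (ush D) (fun i => @probe_proj D (i + 1)) (probe_shift_bdd D).

Definition split_exact Y C X (i : ucmap Y C) (p : ucmap C X) :=
  exists (r : forall j, {linear C j -> Y j}) (s : forall j, {linear X j -> C j}),
    [/\ forall j x, p j (s j x) = x, forall j y, r j (i j y) = y,
        forall j y, p j (i j y) = 0
      & forall j c, c = i j (r j c) + s j (p j c)].

(** Subtracting from [f] the boundary of the null homotopy, lifted through the degreewise section,
    makes the composite with [p] zero on the nose; the result then has values in [Y]. *)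
Lemma split_exact_lift D Y C X (i : ucmap Y C) (p : ucmap C X) (f : ucmap D C) :
  split_exact i p -> unull (ucomp p f) ->
  exists f' : ucmap D Y, uhom (ucomp i f') f.
Proof.
move=> [r [s [ps ri pi dec]]] [h hP].
have [B BE] := boundary_map (fun j => s j \o h j).
pose f2 := usub f B.
have pf2 j x : p (j + 1) (f2 (j + 1) x) = 0.
  rewrite /= BE linearB linearD /= (ufunP p) !ps; have /= -> := hP j x.
  by rewrite subrr.
have if2 j x : i (j + 1) (r (j + 1) (f2 (j + 1) x)) = f2 (j + 1) x.
  by rewrite [RHS]dec pf2 linear0 addr0.
have [|f' f'E] := @ucmap_reindex D Y (fun j => r (j + 1) \o f2 (j + 1)).
  move=> j x; apply: (can_inj (ri _)).
  apply: etrans (if2 (j + 1) _) _; apply: etrans (ufunP f2 _) _.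
  by rewrite (ufunP i) /=; congr (ud C _ _); apply/esym/if2.
exists f'; apply: uhom_sym; exists (fun j => s j \o h j) => j x.
rewrite -BE /= f'E [i _ _](if2 j x) /=.
by rewrite subKr.
Qed.
End UnboundedComplexes.

(** * Covers of probes *)

Section Covers.
Variable R : nzRingType.
Implicit Types (X Y Z : ucplx R) (D E F : probe R).

(** Quasi-isomorphisms: injectivity and surjectivity on cohomology, expressed on representatives in
    degree [i + 1]. *)
Definition uqis X Y (f : ucmap X Y) :=
  (forall i (z : X (i + 1)) (y : Y i), ud X (i + 1) z = 0 ->
     f (i + 1) z = ud Y i y -> exists x, ud X i x = z) /\
  (forall i (y : Y (i + 1)), ud Y (i + 1) y = 0 ->
     exists x z, ud X (i + 1) x = 0 /\ y = f (i + 1) x + ud Y i z).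

Definition cfst (X Y : cplx R) (f : cmap X Y) i : {linear cone f i -> X (i + 1)} :=
  @fst (X (i + 1)) (Y i).
Definition csnd (X Y : cplx R) (f : cmap X Y) i : {linear cone f i -> Y i} :=
  @snd (X (i + 1)) (Y i).

Lemma acyclic_cone_qis (X Y : cplx R) (f : cmap X Y) : acyclic (cone f) <-> uqis f.
Proof.
split=> [ac|[inj sur] i].
  have cyc i (x : X (i + 1 + 1)) (y : Y (i + 1)) : cd X (i + 1 + 1) x = 0 ->
      f (i + 1 + 1) x + cd Y (i + 1) y = 0 ->
      exists x' y', - cd X (i + 1) x' = x /\ f (i + 1) x' + cd Y i y' = y.
    move=> dx fx; have cxy : cd (cone f) (i + 1) (x, y) = 0.
      by rewrite /= /cone_fun /= dx oppr0 fx.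
    have [[x' y'] e] := proj1 (ac i (x, y)) cxy.
    by exists x', y'; split; [exact: (congr1 fst e)|exact: (congr1 snd e)].
  split=> i.
    move=> z y dz fz; have [j e] := int_succ i; subst i.
    have [|x' [_ [e _]]] := cyc j z (- y) dz.
      by rewrite linearN; apply/eqP; rewrite subr_eq0; apply/eqP.
    by exists (- x'); rewrite linearN.
  move=> y dy; have [|x' [z [e1 e2]]] := cyc i 0 y (linear0 _).
    by rewrite linear0 add0r; exact: dy.
  exists x', z; split; last by rewrite -e2.
  by apply/eqP; rewrite -oppr_eq0; apply/eqP.
case=> x y; split=> [e|[u <-]]; last exact: cdd.
have /eqP dx := congr1 fst e; have fx := congr1 snd e.
rewrite /= in dx fx.
rewrite oppr_eq0 in dx; move/eqP: dx => dx.
have [|x1 x1E] := inj (i + 1) x (- y) dx.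
  by rewrite linearN; apply/eqP; rewrite -subr_eq0 opprK; apply/eqP.
have [|x2 [y2 [dx2 e2]]] := sur i (y + f (i + 1) x1).
  by rewrite linearD -(ufunP f) /= [cd X _ _]x1E; apply: etrans (addrC _ _) fx.
exists (x2 - x1, y2); congr pair; rewrite /=.
  by rewrite linearB [cd X _ x2]dx2 sub0r opprK [cd X _ x1]x1E.
apply: (@addIr _ (f (i + 1) x1)); rewrite [RHS]e2 linearB /=.
have zm (V : zmodType) (u v w : V) : u - v + w + v = u + w by rewrite addrAC subrK.
exact: zm.
Qed.

(** The first component of a null homotopy into the cone is a chain map to [X]; the second is a
    homotopy between [b] and its composite with [f]. *)
Lemma cone_lift D (X Y : cplx R) (f : cmap X Y) (b : ucmap D Y) :
  unull (ucomp (cone_incl f) b) -> exists a : ucmap D X, uhom (ucomp f a) b.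
Proof.
case=> k kP.
have e1 i x : (k (i + 1) (ud D (i + 1) x)).1 = ud X (i + 1) (k i x).1.
  have zm (V : zmodType) (u v : V) : 0 = - u + v -> v = u.
    by move/esym/eqP; rewrite addrC subr_eq0 => /eqP.
  exact: zm (congr1 fst (kP i x)).
have e2 i x : b (i + 1) x = f (i + 1) (k i x).1 + ud Y i (k i x).2
    + (k (i + 1) (ud D (i + 1) x)).2.
  exact: (congr1 snd (kP i x)).
have [a aE] := @ucmap_reindex _ D X (fun i => cfst f i \o k i) e1.
exists a; apply: uhom_sym; exists (fun i => csnd f i \o k i) => i x /=.
have zm (V : zmodType) (u v w : V) : u + v + w - u = v + w.
  by rewrite addrC -[u + v + w]addrA addKr.
by rewrite e2 aE; exact: zm.
Qed.

(** With [h] a null homotopy of the composite, [(a, - h)] is a chain map from the shift of [D] to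
    the cone. The first component of a null homotopy of its restriction is, up to sign, a null
    homotopy of the restricted [a]. *)
Lemma cone_unlift (D : ucplx R) (X Y : cplx R) (f : cmap X Y) (a : ucmap D X) :
  unull (ucomp f a) -> exists G : ucmap (ush D) (cone f),
    forall (E : ucplx R) (e : ucmap E D), unull (ucomp G (ush_map e)) ->
    unull (ucomp a e).
Proof.
case=> h hP.
have GL i : linear (fun x : D (i + 1) => ((a (i + 1) x, - h i x) : cone f i)).
  by move=> c x y; congr pair; rewrite !linearP //= opprD scalerN.
have GP i (x : ush D i) : mklin (GL (i + 1)) (ud (ush D) i x) =
    ud (cone f) i (mklin (GL i) x).
  rewrite /= /cone_fun /=; congr pair; rewrite !linearN /=.
    by rewrite [a _ _](ufunP a).
  have zm (V : zmodType) (u v w : V) : u = v + w -> - - w = u + - v.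
    by move=> ->; rewrite opprK addrC addKr.
  exact: zm (hP i x).
exists (@UCMap _ (ush D) (cone f) (fun i => mklin (GL i)) GP) => E e [k kP].
have [h' h'E] := @reindex_succ (fun j => {linear E (j + 1) -> X j})
    (fun i => \- (cfst f i \o k i)).
exists h' => j; have [i ji] := int_succ j; subst j => x.
have := congr1 fst (kP i x) => /= ->.
by rewrite !h'E /= !linearN.
Qed.

Section Cocone.
Variables (D Q : ucplx R) (g : ucmap D (ush Q)).

Lemma ucc_linear i : linear (fun u : prod_mod (D i) (Q i) =>
  ((ud D i u.1, g i u.1 + ud Q i u.2) : prod_mod (D (i + 1)) (Q (i + 1)))).
Proof.
move=> a u v; congr pair; first by rewrite /= linearP.
by rewrite /= [g i _]linearP [ud Q i _]linearP scalerDr addrACA.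
Qed.

Lemma ucc_dd i (u : prod_mod (D i) (Q i)) :
  mklin (@ucc_linear (i + 1)) (mklin (@ucc_linear i) u) = 0.
Proof.
congr pair; rewrite /= ?udd // linearD udd addr0 (ufunP g) /=.
exact: addNr.
Qed.

(* The cocone of g : D -> Q[1], whose terms need no downward shift of Q. *)
Definition ucc : ucplx R :=
  @UCplx R (fun i => prod_mod (D i) (Q i)) (fun i => mklin (@ucc_linear i)) ucc_dd.

Definition ucc_fst i : {linear ucc i -> D i} := @fst (D i) (Q i).
Definition ucc_snd i : {linear ucc i -> Q i} := @snd (D i) (Q i).

Definition ucc_proj : ucmap ucc D :=
  @UCMap R ucc D ucc_fst (fun _ _ => erefl).

Lemma ucc_null : unull (ucomp g ucc_proj).
Proof.
exists (fun i => ucc_snd (i + 1)) => i x /=.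
have zm (V : zmodType) (u v : V) : u = - v + (u + v) by rewrite addrC addrK.
exact: zm.
Qed.

Lemma ucc_univ (F : ucplx R) (e : ucmap F D) : unull (ucomp g e) ->
  exists e' : ucmap F ucc, uhom (ucomp ucc_proj e') e.
Proof.
case=> k kP.
have [w wE] := @reindex_succ (fun j => {linear F j -> Q j}) k.
have eL i : linear (fun x : F i => ((e i x, w i x) : ucc i)).
  by move=> a x y; congr pair; rewrite linearP.
have eP i (x : F i) : mklin (eL (i + 1)) (ud F i x) = ud ucc i (mklin (eL i) x).
  congr pair; rewrite /= ?ufunP //.
  have [j ej] := int_succ i; subst i; rewrite !wE.
  have zm (V : zmodType) (u v z : V) : u = - v + z -> z = u + v.
    by move=> ->; rewrite addrC addNKr.
  exact: zm (kP j x).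
exists (@UCMap _ F ucc (fun i => mklin (eL i)) eP).
exact: uhom_eq.
Qed.
End Cocone.

Section CoconeProbe.
Variables (D : probe R) (Q : cplx R) (Qp : perfect Q) (g : ucmap D (ush Q)).

Lemma pcc_bdd : exists b : int, forall i, (b < i)%R -> zero_mod (ucc g i).
Proof.
have [b bP] := probe_bdd D; have [n nP] := cbounded Q.
exists (absz b + n)%N%:Z => i hi [x y].
by congr pair; [apply: bP; lia|apply: nP; lia].
Qed.

Definition pcc : probe R :=
  @Probe R (ucc g) (fun i => projective_prod (@probe_proj _ D i) (@Qp i)) pcc_bdd.
End CoconeProbe.

(* Up to homotopy equivalence, the morphisms of probes with a perfect cone. *)
Inductive cov : forall D' D : probe R, ucmap D' D -> Prop :=
| cov_id D : cov (uid D)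
| cov_step D' D (rho : ucmap D' D) Q (Qp : perfect Q) (g : ucmap D' (ush Q)) :
    cov rho -> @cov (pcc Qp g) D (ucomp rho (ucc_proj g))
| cov_hom D' D (rho rho' : ucmap D' D) : cov rho -> uhom rho rho' -> cov rho'.

Lemma uassoc X Y Z T (h : ucmap Z T) (g : ucmap Y Z) (f : ucmap X Y) :
  uhom (ucomp h (ucomp g f)) (ucomp (ucomp h g) f).
Proof. exact: uhom_eq. Qed.

Lemma uassocV X Y Z T (h : ucmap Z T) (g : ucmap Y Z) (f : ucmap X Y) :
  uhom (ucomp (ucomp h g) f) (ucomp h (ucomp g f)).
Proof. exact: uhom_eq. Qed.

Lemma uhom_idl X Y (f : ucmap X Y) : uhom (ucomp (uid Y) f) f.
Proof. exact: uhom_eq. Qed.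

Lemma uhom_idr X Y (f : ucmap X Y) : uhom (ucomp f (uid X)) f.
Proof. exact: uhom_eq. Qed.

Lemma cov_comp D'' D' D (rho' : ucmap D'' D') (rho : ucmap D' D) :
  cov rho' -> cov rho -> cov (ucomp rho rho').
Proof.
move=> c' c; elim: c' rho c => {D'' D' rho'}.
- by move=> D' rho c; apply: cov_hom c _; apply: uhom_sym; exact: uhom_idr.
- move=> D'' D' rho' Q Qp g c' IH rho c.
  by apply: cov_hom (cov_step Qp g (IH _ c)) _; exact: uassocV.
- move=> D'' D' r r' c' IH h rho c.
  by apply: cov_hom (IH _ c) _; exact: uhom_compl.
Qed.

(** An Ore condition. A step defined by [g] pulls back to the step defined by the composite of [g]
    with the map already constructed, by the universal property [ucc_univ]. *)
Lemma cov_pull D' D (rho : ucmap D' D) : cov rho -> forall E (e : ucmap E D),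
  exists (E' : probe R) (rho' : ucmap E' E) (e' : ucmap E' D'),
    cov rho' /\ uhom (ucomp rho e') (ucomp e rho').
Proof.
elim=> {D' D rho}.
- move=> D E e; exists E, (uid E), e; split; first exact: cov_id.
  by apply: uhom_trans (uhom_idl _) _; apply: uhom_sym; exact: uhom_idr.
- move=> D' D rho Q Qp g c IH E e.
  have [E' [rho' [e' [c' h']]]] := IH E e.
  have [|e'' h''] := @ucc_univ D' Q g (ucc (ucomp g e')) (ucomp e' (ucc_proj _)).
    by apply: unull_hom (uassoc _ _ _) _; exact: ucc_null.
  exists (pcc Qp (ucomp g e')), (ucomp rho' (ucc_proj _)), e''.
  split; first exact: cov_step.
  apply: uhom_trans (uassocV _ _ _) _.
  apply: uhom_trans (uhom_compl rho h'') _.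
  apply: uhom_trans (uassoc _ _ _) _.
  by apply: uhom_trans (uhom_compr _ h') _; exact: uassocV.
- move=> D' D r r' c IH h E e; have [E' [rho' [e' [c' h']]]] := IH E e.
  exists E', rho', e'; split=> //; apply: uhom_trans h'.
  by apply: uhom_compr; exact: uhom_sym.
Qed.

(** Covers play the role of a Grothendieck topology, and [loceq] that of local equality of
    sections. *)
Definition loceq D X (a b : ucmap D X) :=
  exists (D' : probe R) (rho : ucmap D' D),
    cov rho /\ uhom (ucomp a rho) (ucomp b rho).

Lemma loceq_hom D X (a b : ucmap D X) : uhom a b -> loceq a b.
Proof.
by move=> h; exists D, (uid D); split; [exact: cov_id|exact: uhom_compr].
Qed.

Lemma loceq_refl D X (a : ucmap D X) : loceq a a.
Proof. by apply: loceq_hom; exact: uhom_refl. Qed.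

Lemma loceq_sym D X (a b : ucmap D X) : loceq a b -> loceq b a.
Proof. by move=> [D' [r [c h]]]; exists D', r; split=> //; exact: uhom_sym. Qed.

Lemma loceq_restr D E X (a b : ucmap D X) (e : ucmap E D) :
  loceq a b -> loceq (ucomp a e) (ucomp b e).
Proof.
move=> [D' [r [c h]]]; have [E' [r' [e' [c' h']]]] := cov_pull c e.
exists E', r'; split=> //.
apply: uhom_trans (uassocV _ _ _) _.
apply: uhom_trans (uhom_compl _ (uhom_sym h')) _.
apply: uhom_trans (uassoc _ _ _) _.
apply: uhom_trans (uhom_compr _ h) _.
apply: uhom_trans (uassocV _ _ _) _.
apply: uhom_trans (uhom_compl _ h') _.
exact: uassoc.
Qed.

Lemma loceq_local D' D X (a b : ucmap D X) (rho : ucmap D' D) :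
  cov rho -> loceq (ucomp a rho) (ucomp b rho) -> loceq a b.
Proof.
move=> c [D'' [r [c' h]]]; exists D'', (ucomp rho r); split; first exact: cov_comp.
apply: uhom_trans (uassoc _ _ _) _; apply: uhom_trans h _; exact: uassocV.
Qed.

Lemma loceq_trans D X (b a c : ucmap D X) : loceq a b -> loceq b c -> loceq a c.
Proof.
move=> [D' [r [cr h]]] /(loceq_restr r)/loceq_sym h'.
apply: (loceq_local cr); apply: loceq_sym.
case: h' => D'' [r' [cr' h']]; exists D'', r'; split=> //.
by apply: uhom_trans h' _; apply: uhom_compr; exact: uhom_sym.
Qed.

Lemma loceq_compl D X Y (f : ucmap X Y) (a b : ucmap D X) :
  loceq a b -> loceq (ucomp f a) (ucomp f b).
Proof.
move=> [D' [r [c h]]]; exists D', r; split=> //.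
apply: uhom_trans (uassocV _ _ _) _.
by apply: uhom_trans (uhom_compl f h) _; exact: uassoc.
Qed.

Definition castm X (i j : int) (e : i = j) : {linear X i -> X j} :=
  match e in _ = k return {linear X i -> X k} with erefl => idfun end.

Lemma castm_d X (i j : int) (e : i = j) (e' : i + 1 = j + 1) x :
  castm X e' (ud X i x) = ud X j (castm X e x).
Proof. by case: j / e e' => e'; rewrite (eq_irrelevance e' erefl). Qed.

Lemma castm_comp X (i j k : int) (e : i = j) (e' : j = k) (e'' : i = k) x :
  castm X e' (castm X e x) = castm X e'' x.
Proof. by case: k / e' e''; case: j / e => e''; rewrite (eq_irrelevance e'' erefl). Qed.

Lemma castmK X (i j : int) (e : i = j) (e' : j = i) x : castm X e' (castm X e x) = x.
Proof. exact: (castm_comp e e' erefl). Qed.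

Section Unshift.
Variable Q : cplx R.

Lemma unsh_eq (i : int) : i - 1 + 1 = i + 1 - 1. Proof. by rewrite subrK addrK. Qed.

(* The sign cancels the one in ush, so that ush (unsh Q) is Q up to casts. *)
Definition unsh_d i : {linear Q (i - 1) -> Q (i + 1 - 1)} :=
  \- (castm Q (unsh_eq i) \o ud Q (i - 1)).

Lemma unsh_dd i (x : Q (i - 1)) : unsh_d (i + 1) (unsh_d i x) = 0.
Proof.
have e : i - 1 + 1 + 1 = i + 1 - 1 + 1 by rewrite unsh_eq.
rewrite /= linearN -[cd Q (i + 1 - 1) _](@castm_d Q _ _ (unsh_eq i) e _).
by rewrite [cd Q _ _](udd (x : (Q : ucplx R) (i - 1))) !(linear0, oppr0).
Qed.

Lemma unsh_bounded : exists n : nat, forall i : int, (n < absz i)%N -> zero_mod (Q (i - 1)).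
Proof. by have [n nP] := cbounded Q; exists n.+1 => i hi; apply: nP; lia. Qed.

Definition unsh : cplx R := @Cplx R (fun i => Q (i - 1)) unsh_d unsh_dd unsh_bounded.

Lemma unsh_perfect : perfect Q -> perfect unsh.
Proof. by move=> Qp i; exact: Qp. Qed.

Lemma unsh_iso : exists (a : ucmap Q (ush unsh)) (b : ucmap (ush unsh) Q),
  (forall i x, b i (a i x) = x) /\ (forall i x, a i (b i x) = x).
Proof.
have e1 (i : int) : i = i + 1 - 1 by rewrite addrK.
have e2 (i : int) : i + 1 - 1 = i by rewrite addrK.
have e3 (i : int) : i + 1 = i + 1 - 1 + 1 by rewrite addrK.
have e4 (i : int) : i + 1 - 1 + 1 = i + 1 by rewrite addrK.
have aP i x : castm Q (e1 (i + 1)) (ud Q i x) = ud (ush unsh) i (castm Q (e1 i) x).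
  by rewrite /= opprK -[cd Q (i + 1 - 1) _](@castm_d Q _ _ (e1 i) (e3 i) _) (@castm_comp Q _ _ _ _ _ (e1 (i + 1))).
have bP i x : castm Q (e2 (i + 1)) (ud (ush unsh) i x) = ud Q i (castm Q (e2 i) x).
  by rewrite /= opprK (@castm_comp Q _ _ _ _ _ (e4 i)) -[cd Q i _](@castm_d Q _ _ (e2 i) (e4 i) _).
exists (@UCMap R Q (ush unsh) (fun i => castm Q (e1 i)) aP).
exists (@UCMap R (ush unsh) Q (fun i => castm Q (e2 i)) bP).
by split=> i x; [exact: (@castmK Q _ _ (e1 i) (e2 i))|exact: (@castmK Q _ _ (e2 i) (e1 i))].
Qed.
End Unshift.

End Covers.

(** * Actions and localizations *)

Section Shift.
Variable R : nzRingType.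
Implicit Types (X Y Z : ucplx R) (D E F : probe R).

Lemma ush_map_comp X Y Z (g : ucmap Y Z) (f : ucmap X Y) :
  uhom (ush_map (ucomp g f)) (ucomp (ush_map g) (ush_map f)).
Proof. exact: uhom_eq. Qed.

Lemma ush_map_hom X Y (f g : ucmap X Y) : uhom f g -> uhom (ush_map f) (ush_map g).
Proof.
case=> h hP; exists (fun i => \- h (i + 1)) => i x.
by rewrite /= !linearN !opprK; exact: hP.
Qed.

Lemma ush_map_null X Y (f : ucmap X Y) : unull f -> unull (ush_map f).
Proof.
move=> /unullE/ush_map_hom h; apply/unullE; apply: uhom_trans h _.
exact: uhom_eq.
Qed.

Lemma ush_unmap X Y (f : ucmap (ush X) (ush Y)) :
  exists g : ucmap X Y, forall i x, g (i + 1) x = f i x.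
Proof.
apply: (@ucmap_reindex _ X Y f) => i x; have := ufunP f x.
by rewrite /= linearN => /oppr_inj.
Qed.

(** The pulled back cover must be the shift of a cover of [D]. The map [D'[1] -> Q[1]] defining a
    step is therefore unshifted to [D' -> Q], and [Q] is rewritten as the shift of [unsh Q], since
    steps are given by maps into shifts. *)
Lemma cov_pull_shift E F (rho : ucmap E F) : cov rho ->
  forall D (u : ucmap (ush D) F), exists (D' : probe R) (rho' : ucmap D' D)
    (e : ucmap (ush D') E), cov rho' /\ uhom (ucomp rho e) (ucomp u (ush_map rho')).
Proof.
elim=> {E F rho}.
- move=> F D u; exists D, (uid D), u; split; first exact: cov_id.
  by apply: uhom_trans (uhom_idl _) _; exact: uhom_eq.
- move=> E F rho Q Qp g c IH D u; have [D' [rho' [e [c' h]]]] := IH D u.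
  have [g' g'E] := ush_unmap (ucomp g e).
  have [al [be [be_al al_be]]] := unsh_iso Q.
  pose k := ucomp al g'.
  have Qp' : perfect (unsh Q) by exact: unsh_perfect.
  have g'null : unull (ucomp g' (ucc_proj k)).
    have := unull_compl be (ucc_null k); apply: unull_hom.
    by apply: uhom_eq => i x /=; rewrite be_al.
  have [|e' h'] := @ucc_univ _ E Q g _ (ucomp e (ush_map (ucc_proj k))).
    apply: unull_hom _ (ush_map_null g'null).
    by apply: uhom_eq => i x /=; rewrite g'E.
  exists (pcc Qp' k), (ucomp rho' (ucc_proj k)), e'; split; first exact: cov_step.
  apply: uhom_trans (uassocV _ _ _) _.
  apply: uhom_trans (uhom_compl _ h') _.
  apply: uhom_trans (uassoc _ _ _) _.
  apply: uhom_trans (uhom_compr _ h) _.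
  apply: uhom_trans (uassocV _ _ _) _.
  by apply: uhom_compl; apply: uhom_sym; exact: ush_map_comp.
- move=> E F r r' c IH h D u; have [D' [rho' [e [c' h']]]] := IH D u.
  exists D', rho', e; split=> //; apply: uhom_trans h'.
  by apply: uhom_compr; exact: uhom_sym.
Qed.

End Shift.

Section Actions.
Variable R : nzRingType.
Implicit Types (D E F : probe R).

(* Morphisms of C act as functional relations, locally for covers of probes, on maps
   from probes to the complexes underlying the objects of C.  An action passes to
   localizations, where it detects that a formal zigzag is zero without any calculus
   of fractions. *)
Record action (C : scat) (U : C -> cplx R) := Action {
  act : forall X Y : C, hom X Y -> forall D, ucmap D (U X) -> ucmap D (U Y) -> Prop;
  act_congr : forall X Y (f : hom X Y) D (a a' : ucmap D (U X)) (b b' : ucmap D (U Y)),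
    uhom a a' -> uhom b b' -> act f a b -> act f a' b';
  act_restr : forall X Y (f : hom X Y) D (a : ucmap D (U X)) (b : ucmap D (U Y)),
    act f a b -> forall E (e : ucmap E D), act f (ucomp a e) (ucomp b e);
  act_local : forall X Y (f : hom X Y) D' D (rho : ucmap D' D)
      (a : ucmap D (U X)) (b : ucmap D (U Y)),
    cov rho -> act f (ucomp a rho) (ucomp b rho) -> act f a b;
  act_total : forall X Y (f : hom X Y) D (a : ucmap D (U X)),
    exists D' (rho : ucmap D' D) b, cov rho /\ act f (ucomp a rho) b;
  act_fun : forall X Y (f : hom X Y) D (a : ucmap D (U X)) (b b' : ucmap D (U Y)),
    act f a b -> act f a b' -> loceq b b';
  act_heq : forall X Y (f g : hom X Y), f =h g ->
    forall D (a : ucmap D (U X)) (b : ucmap D (U Y)), act f a b <-> act g a b;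
  act_id : forall X D (a b : ucmap D (U X)), act (idm X) a b <-> loceq a b;
  act_comp : forall X Y Z (g : hom Y Z) (f : hom X Y) D
      (a : ucmap D (U X)) (b : ucmap D (U Z)),
    act (g \oc f) a b <-> exists D' (rho : ucmap D' D) c,
      [/\ cov rho, act f (ucomp a rho) c & act g c (ucomp b rho)];
  act_zero : forall X Y D (a : ucmap D (U X)) (b : ucmap D (U Y)),
    act (zerom X Y) a b <-> loceq b (uzero D (U Y));
  act_on_zero : forall X Y (f : hom X Y) D, act f (uzero D (U X)) (uzero D (U Y))
}.

Section ActionTheory.
Variables (C : scat) (U : C -> cplx R) (A : action U).
Implicit Types X Y : C.

Lemma act_loceq X Y (f : hom X Y) D (a a' : ucmap D (U X)) (b b' : ucmap D (U Y)) :
  loceq a a' -> loceq b b' -> act A f a b -> act A f a' b'.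
Proof.
move=> [D1 [r1 [c1 h1]]] [D2 [r2 [c2 h2]]] H.
have [E [s [e [cs h]]]] := cov_pull c1 r2.
apply: (act_local (cov_comp cs c2)).
apply: act_congr (act_restr H (ucomp r2 s)).
  apply: uhom_trans (uhom_compl _ (uhom_sym h)) _.
  apply: uhom_trans (uassoc _ _ _) _.
  apply: uhom_trans (uhom_compr _ h1) _.
  apply: uhom_trans (uassocV _ _ _) _.
  exact: uhom_compl.
apply: uhom_trans (uassoc _ _ _) _.
by apply: uhom_trans (uhom_compr _ h2) _; exact: uassocV.
Qed.

Lemma act_compI X Y Z (g : hom Y Z) (f : hom X Y) D (a : ucmap D (U X)) c
    (b : ucmap D (U Z)) : act A f a c -> act A g c b -> act A (g \oc f) a b.
Proof.
move=> fa gb; apply/act_comp; exists D, (uid D), c; split; first exact: cov_id.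
  by apply: act_congr fa; [exact: uhom_eq|exact: uhom_refl].
by apply: act_congr gb; [exact: uhom_refl|exact: uhom_eq].
Qed.

(** These two clauses are totality and functionality of the converse relation, so that a formal
    inverse of [s] can act by it. *)
Definition locally_bijective X Y (s : hom X Y) :=
  (forall D (b : ucmap D (U Y)), exists D' (rho : ucmap D' D) a,
     cov rho /\ act A s a (ucomp b rho)) /\
  (forall D (a a' : ucmap D (U X)) b, act A s a b -> act A s a' b -> loceq a a').

Lemma locally_bijective_iso X Y (f : hom X Y) : is_iso f -> locally_bijective f.
Proof.
move=> [g [gf fg]]; split=> [D b|D a a' b fa fa'].
  have [D1 [r1 [c [c1 gc]]]] := act_total A g b.
  have [D2 [r2 [d [c2 fd]]]] := act_total A f c.
  have /(act_heq A fg)/act_id h := act_compI (act_restr gc r2) fd.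
  exists D2, (ucomp r1 r2), (ucomp c r2); split; first exact: cov_comp.
  apply: act_loceq (loceq_refl _) _ fd.
  by apply: loceq_trans (loceq_sym h) _; apply: loceq_hom; exact: uassocV.
have [D1 [r1 [c [c1 gc]]]] := act_total A g b.
have /(act_heq A gf)/act_id h := act_compI (act_restr fa r1) gc.
have /(act_heq A gf)/act_id h' := act_compI (act_restr fa' r1) gc.
by apply: (loceq_local c1); apply: loceq_trans h (loceq_sym h').
Qed.

Lemma locally_bijective_comp X Y Z (g : hom Y Z) (f : hom X Y) :
  locally_bijective f -> locally_bijective g -> locally_bijective (g \oc f).
Proof.
move=> [fs fi] [gs gi]; split=> [D b|D a a' b].
  have [D1 [r1 [c [c1 gc]]]] := gs D b.
  have [D2 [r2 [a [c2 fa]]]] := fs D1 c.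
  exists D2, (ucomp r1 r2), a; split; first exact: cov_comp.
  apply: act_compI fa _.
  by apply: act_congr (act_restr gc r2); [exact: uhom_refl|exact: uassocV].
move=> /act_comp[D1 [r1 [c [c1 fa gc]]]] /act_comp[D2 [r2 [c' [c2 fa' gc']]]].
have [E [s [e [cs h]]]] := cov_pull c1 r2.
have hv V (v : ucmap D V) : uhom (ucomp (ucomp v r1) e) (ucomp (ucomp v r2) s).
  apply: uhom_trans (uassocV _ _ _) _.
  by apply: uhom_trans (uhom_compl _ h) _; exact: uassoc.
have cc' : loceq (ucomp c e) (ucomp c' s).
  apply: gi _ (act_restr gc' s).
  exact: act_congr (uhom_refl _) (hv _ _) (act_restr gc e).
have fE := act_congr (hv _ _) (uhom_refl _) (act_restr fa e).
have aa' := fi _ _ _ _ (act_loceq (loceq_refl _) cc' fE) (act_restr fa' s).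
apply: (loceq_local (cov_comp cs c2)).
by apply: loceq_trans (loceq_hom (uassoc _ _ _)) _;
   apply: loceq_trans aa' (loceq_hom (uassocV _ _ _)).
Qed.

Lemma locally_bijective_cancel X Y Z (g : hom Y Z) (f : hom X Y) :
  locally_bijective (g \oc f) -> locally_bijective g -> locally_bijective f.
Proof.
move=> [gfs gfi] [gs gi]; split=> [D b|D a a' b fa fa'].
  have [D1 [r1 [d [c1 gd]]]] := act_total A g b.
  have [D2 [r2 [a [c2 /act_comp[D3 [r3 [c [c3 fa gc]]]]]]]] := gfs D1 d.
  exists D3, (ucomp r1 (ucomp r2 r3)), (ucomp a r3); split.
    by apply: cov_comp c1; exact: cov_comp.
  apply: act_loceq (loceq_refl _) _ fa.
  apply: gi gc _.
  apply: act_congr (act_restr (act_restr gd r2) r3); last exact: uhom_refl.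
  by apply: uhom_eq.
have [D1 [r1 [c [c1 gc]]]] := act_total A g b.
apply: (loceq_local c1).
exact: gfi (act_compI (act_restr fa r1) gc) (act_compI (act_restr fa' r1) gc).
Qed.

Lemma locally_bijective_heq X Y (f g : hom X Y) :
  f =h g -> locally_bijective f -> locally_bijective g.
Proof.
move=> fg [fs fi]; split=> [D b|D a a' b].
  by have [D1 [r1 [a [c1 /(act_heq A fg) fa]]]] := fs D b; exists D1, r1, a.
by move=> /(act_heq A fg) ga /(act_heq A fg); exact: fi ga.
Qed.

End ActionTheory.

Section Localization.
Variables (C : scat) (U : C -> cplx R) (A : action U).
Variable W : forall X Y : C, hom X Y -> Prop.
Hypothesis W_sh : forall (X Y : C) (s : hom X Y), W s -> W (shm s).
Hypothesis W_bij : forall (X Y : C) (s : hom X Y), W s -> locally_bijective A s.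

Fixpoint loc_act (X Y : C) (f : loc_hom W X Y) : forall D, ucmap D (U X) -> ucmap D (U Y) -> Prop :=
  match f in loc_hom _ X Y return forall D, ucmap D (U X) -> ucmap D (U Y) -> Prop with
  | Loc _ _ f => fun D a b => act A f a b
  | Inv _ _ s _ => fun D a b => act A s b a
  | Comp _ _ _ g f => fun D a b => exists D' (rho : ucmap D' D) c,
      [/\ cov rho, loc_act f (ucomp a rho) c & loc_act g c (ucomp b rho)]
  end.

Lemma loc_act_congr X Y (f : loc_hom W X Y) D (a a' : ucmap D (U X)) (b b' : ucmap D (U Y)) :
  uhom a a' -> uhom b b' -> loc_act f a b -> loc_act f a' b'.
Proof.
elim: f D a a' b b' => {X Y} [X Y f|X Y s Ws|X Y Z g IHg f IHf] D a a' b b' ha hb /=.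
- exact: act_congr.
- exact: act_congr.
- move=> [D' [r [c [cr fa gb]]]]; exists D', r, c; split=> //.
    by apply: IHf fa; [exact: uhom_compr|exact: uhom_refl].
  by apply: IHg gb; [exact: uhom_refl|exact: uhom_compr].
Qed.

Lemma loc_act_restr X Y (f : loc_hom W X Y) D (a : ucmap D (U X)) (b : ucmap D (U Y)) :
  loc_act f a b -> forall E (e : ucmap E D), loc_act f (ucomp a e) (ucomp b e).
Proof.
elim: f D a b => {X Y} [X Y f|X Y s Ws|X Y Z g IHg f IHf] D a b /=.
- exact: act_restr.
- exact: act_restr.
- move=> [D' [r [c [cr fa gb]]]] E e.
  have [E' [s [e' [cs h]]]] := cov_pull cr e.
  have ha V (v : ucmap D V) : uhom (ucomp (ucomp v r) e') (ucomp (ucomp v e) s).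
    apply: uhom_trans (uassocV _ _ _) _.
    by apply: uhom_trans (uhom_compl _ h) _; exact: uassoc.
  exists E', s, (ucomp c e'); split=> //.
    exact: loc_act_congr (ha _ _) (uhom_refl _) (IHf _ _ _ fa _ e').
  exact: loc_act_congr (uhom_refl _) (ha _ _) (IHg _ _ _ gb _ e').
Qed.

Lemma loc_act_local X Y (f : loc_hom W X Y) D' D (rho : ucmap D' D)
    (a : ucmap D (U X)) (b : ucmap D (U Y)) :
  cov rho -> loc_act f (ucomp a rho) (ucomp b rho) -> loc_act f a b.
Proof.
case: f a b => {X Y} [X Y f|X Y s Ws|X Y Z g f] a b cr /=.
- exact: act_local.
- exact: act_local.
- move=> [E [s [c [cs fa gb]]]]; exists E, (ucomp rho s), c; split.
  + exact: cov_comp.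
  + by apply: loc_act_congr fa; [exact: uassocV|exact: uhom_refl].
  + by apply: loc_act_congr gb; [exact: uhom_refl|exact: uassocV].
Qed.

Lemma loc_act_loceq X Y (f : loc_hom W X Y) D (a a' : ucmap D (U X)) (b b' : ucmap D (U Y)) :
  loceq a a' -> loceq b b' -> loc_act f a b -> loc_act f a' b'.
Proof.
move=> [D1 [r1 [c1 h1]]] [D2 [r2 [c2 h2]]] H.
have [E [s [e [cs h]]]] := cov_pull c1 r2.
apply: (loc_act_local (cov_comp cs c2)).
apply: loc_act_congr (loc_act_restr H (ucomp r2 s)).
  apply: uhom_trans (uhom_compl _ (uhom_sym h)) _.
  apply: uhom_trans (uassoc _ _ _) _.
  apply: uhom_trans (uhom_compr _ h1) _.
  apply: uhom_trans (uassocV _ _ _) _.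
  exact: uhom_compl.
apply: uhom_trans (uassoc _ _ _) _.
by apply: uhom_trans (uhom_compr _ h2) _; exact: uassocV.
Qed.

Lemma loc_act_total X Y (f : loc_hom W X Y) D (a : ucmap D (U X)) :
  exists D' (rho : ucmap D' D) b, cov rho /\ loc_act f (ucomp a rho) b.
Proof.
elim: f D a => {X Y} [X Y f|X Y s Ws|X Y Z g IHg f IHf] D a /=.
- exact: act_total.
- exact: (proj1 (W_bij Ws)).
- have [D1 [r1 [c [c1 fc]]]] := IHf D a.
  have [D2 [r2 [b [c2 gb]]]] := IHg D1 c.
  exists D2, (ucomp r1 r2), b; split; first exact: cov_comp.
  exists D2, (uid D2), (ucomp c r2); split; first exact: cov_id.
    by apply: loc_act_congr (loc_act_restr fc r2); [exact: uhom_eq|exact: uhom_refl].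
  by apply: loc_act_congr gb; [exact: uhom_refl|exact: uhom_eq].
Qed.

Lemma loc_act_fun X Y (f : loc_hom W X Y) D (a : ucmap D (U X)) (b b' : ucmap D (U Y)) :
  loc_act f a b -> loc_act f a b' -> loceq b b'.
Proof.
elim: f D a b b' => {X Y} [X Y f|X Y s Ws|X Y Z g IHg f IHf] D a b b' /=.
- exact: act_fun.
- exact: (proj2 (W_bij Ws)).
- move=> [D1 [r1 [c [c1 fa gb]]]] [D2 [r2 [c' [c2 fa' gb']]]].
  have [E [s [e [cs h]]]] := cov_pull c1 r2.
  have hv V (v : ucmap D V) : uhom (ucomp (ucomp v r1) e) (ucomp (ucomp v r2) s).
    apply: uhom_trans (uassocV _ _ _) _.
    by apply: uhom_trans (uhom_compl _ h) _; exact: uassoc.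
  have cc' : loceq (ucomp c e) (ucomp c' s).
    apply: IHf (loc_act_restr fa' s).
    exact: loc_act_congr (hv _ _) (uhom_refl _) (loc_act_restr fa e).
  have gE := loc_act_congr (uhom_refl _) (hv _ _) (loc_act_restr gb e).
  have gE' := loc_act_restr gb' s.
  apply: (loceq_local (cov_comp cs c2)).
  have := IHg _ _ _ _ (loc_act_loceq cc' (loceq_refl _) gE) gE'.
  by move=> H; apply: loceq_trans (loceq_hom (uassoc _ _ _)) _;
     apply: loceq_trans H (loceq_hom (uassocV _ _ _)).
Qed.

Lemma loc_act_compI X Y Z (g : loc_hom W Y Z) (f : loc_hom W X Y) D
    (a : ucmap D (U X)) c (b : ucmap D (U Z)) :
  loc_act f a c -> loc_act g c b -> loc_act (Comp g f) a b.
Proof.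
move=> fa gb; exists D, (uid D), c; split; first exact: cov_id.
  by apply: loc_act_congr fa; [exact: uhom_eq|exact: uhom_refl].
by apply: loc_act_congr gb; [exact: uhom_refl|exact: uhom_eq].
Qed.

(** Induction over the generators of the congruence; local bijectivity enters in the two inverse
    laws. *)
Lemma loc_act_eq X Y (f g : loc_hom W X Y) : loc_eq f g ->
  forall D (a : ucmap D (U X)) (b : ucmap D (U Y)), loc_act f a b <-> loc_act g a b.
Proof.
elim=> {X Y f g}.
- by [].
- by move=> X Y f g _ IH D a b; split=> /IH.
- by move=> X Y f g h _ IH _ IH' D a b; rewrite IH IH'.
- move=> X Y Z g g' f f' _ IHg _ IHf D a b.
  by split=> -[D' [r [c [cr /IHf fa /IHg gb]]]]; exists D', r, c.
- move=> X Y Z T h g f D a b; split.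
    move=> [D1 [r1 [c [c1 [D2 [r2 [c' [c2 fa gc]]]] hb]]]].
    exists D2, (ucomp r1 r2), c'; split; first exact: cov_comp.
      by apply: loc_act_congr fa; [exact: uassocV|exact: uhom_refl].
    apply: loc_act_compI gc _.
    by apply: loc_act_congr (loc_act_restr hb r2); [exact: uhom_refl|exact: uassocV].
  move=> [D1 [r1 [c [c1 fa [D2 [r2 [c' [c2 gc hb]]]]]]]].
  exists D2, (ucomp r1 r2), c'; split; first exact: cov_comp.
    apply: loc_act_compI gc.
    by apply: loc_act_congr (loc_act_restr fa r2); [exact: uassocV|exact: uhom_refl].
  by apply: loc_act_congr hb; [exact: uhom_refl|exact: uassocV].
- move=> X Y f D a b; split=> [[D' [r [c [cr fa /= /act_id cb]]]]|fa].
    by apply: (loc_act_local cr); apply: loc_act_loceq cb fa; exact: loceq_refl.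
  by apply: loc_act_compI fa _; apply/act_id; exact: loceq_refl.
- move=> X Y f D a b; split=> [[D' [r [c [cr /= /act_id/loceq_sym ac fb]]]]|fa].
    by apply: (loc_act_local cr); apply: loc_act_loceq ac _ fb; exact: loceq_refl.
  by apply: loc_act_compI fa; apply/act_id; exact: loceq_refl.
- by move=> X Y f g fg D a b; exact: act_heq.
- by move=> X Y Z g f D a b; exact: act_comp.
- move=> X Y s Ws D a b; split=> [[D' [r [c [cr /= sa sb]]]]|/act_id ab].
    apply/act_id; apply: (loceq_local cr).
    exact: (proj2 (W_bij Ws)) sa sb.
  have [D' [r [c [cr sc]]]] := act_total A s a.
  exists D', r, c; split=> //=.
  by apply: (act_loceq (loceq_restr r ab) (loceq_refl _) sc).
- move=> X Y s Ws D a b; split=> [[D' [r [c [cr /= sa sb]]]]|/act_id ab].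
    apply/act_id; apply: (loceq_local cr); exact: act_fun sa sb.
  have [D' [r [c [cr sc]]]] := proj1 (W_bij Ws) D b.
  exists D', r, c; split=> //=.
  by apply: (act_loceq (loceq_refl _) (loceq_restr r (loceq_sym ab)) sc).
Qed.

Lemma loc_act_on_zero X Y (f : loc_hom W X Y) D :
  loc_act f (uzero D (U X)) (uzero D (U Y)).
Proof.
elim: f => {X Y} [X Y f|X Y s Ws|X Y Z g IHg f IHf] /=; try exact: act_on_zero.
exact: loc_act_compI IHf IHg.
Qed.

(** Transparent, because later proofs let the action of [Loc f] and of [Inv] reduce to the
    underlying relation. *)
Definition localization_action : action (C := localization W_sh) U.
Proof.
apply: (@Action (localization W_sh) U loc_act).
- exact: loc_act_congr.
- exact: loc_act_restr.
- exact: loc_act_local.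
- exact: loc_act_total.
- exact: loc_act_fun.
- by move=> X Y f g fg D a b; exact: loc_act_eq.
- by move=> X D a b; exact: act_id.
- by [].
- by move=> X Y D a b; exact: act_zero.
- exact: loc_act_on_zero.
Defined.

End Localization.

End Actions.

(** * The homotopy category *)

(** The data records carry no axioms. These laws are checked for K^b and inherited by both
    localizations. *)
Record scat_laws (C : scat) := ScatLaws {
  heq_refl : forall (X Y : C) (f : hom X Y), f =h f;
  heq_sym : forall (X Y : C) (f g : hom X Y), f =h g -> g =h f;
  heq_trans : forall (X Y : C) (f g h : hom X Y), f =h g -> g =h h -> f =h h;
  heq_congr : forall (X Y Z : C) (g g' : hom Y Z) (f f' : hom X Y),
    g =h g' -> f =h f' -> g \oc f =h g' \oc f';
  heq_assoc : forall (X Y Z T : C) (h : hom Z T) (g : hom Y Z) (f : hom X Y),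
    h \oc (g \oc f) =h h \oc g \oc f;
  heq_idl : forall (X Y : C) (f : hom X Y), idm Y \oc f =h f;
  heq_idr : forall (X Y : C) (f : hom X Y), f \oc idm X =h f;
  shm_heq : forall (X Y : C) (f g : hom X Y), f =h g -> shm f =h shm g;
  shm_id : forall X : C, shm (idm X) =h idm (sh X);
  shm_comp : forall (X Y Z : C) (g : hom Y Z) (f : hom X Y),
    shm (g \oc f) =h shm g \oc shm f
}.

Section LocalizationLaws.
Variables (C : scat) (F : scat_laws C).
Variable W : forall X Y : C, hom X Y -> Prop.
Hypothesis W_sh : forall (X Y : C) (s : hom X Y), W s -> W (shm s).

Lemma loc_shm_eq (X Y : C) (f g : loc_hom W X Y) :
  loc_eq f g -> loc_eq (loc_shm W_sh f) (loc_shm W_sh g).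
Proof.
elim=> {X Y f g} /=.
- by move=> X Y f; exact: LocRefl.
- by move=> X Y f g _ IH; exact: LocSym.
- by move=> X Y f g h _ IH _ IH'; exact: LocTrans IH IH'.
- by move=> X Y Z g g' f f' _ IH _ IH'; exact: LocCongr.
- by move=> X Y Z T h g f; exact: LocAssoc.
- move=> X Y f; apply: LocTrans _ (LocIdl _).
  by apply: LocCongr (LocRefl _); apply: LocHeq; exact: shm_id.
- move=> X Y f; apply: LocTrans _ (LocIdr _).
  by apply: LocCongr (LocRefl _) _; apply: LocHeq; exact: shm_id.
- by move=> X Y f g h; apply: LocHeq; exact: shm_heq.
- move=> X Y Z g f; apply: LocTrans _ (LocComp _ _ _).
  by apply: LocHeq; exact: shm_comp.
- move=> X Y s Ws; apply: LocTrans (LocInvl _) _.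
  by apply: LocSym; apply: LocHeq; exact: shm_id.
- move=> X Y s Ws; apply: LocTrans (LocInvr _) _.
  by apply: LocSym; apply: LocHeq; exact: shm_id.
Qed.

Definition localization_laws : scat_laws (localization W_sh).
Proof.
apply: (@ScatLaws (localization W_sh)).
- by move=> X Y f; exact: LocRefl.
- by move=> X Y f g; exact: LocSym.
- by move=> X Y f g h; exact: LocTrans.
- by move=> X Y Z g g' f f'; exact: LocCongr.
- by move=> X Y Z T h g f; exact: LocAssoc.
- by move=> X Y f; exact: LocIdl.
- by move=> X Y f; exact: LocIdr.
- by move=> X Y f g; exact: loc_shm_eq.
- by move=> X; apply: LocHeq; exact: shm_id.
- by move=> X Y Z g f; exact: LocRefl.
Defined.

Lemma loc_iso (X Y : C) (f : hom X Y) : is_iso f ->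
  @is_iso (localization W_sh) X Y (Loc W f).
Proof.
move=> [g [gf fg]]; exists (Loc W g); split.
  by apply: LocTrans (LocSym (LocComp _ _ _)) _; exact: LocHeq.
by apply: LocTrans (LocSym (LocComp _ _ _)) _; exact: LocHeq.
Qed.

Lemma loc_isomorphic (X Y : C) : isomorphic X Y ->
  @isomorphic (localization W_sh) X Y.
Proof. by move=> [f fi]; exists (Loc W f); exact: loc_iso. Qed.

End LocalizationLaws.

Section Laws.
Variables (C : scat) (F : scat_laws C).
Implicit Types X Y Z : C.

Lemma isomorphic_refl X : isomorphic X X.
Proof. by exists (idm X), (idm X); split; exact: (heq_idl F). Qed.

Lemma isomorphic_sym X Y : isomorphic X Y -> isomorphic Y X.
Proof. by move=> [f [g [gf fg]]]; exists g, f. Qed.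

Lemma is_iso_comp X Y Z (g : hom Y Z) (f : hom X Y) :
  is_iso f -> is_iso g -> is_iso (g \oc f).
Proof.
move=> [f' [f'f ff']] [g' [g'g gg']]; exists (f' \oc g'); split.
  apply: (heq_trans F) (heq_assoc F _ _ _) _.
  apply: (heq_trans F) _ f'f.
  apply: (heq_congr F) (heq_refl F _).
  apply: (heq_trans F) (heq_sym F (heq_assoc F _ _ _)) _.
  apply: (heq_trans F) (heq_congr F (heq_refl F _) g'g) _.
  exact: heq_idr.
apply: (heq_trans F) (heq_assoc F _ _ _) _.
apply: (heq_trans F) _ gg'.
apply: (heq_congr F) (heq_refl F _).
apply: (heq_trans F) (heq_sym F (heq_assoc F _ _ _)) _.
apply: (heq_trans F) (heq_congr F (heq_refl F _) ff') _.
exact: heq_idr.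
Qed.

Lemma isomorphic_trans Y X Z : isomorphic X Y -> isomorphic Y Z -> isomorphic X Z.
Proof. by move=> [f fi] [g gi]; exists (g \oc f); exact: is_iso_comp. Qed.

Lemma is_iso_shm X Y (f : hom X Y) : is_iso f -> is_iso (shm f).
Proof.
move=> [g [gf fg]]; exists (shm g); split.
  apply: (heq_trans F) (heq_sym F (shm_comp F _ _)) _.
  by apply: (heq_trans F) (shm_heq F gf) _; exact: shm_id.
apply: (heq_trans F) (heq_sym F (shm_comp F _ _)) _.
by apply: (heq_trans F) (shm_heq F fg) _; exact: shm_id.
Qed.

Lemma isomorphic_sh X Y : isomorphic X Y -> isomorphic (sh X) (sh Y).
Proof. by move=> [f fi]; exists (shm f); exact: is_iso_shm. Qed.

(** Isomorphic objects and direct summands are both retracts, so one closure property settles two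
    clauses of [thick_subcat]. *)
Definition retract X Y := exists (i : hom X Y) (p : hom Y X), p \oc i =h idm X.

Lemma retract_iso X Y : isomorphic X Y -> retract X Y.
Proof. by move=> [f [g [gf _]]]; exists f, g. Qed.

Lemma retract_summand X Y : direct_summand X Y -> retract X Y.
Proof.
by move=> [X' [i [i' /(_ X (idm X) (zerom X' X))[[p [pi _]] _]]]]; exists i, p.
Qed.

Lemma retract_iter_sh k X Y :
  retract X Y -> retract (iter k (@sh C) X) (iter k (@sh C) Y).
Proof.
elim: k => [//|k IH] /IH[i [p pi]]; exists (shm i), (shm p).
apply: (heq_trans F) (heq_sym F (shm_comp F _ _)) _.
by apply: (heq_trans F) (shm_heq F pi) _; exact: shm_id.
Qed.
End Laws.

Section KbLaws.
Variable R : nzRingType.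

Lemma cshift_map_hom (X Y : cplx R) (f g : cmap X Y) :
  homotopic f g -> homotopic (cshift_map f) (cshift_map g).
Proof. exact: (@ush_map_hom R X Y f g). Qed.

Definition Kb_laws : scat_laws (Kb R).
Proof.
apply: (@ScatLaws (Kb R)).
- by move=> X Y f; exact: (@uhom_refl R X Y f).
- by move=> X Y f g; exact: (@uhom_sym R X Y f g).
- by move=> X Y f g h; exact: (@uhom_trans R X Y g f h).
- by move=> X Y Z g g' f f'; exact: (@uhom_comp R X Y Z g g' f f').
- by move=> X Y Z T h g f; exact: (@uassoc R X Y Z T h g f).
- by move=> X Y f; exact: (@uhom_idl R X Y f).
- by move=> X Y f; exact: (@uhom_idr R X Y f).
- by move=> X Y f g; exact: cshift_map_hom.
- by move=> X; exact: (@uhom_eq R _ _ (ucmap_of (cshift_map (cmap_id X))) (ucmap_of (cmap_id (cshift X)))).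
- by move=> X Y Z g f; exact: (@uhom_eq R _ _ (ucmap_of (cshift_map (cmap_comp g f))) (ucmap_of (cmap_comp (cshift_map g) (cshift_map f)))).
Defined.

Implicit Types (D E : probe R).

Definition Kb_act (X Y : Kb R) (f : hom X Y) D (a : ucmap D X) (b : ucmap D Y) :=
  loceq (ucomp (ucmap_of f) a) b.

Definition Kb_action : @action R (Kb R) id.
Proof.
apply: (@Action R (Kb R) id Kb_act).
- move=> X Y f D a a' b b' aa' bb' h.
  apply: loceq_trans (loceq_hom bb'); apply: loceq_trans h.
  by apply: loceq_hom; apply: uhom_compl; exact: uhom_sym.
- move=> X Y f D a b h E e.
  by apply: loceq_trans (loceq_restr e h); apply: loceq_hom; exact: uassoc.
- move=> X Y f D' D rho a b c h; apply: (loceq_local c).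
  by apply: loceq_trans h; apply: loceq_hom; exact: uassocV.
- move=> X Y f D a; exists D, (uid D), (ucomp (ucmap_of f) a); split.
    exact: cov_id.
  by apply: loceq_hom; exact: uhom_eq.
- by move=> X Y f D a b b' /loceq_sym; exact: loceq_trans.
- move=> X Y f g fg D a b.
  have h : uhom (ucmap_of f) (ucmap_of g) by exact: fg.
  split; apply: loceq_trans; apply: loceq_hom; apply: uhom_compr => //.
  exact: uhom_sym.
- move=> X D a b; split; apply: loceq_trans; apply: loceq_hom; exact: uhom_eq.
- move=> X Y Z g f D a b; split=> [h|[D' [r [c [cr fa gb]]]]].
    exists D, (uid D), (ucomp (ucmap_of f) a); split; first exact: cov_id.
      by apply: loceq_hom; exact: uhom_eq.
    apply: loceq_trans (loceq_restr (uid D) h).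
    by apply: loceq_hom; exact: uhom_eq.
  apply: (loceq_local cr); apply: loceq_trans gb.
  apply: loceq_trans (loceq_compl _ fa).
  by apply: loceq_hom; exact: uhom_eq.
- move=> X Y D a b; split=> [/loceq_sym h|h].
    by apply: loceq_trans h _; apply: loceq_hom; exact: uhom_eq.
  by apply: loceq_trans _ (loceq_sym h); apply: loceq_hom; exact: uhom_eq.
- by move=> X Y f D; apply: loceq_hom; exact: uhom_zero_compl.
Defined.

Definition kills (Z : ucplx R) := forall D (c : ucmap D Z), loceq c (uzero D Z).

Lemma acyclic_kills (Z : ucplx R) : uacyclic Z -> kills Z.
Proof.
by move=> Zac D c; apply: loceq_hom; apply/unullE; exact: acyclic_null.
Qed.

(** Surjectivity is [cone_lift] on a cover where the map to the cone dies. Injectivity uses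
    [cone_unlift], whose test map lives on a shifted probe; [cov_pull_shift] brings the resulting
    cover back to the probe itself. *)
Lemma kills_bijective (X Y : cplx R) (f : cmap X Y) :
  kills (cone f) -> @locally_bijective R (Kb R) id Kb_action X Y f.
Proof.
move=> kf; split=> [D b|D a a' b fa fa'].
  have [D' [r [c h]]] := kf D (ucomp (cone_incl f) b).
  have [|a ha] := @cone_lift R D' X Y f (ucomp b r).
    apply/unullE; apply: uhom_trans (uassoc _ _ _) _.
    by apply: uhom_trans h _; exact: uhom_zero_compr.
  by exists D', r, a; split=> //; exact: loceq_hom.
have [D' [r [c h]]] := loceq_trans fa (loceq_sym fa').
pose u := usub (ucomp a r) (ucomp a' r).
have [|G GP] := @cone_unlift R D' X Y f u.
  apply: unull_hom ((uhom_sub _ _).1 h).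
  by apply: uhom_eq => i x; rewrite /= linearB.
have [E [s [cs hs]]] := kf (psh D') G.
have [D2 [r2 [e [c2 he]]]] := cov_pull_shift cs (uid (ush D')).
have Gn : unull (ucomp G (ush_map r2)).
  apply/unullE.
  apply: uhom_trans (_ : uhom _ (ucomp (ucomp G s) e)) _.
    apply: uhom_trans _ (uassoc _ _ _); apply: uhom_compl.
    by apply: uhom_trans _ (uhom_sym he); exact: uhom_eq.
  apply: uhom_trans (uhom_compr _ hs) _.
  by apply: uhom_trans (uassocV _ _ _) _; exact: uhom_zero_compr.
apply: (loceq_local c); exists D2, r2; split=> //.
apply/uhom_sub; apply: unull_hom (GP _ _ Gn).
exact: uhom_eq.
Qed.

(** Every map into [Z] is null on its own cocone, and that cocone is a cover because [Z] is
    perfect. *)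
Lemma perfect_kills (Z : cplx R) : perfect Z -> kills Z.
Proof.
move=> Zp D c; have [al [be [be_al _]]] := unsh_iso Z.
pose g := ucomp al c.
have Zp' : perfect (unsh Z) by exact: unsh_perfect.
exists (pcc Zp' g), (ucomp (uid D) (ucc_proj g)); split.
  by apply: cov_step; exact: cov_id.
apply: (@uhom_trans R (ucc g) Z (ucomp be (ucomp g (ucc_proj g)))).
  by apply: uhom_eq => i x /=; rewrite be_al.
apply: uhom_trans (uhom_compl be ((unullE _).1 (ucc_null g))) _.
by apply: uhom_trans (uhom_zero_compl _ _) _; exact: uhom_eq.
Qed.

End KbLaws.

(** * The derived and singularity categories *)

Section Derived.
Variable R : nzRingType.
Implicit Types (D E : probe R).

Lemma acyclic_iso (Z Z' : Kb R) : isomorphic Z Z' -> acyclic Z -> acyclic Z'.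
Proof.
move=> [c [c' [_ [h hP]]]] Zac i x; split=> [dx|[y <-]]; last exact: cdd.
have c'x : cd Z (i + 1) ((c' : cmap _ _) (i + 1) x) = 0.
  by rewrite -cfunP dx linear0.
have [z zE] := proj1 (Zac i _) c'x.
exists ((c : cmap _ _) i z - h i x).
have := hP i x; rewrite /= dx linear0 addr0 -zE cfunP => e.
by rewrite linearB -e subKr.
Qed.

(** The shape of a morphism in [cone_in] that is stable under its shift constructor: up to
    isomorphism at both ends, a chain map with acyclic cone. *)
Definition cone_like (X Y : Kb R) (s : hom X Y) :=
  exists (X0 Y0 : Kb R) (f : hom X0 Y0) (a : hom X X0) (b : hom Y Y0),
    [/\ is_iso a, is_iso b, b \oc s =h f \oc a & acyclic (cone f)].

Lemma uqis_shift (X Y : cplx R) (f : cmap X Y) : uqis f -> uqis (cshift_map f).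
Proof.
move=> [inj sur]; split=> [i z y dz fz|i y dy].
  have [||x xE] := inj (i + 1) z (- y).
  - by apply: oppr_inj; rewrite oppr0; exact: dz.
  - by rewrite linearN; exact: fz.
  by exists (- x); rewrite /= linearN opprK.
have [|x [z [dx e]]] := sur (i + 1) y.
  by apply: oppr_inj; rewrite oppr0; exact: dy.
exists x, (- z); split; first by apply: oppr_inj; rewrite oppr0 /= opprK.
by rewrite /= linearN opprK.
Qed.

Lemma cone_in_acyclic (X Y : Kb R) (s : hom X Y) :
  @cone_in (Kb R) (@acyclic R) X Y s -> cone_like s.
Proof.
elim=> {X Y s}.
  move=> X Y Z u v w [X0 [Y0 [f [a [b [c [[ia ib ic] [e1 _ _]]]]]]]] Zac.
  exists X0, Y0, f, a, b; split=> //.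
  by apply: acyclic_iso Zac; exists c.
move=> X Y s _ [X0 [Y0 [f [a [b [ia ib e fac]]]]]].
exists (sh X0), (sh Y0), (shm f), (shm a), (shm b); split.
- exact: is_iso_shm (Kb_laws R) _ _ _ ia.
- exact: is_iso_shm (Kb_laws R) _ _ _ ib.
- have L := Kb_laws R.
  apply: (heq_trans L) (heq_sym L (shm_comp L _ _)) _.
  by apply: (heq_trans L) (shm_heq L e) _; exact: shm_comp.
- by apply/acyclic_cone_qis; apply: uqis_shift; apply/acyclic_cone_qis.
Qed.

Lemma acyclic_cone_bijective (X Y : Kb R) (s : hom X Y) :
  @cone_in (Kb R) (@acyclic R) X Y s -> locally_bijective (Kb_action R) s.
Proof.
move/cone_in_acyclic=> [X0 [Y0 [f [a [b [ia ib e fac]]]]]].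
apply: (@locally_bijective_cancel _ _ _ _ _ _ _ b); last exact: locally_bijective_iso.
apply: locally_bijective_heq (heq_sym (Kb_laws R) e) _.
apply: locally_bijective_comp; first exact: locally_bijective_iso.
by apply: kills_bijective; exact: acyclic_kills.
Qed.

Definition Db_laws : scat_laws (Db R) := localization_laws (Kb_laws R) _.

Definition Db_action : @action R (Db R) id :=
  localization_action (@ConeInSh _ _) acyclic_cone_bijective.

Definition toDb (X Y : cplx R) (f : cmap X Y) : @hom (Db R) X Y :=
  @Loc (Kb R) _ X Y f.

Lemma toDb_iso (X Y : Kb R) (f : hom X Y) : is_iso f -> is_iso (toDb f).
Proof. by move=> h; exact: loc_iso. Qed.

Lemma dist_Db (t : triangle (Db R)) : dist t ->
  exists (X Y : cplx R) (f : cmap X Y)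
    (a : @hom (Db R) (tX t) X) (b : @hom (Db R) (tY t) Y)
    (c : @hom (Db R) (tZ t) (cone f)),
    [/\ is_iso a, is_iso b, is_iso c & b \oc tu t =h toDb f \oc a].
Proof.
move=> [t0 [X0 [Y0 [f [a0 [b0 [c0 [[ia ib ic] [e _ _]]]]]]]]].
move=> [a [b [c [[ja jb jc] [e' _ _]]]]].
have L := Db_laws.
exists X0, Y0, f, (toDb a0 \oc a), (toDb b0 \oc b), (toDb c0 \oc c); split.
- by apply: is_iso_comp => //; exact: toDb_iso.
- by apply: is_iso_comp => //; exact: toDb_iso.
- by apply: is_iso_comp => //; exact: toDb_iso.
apply: (heq_trans L) (heq_sym L (heq_assoc L _ _ _)) _.
apply: (heq_trans L) (heq_congr L (heq_refl L _) e') _.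
apply: (heq_trans L) (heq_assoc L _ _ _) _.
apply: (heq_trans L) _ (heq_sym L (heq_assoc L _ _ _)).
apply: (heq_congr L) (heq_refl L _).
apply: LocTrans (LocSym (LocComp _ _ _)) _.
by apply: LocTrans _ (LocComp _ _ _); exact: LocHeq.
Qed.

Definition perfect_like (X Y : Db R) (s : hom X Y) :=
  exists (X0 Y0 : cplx R) (f : cmap X0 Y0)
    (a : @hom (Db R) X X0) (b : @hom (Db R) Y Y0) (Z : cplx R),
    [/\ is_iso a, is_iso b, b \oc s =h toDb f \oc a, perfect Z
      & @isomorphic (Db R) (cone f) Z].

(** The two differentials differ by the sign of [f]; negating the first component absorbs it. *)
Lemma cone_shift_iso (X Y : cplx R) (f : cmap X Y) :
  @isomorphic (Kb R) (cone (cshift_map f)) (cshift (cone f)).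
Proof.
pose T i := prod_mod (X (i + 1 + 1)) (Y (i + 1)).
have nL i : linear (fun u : T i => ((- u.1, u.2) : T i)).
  by move=> a u v; congr pair; rewrite /= opprD scalerN.
have nP1 i (u : T i) : mklin (nL (i + 1)) (cd (cone (cshift_map f)) i u) =
    cd (cshift (cone f)) i (mklin (nL i) u).
  by congr pair; rewrite /= ?opprK ?linearN //= opprD opprK.
have nP2 i (u : T i) : mklin (nL (i + 1)) (cd (cshift (cone f)) i u) =
    cd (cone (cshift_map f)) i (mklin (nL i) u).
  by congr pair; rewrite /= ?opprK ?linearN //= opprD.
exists (@CMap R (cone (cshift_map f)) (cshift (cone f)) (fun i => mklin (nL i)) nP1).
exists (@CMap R (cshift (cone f)) (cone (cshift_map f)) (fun i => mklin (nL i)) nP2).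
have nn i (u : T i) : mklin (nL i) (mklin (nL i) u) = u.
  by case: u => x y; congr pair; rewrite /= opprK.
by split; exists (fun=> \0) => i u; rewrite linear0 addr0 /= [X in X - _]nn subrr.
Qed.

Lemma cone_in_perfect (X Y : Db R) (s : hom X Y) :
  @cone_in (Db R) (@perfect R) X Y s -> perfect_like s.
Proof.
have L := Db_laws.
elim=> {X Y s}.
  move=> X Y Z u v w /dist_Db[X0 [Y0 [f [a [b [c [/= ia ib ic e]]]]]]] Zp.
  by exists X0, Y0, f, a, b, Z; split=> //; apply: isomorphic_sym; exists c.
move=> X Y s _ [X0 [Y0 [f [a [b [Z [ia ib e Zp iZ]]]]]]].
exists (cshift X0), (cshift Y0), (cshift_map f), (shm a), (shm b), (cshift Z); split.
- exact: is_iso_shm L _ _ _ ia.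
- exact: is_iso_shm L _ _ _ ib.
- apply: (heq_trans L) (heq_sym L (shm_comp L _ _)) _.
  by apply: (heq_trans L) (shm_heq L e) _; exact: (shm_comp L).
- by move=> i; exact: Zp.
- apply: (@isomorphic_trans _ L (cshift (cone f) : Db R)).
    by apply: loc_isomorphic; exact: cone_shift_iso.
  exact: isomorphic_sh L _ _ iZ.
Qed.

(** The isomorphism is only a zigzag, but it acts locally bijectively and sends zero to zero. *)
Lemma kills_iso (Z Z' : Db R) : isomorphic Z' Z -> kills Z -> kills Z'.
Proof.
move=> [g ig] kZ D c.
have [D' [r [b [cr gb]]]] := act_total Db_action g c.
apply: (loceq_local cr).
have := act_loceq (loceq_refl _) (kZ D' b) gb.
move=> /(proj2 (locally_bijective_iso Db_action ig)) /(_ (act_on_zero _ _ _)) h.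
by apply: loceq_trans h _; apply: loceq_hom; exact: uhom_eq.
Qed.

Lemma perfect_cone_bijective (X Y : Db R) (s : hom X Y) :
  @cone_in (Db R) (@perfect R) X Y s -> locally_bijective Db_action s.
Proof.
move/cone_in_perfect=> [X0 [Y0 [f [a [b [Z [ia ib e Zp iZ]]]]]]].
apply: (@locally_bijective_cancel _ _ _ _ _ _ _ b); last exact: locally_bijective_iso.
apply: locally_bijective_heq (heq_sym Db_laws e) _.
apply: locally_bijective_comp; first exact: locally_bijective_iso.
by apply: kills_bijective; apply: kills_iso iZ _; exact: perfect_kills.
Qed.

Definition Dsg_laws : scat_laws (Dsg R) := localization_laws Db_laws _.

Definition Dsg_action : @action R (Dsg R) id :=
  localization_action (@ConeInSh _ _) perfect_cone_bijective.

Definition toDsg (X Y : cplx R) (f : @hom (Db R) X Y) : @hom (Dsg R) X Y :=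
  @Loc (Db R) _ X Y f.

Lemma toDsg_isomorphic (X Y : Db R) : isomorphic X Y -> @isomorphic (Dsg R) X Y.
Proof. exact: loc_isomorphic. Qed.

Lemma dist_Dsg (t : triangle (Dsg R)) : dist t ->
  exists (X Y : cplx R) (f : cmap X Y),
    [/\ @isomorphic (Dsg R) (tX t) X, @isomorphic (Dsg R) (tY t) Y
      & @isomorphic (Dsg R) (tZ t) (cone f)].
Proof.
move=> [t0 /dist_Db[X [Y [f [a [b [c [ia ib ic _]]]]]]]].
move=> [a' [b' [c' [[ja jb jc] _]]]].
exists X, Y, f; split.
- apply: (isomorphic_trans Dsg_laws (Y := tX t0)); first by exists a'.
  by apply: toDsg_isomorphic; exists a.
- apply: (isomorphic_trans Dsg_laws (Y := tY t0)); first by exists b'.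
  by apply: toDsg_isomorphic; exists b.
- apply: (isomorphic_trans Dsg_laws (Y := tZ t0)); first by exists c'.
  by apply: toDsg_isomorphic; exists c.
Qed.

End Derived.

(** * A thick subcategory of the singularity category *)

Section ThickClass.
Variables (R : nzRingType) (P : probe R).
Implicit Types (D E : probe R).

(** For [P] a resolution of T, the chain-level form of Hom(T, X) = 0 in [Dsg]. Quantifying over all
    covers of [P] is what gives closure under retracts and extensions, where the auxiliary maps
    exist only after passing to a further cover. *)
Definition locally_trivial (X : cplx R) :=
  forall D (rho : ucmap D P), cov rho -> forall f : ucmap D X, loceq f (uzero D X).

Lemma locally_trivial_retract (X Y : Dsg R) :
  retract X Y -> locally_trivial Y -> locally_trivial X.
Proof.
move=> [i [p pi]] tY D rho c f.
have [D1 [r1 [b [c1 ib]]]] := act_total (Dsg_action R) i f.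
have [D2 [r2 [d [c2 pd]]]] := act_total (Dsg_action R) p b.
have /(act_heq (Dsg_action R) pi)/act_id fd := act_compI (act_restr ib r2) pd.
have b0 := tY D1 _ (cov_comp c1 c) b.
have d0 : loceq d (uzero D2 X).
  apply: act_fun pd _.
  apply: act_loceq (loceq_restr r2 (loceq_sym b0)) (loceq_refl _) _.
  apply: act_congr (act_on_zero (Dsg_action R) p D2); last exact: uhom_refl.
  exact: uhom_eq.
apply: (loceq_local (cov_comp c2 c1)).
apply: loceq_trans (loceq_hom (uassoc _ _ _)) _.
apply: loceq_trans (loceq_trans fd d0) _.
by apply: loceq_hom; exact: uhom_eq.
Qed.

Definition has_split_exact (Y C X : cplx R) :=
  exists (i : ucmap Y C) (p : ucmap C X), split_exact i p.

Lemma locally_trivial_extension Y C X :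
  has_split_exact Y C X -> locally_trivial Y -> locally_trivial X -> locally_trivial C.
Proof.
move=> [i [p ex]] tY tX D rho c f.
have [D1 [r1 [c1 h1]]] := tX D rho c (ucomp p f).
have [|f' h'] := @split_exact_lift R D1 Y C X i p (ucomp f r1) ex.
  apply/unullE; apply: uhom_trans (uassoc _ _ _) _; apply: uhom_trans h1 _.
  exact: uhom_zero_compr.
apply: (loceq_local c1).
apply: loceq_trans (loceq_hom (uhom_sym h')) _.
apply: loceq_trans (loceq_compl i (tY D1 _ (cov_comp c1 c) f')) _.
by apply: loceq_hom; apply: uhom_trans (uhom_zero_compl _ _) _; exact: uhom_eq.
Qed.

Lemma has_split_exact_shift Y C X :
  has_split_exact Y C X -> has_split_exact (cshift Y) (cshift C) (cshift X).
Proof.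
move=> [i [p [r [s [ps ri pi dec]]]]].
exists (cshift_map (cmap_of i)), (cshift_map (cmap_of p)), (fun j => r (j + 1)), (fun j => s (j + 1)).
by split=> j x; [exact: ps|exact: ri|exact: pi|exact: dec].
Qed.

Lemma has_split_exact_cone (X Y : cplx R) (f : cmap X Y) :
  has_split_exact Y (cone f) (cshift X).
Proof.
exists (cone_incl f), (cone_proj f), (fun j => csnd f j).
have sL j : linear (fun x : X (j + 1) => ((x, 0) : prod_mod (X (j + 1)) (Y j))).
  by move=> a x y; congr pair; rewrite /= scaler0 addr0.
exists (fun j => mklin (sL j)); split=> // j [x y] /=.
by congr pair; rewrite /= ?add0r ?addr0.
Qed.

Definition shift_iter k (X : cplx R) : cplx R := iter k (@cshift R) X.

Lemma has_split_exact_iter k Y C X : has_split_exact Y C X ->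
  has_split_exact (shift_iter k Y) (shift_iter k C) (shift_iter k X).
Proof. by move=> h; elim: k => [//|k IH]; exact: has_split_exact_shift. Qed.

Definition eventually_trivial (X : cplx R) :=
  exists n, forall k, (n <= k)%N -> locally_trivial (shift_iter k X).

Lemma eventually_trivial_retract (X Y : Dsg R) :
  retract X Y -> eventually_trivial Y -> eventually_trivial X.
Proof.
move=> rXY [n nP]; exists n => k nk.
apply: locally_trivial_retract (nP k nk).
exact: (retract_iter_sh (Dsg_laws R) k rXY).
Qed.

(** The threshold absorbs shifts in both directions. For a cone, shifting preserves the degreewise
    split sequence Y -> cone -> X[1]. *)
Lemma eventually_trivial_thick :
  @thick_subcat (Dsg R) eventually_trivial.
Proof.
split.
- move=> X Y iXY; apply: eventually_trivial_retract; apply: retract_iso.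
  exact: isomorphic_sym.
- move=> X; split=> -[n nP].
    exists n => k nk; rewrite /shift_iter -iterSr; apply: nP; lia.
  exists n.+1 => -[//|k] nk; rewrite /shift_iter iterSr; exact: nP.
- move=> t /dist_Dsg[X [Y [f [iX iY iZ]]]] /= tX tY.
  apply: eventually_trivial_retract (retract_iso iZ) _.
  have [n nP] : eventually_trivial X.
    by apply: eventually_trivial_retract tX; apply: retract_iso; exact: isomorphic_sym.
  have [m mP] : eventually_trivial Y.
    by apply: eventually_trivial_retract tY; apply: retract_iso; exact: isomorphic_sym.
  exists (maxn n m) => k; rewrite geq_max => /andP[nk mk].
  apply: locally_trivial_extension (has_split_exact_iter k (has_split_exact_cone f)) _ _.
    exact: mP.
  by rewrite /shift_iter -iterSr; apply: nP; lia.
- by move=> X Y /retract_summand; exact: eventually_trivial_retract.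
Qed.

End ThickClass.

(** * Truncations *)

Section Truncation.
Variables (R : nzRingType) (nth : noeth R) (D : probe R) (m : int).

(** Describes the truncation im(d^m) -> D^{m+1} -> D^{m+2} -> ... with the image in degree [m].
    Cutting every term out of the same product avoids a case distinction on the degree in the types
    of the differentials. *)
Definition trunc_pred i (u : prod_mod (D i) (D (i + 1))) :=
  [/\ (i <= m)%R -> u.1 = 0, i <> m -> u.2 = 0 & exists z, ud D i z = u.2].

Lemma trunc_pred0 i : trunc_pred (0 : prod_mod (D i) (D (i + 1))).
Proof. by split=> //; exists 0; rewrite linear0. Qed.

Lemma trunc_predL i a (u v : prod_mod (D i) (D (i + 1))) :
  trunc_pred u -> trunc_pred v -> trunc_pred (a *: u + v).
Proof.
move=> [u1 u2 [z zE]] [v1 v2 [z' z'E]]; split=> [im|im|] /=.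
- by rewrite u1 // v1 // scaler0 addr0.
- by rewrite u2 // v2 // scaler0 addr0.
- by exists (a *: z + z'); rewrite linearP zE z'E.
Qed.

Definition trunc_subm i : subm (prod_mod (D i) (D (i + 1))) :=
  Subm (@trunc_pred0 i) (@trunc_predL i).

Definition trunc_mod i : fgmod R := subfg nth (trunc_subm i).

Definition trunc_val i : {linear trunc_mod i -> prod_mod (D i) (D (i + 1))} :=
  subfg_inc.

Lemma trunc_valP i u : trunc_pred (trunc_val i u).
Proof. exact: (subfg_incP u). Qed.

Lemma trunc_val_inj i : injective (trunc_val i).
Proof. exact: subfg_inc_inj. Qed.

Definition trunc_fst i : {linear prod_mod (D i) (D (i + 1)) -> D i} := fst.
Definition trunc_snd i : {linear prod_mod (D i) (D (i + 1)) -> D (i + 1)} := snd.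

Lemma trunc_d_ex i : exists d : {linear trunc_mod i -> trunc_mod (i + 1)},
  forall u, trunc_val (i + 1) (d u) = (ud D i (trunc_val i u).1 + (trunc_val i u).2, 0).
Proof.
have fL : linear (fun u : trunc_mod i =>
    ((ud D i (trunc_val i u).1 + (trunc_val i u).2, 0)
     : prod_mod (D (i + 1)) (D (i + 1 + 1)))).
  move=> a u v; congr pair; last by rewrite /= scaler0 addr0.
  have -> : trunc_val i (a *: u + v) = a *: trunc_val i u + trunc_val i v.
    by rewrite linearP.
  rewrite /=; have -> : ud D i (a *: (trunc_val i u).1 + (trunc_val i v).1) =
    a *: ud D i (trunc_val i u).1 + ud D i (trunc_val i v).1 by rewrite linearP.
  by rewrite scalerDr addrACA.
apply: (@subfg_corestr R nth _ (trunc_subm (i + 1)) (trunc_mod i) (mklin fL)) => u.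
have [u1 u2 _] := trunc_valP u.
split=> //= [im|]; last by exists 0; rewrite linear0.
by rewrite u1 ?u2 ?linear0 ?addr0 //; lia.
Qed.

Definition trunc_d i : {linear trunc_mod i -> trunc_mod (i + 1)} :=
  sval (constructive_indefinite_description _ (trunc_d_ex i)).

Lemma trunc_dE i u : trunc_val (i + 1) (trunc_d i u) =
  (ud D i (trunc_val i u).1 + (trunc_val i u).2, 0).
Proof. by rewrite /trunc_d; case: constructive_indefinite_description. Qed.

Lemma trunc_dd i u : trunc_d (i + 1) (trunc_d i u) = 0.
Proof.
apply: trunc_val_inj; rewrite !trunc_dE linear0 /= addr0 linearD udd add0r.
by have [_ _ [z <-]] := trunc_valP u; rewrite udd.
Qed.

Lemma trunc_bounded : exists n : nat, forall i : int, (n < absz i)%N -> zero_mod (trunc_mod i).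
Proof.
have [b bP] := probe_bdd D; exists (absz b + absz m)%N => i hi u.
apply: trunc_val_inj; rewrite linear0.
have [u1 u2 _] := trunc_valP u.
have im : i <> m by lia.
rewrite [trunc_val i u]surjective_pairing u2 //; congr pair.
have [im'|mi] := boolP (i <= m)%R; first exact: u1.
by apply: bP; lia.
Qed.

Definition trunc : cplx R := Cplx trunc_dd trunc_bounded.

Lemma trunc_map_ex i : exists t : {linear D i -> trunc_mod i}, forall z,
  trunc_val i (t z) = (if (m < i)%R then z else 0, if i == m then ud D i z else 0).
Proof.
have fL : linear (fun z : D i => ((if (m < i)%R then z else 0,
    if i == m then ud D i z else 0) : prod_mod (D i) (D (i + 1)))).
  move=> a u v; congr pair; rewrite /=; case: ifP => _ //.
  - by rewrite scaler0 addr0.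
  - by rewrite linearP.
  - by rewrite scaler0 addr0.
apply: (@subfg_corestr R nth _ (trunc_subm i) (D i) (mklin fL)) => z.
split=> /= [im|im|].
- by rewrite ifF //; lia.
- by rewrite ifF //; apply/eqP.
- by case: ifP => _; [exists z|exists 0; rewrite linear0].
Qed.

Definition trunc_map_fun i : {linear D i -> trunc_mod i} :=
  sval (constructive_indefinite_description _ (trunc_map_ex i)).

Lemma trunc_mapE i z : trunc_val i (trunc_map_fun i z) =
  (if (m < i)%R then z else 0, if i == m then ud D i z else 0).
Proof. by rewrite /trunc_map_fun; case: constructive_indefinite_description. Qed.

Lemma trunc_mapP i z : trunc_map_fun (i + 1) (ud D i z) = ud trunc i (trunc_map_fun i z).
Proof.
apply: trunc_val_inj; rewrite trunc_dE !trunc_mapE /=; congr pair.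
  have [mi|im] := boolP (m < i)%R.
    have -> : (m < i + 1)%R by lia.
    have -> : (i == m) = false by lia.
    by rewrite addr0.
  rewrite linear0 add0r; have [e|ne] := eqVneq i m.
    by have -> : (m < i + 1)%R by lia.
  by have -> : (m < i + 1)%R = false by lia.
by case: ifP => // _; rewrite udd.
Qed.

Definition trunc_map : ucmap D trunc := @UCMap R D trunc trunc_map_fun trunc_mapP.

Lemma trunc_map_qis :
  (forall i, (i < m)%R -> exact_at (ud D i) (ud D (i + 1))) -> uqis trunc_map.
Proof.
move=> Dex; split=> [i z u dz tz|i u du].
  have [im|mi] := boolP (i < m)%R; first exact/(Dex i im).
  have := congr1 (trunc_val (i + 1)) tz; rewrite trunc_dE trunc_mapE => e.
  have := congr1 fst e => /=; rewrite ifT; last by lia.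
  have [_ _ [z' <-]] := trunc_valP u.
  by move=> ->; exists ((trunc_val i u).1 + z'); rewrite linearD.
have [u1 u2 _] := trunc_valP u.
have e := congr1 (trunc_val (i + 1 + 1)) du; rewrite trunc_dE linear0 in e.
have e1 : ud D (i + 1) (trunc_val (i + 1) u).1 + (trunc_val (i + 1) u).2 = 0.
  exact: (congr1 fst e).
have v2 : (trunc_val (i + 1) u).2 = 0.
  have [im|mi] := boolP (i + 1 <= m)%R; last by apply: u2; lia.
  by move: e1; rewrite u1 // linear0 add0r.
have d1 : ud D (i + 1) (trunc_val (i + 1) u).1 = 0 by move: e1; rewrite v2 addr0.
exists (trunc_val (i + 1) u).1, 0; split=> //; rewrite linear0 addr0.
apply: trunc_val_inj; rewrite trunc_mapE d1 if_same [LHS]surjective_pairing v2.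
by case: ifP => // mi; rewrite u1 //; lia.
Qed.

Lemma trunc_factor (Y : ucplx R) (f : ucmap D Y) :
  (forall i, (i <= m)%R -> zero_mod (Y i)) ->
  exists g : ucmap trunc Y, forall i z, f i z = g i (trunc_map i z).
Proof.
move=> Yz.
pose g i : {linear trunc_mod i -> Y i} := f i \o (trunc_fst i \o trunc_val i).
have gP i u : g (i + 1) (ud trunc i u) = ud Y i (g i u).
  have [u1 u2 [z zE]] := trunc_valP u.
  (* In degree [m] the differential of the truncation is the inclusion of im(d^m), where [f]
     vanishes because [Y m] is zero. *)
  have fz : f (i + 1) (trunc_val i u).2 = 0.
    have [e|/eqP ne] := eqVneq i m; last by rewrite u2 // linear0.
    by rewrite -zE ufunP (Yz i _ (f i z)) ?linear0 // e.
  by rewrite /g /= trunc_dE /= linearD ufunP fz addr0.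
exists (@UCMap R trunc Y g gP) => i z; rewrite /= trunc_mapE /=.
by case: ifP => // im; rewrite linear0; apply: Yz; lia.
Qed.

Lemma trunc_perfect : projective (image_mod (ud D m)) -> perfect trunc.
Proof.
move=> Ip i; have [mi|im] := boolP (m < i)%R.
  apply: (@projective_retract R (D i) (trunc_mod i)
    (trunc_fst i \o trunc_val i) (trunc_map_fun i)); last exact: probe_proj.
  move=> u; apply: trunc_val_inj; rewrite /= trunc_mapE mi ifF; last by lia.
  rewrite [RHS]surjective_pairing; congr pair.
  by have [_ -> //] := trunc_valP u; lia.
have [e|ne] := eqVneq i m; last first.
  apply: projective_zero => u; apply: trunc_val_inj; rewrite linear0.
  have [u1 u2 _] := trunc_valP u.
  by rewrite [LHS]surjective_pairing u1 ?u2 //; lia.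
subst i.
have [r rE] : exists r : {linear image_mod (ud D m) -> trunc_mod m},
    forall y, trunc_val m (r y) = (0, image_inc y).
  have fL : linear (fun y : image_mod (ud D m) =>
      ((0, image_inc y) : prod_mod (D m) (D (m + 1)))).
    by move=> a u v; congr pair; rewrite ?linearP //= scaler0 addr0.
  apply: (@subfg_corestr R nth _ (trunc_subm m) _ (mklin fL)) => y.
  by split=> //=; have [z zE] := image_incP y; exists z.
have [s sE] : exists s : {linear trunc_mod m -> image_mod (ud D m)},
    forall u, image_inc (s u) = (trunc_val m u).2.
  apply: (@subm_corestr _ _ (im_subm (ud D m)) _ (trunc_snd m \o trunc_val m)) => u.
  by have [_ _ h] := trunc_valP u.
apply: (projective_retract (i := s) (r := r)) Ip => u.
apply: trunc_val_inj; rewrite rE sE [RHS]surjective_pairing.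
by have [-> //] := trunc_valP u.
Qed.

End Truncation.

(** * Covers as morphisms of the singularity category *)

Section Fullness.
Variables (R : nzRingType) (nth : noeth R).
Implicit Types (D E : probe R).

Lemma uqis_exact_low D (X : cplx R) (q : ucmap D X) : uqis q ->
  exists n : nat, forall i : int, (i < - n%:Z)%R -> exact_at (ud D i) (ud D (i + 1)).
Proof.
move=> [inj _]; have [n nP] := cbounded X; exists n.+1 => i hi z.
split=> [dz|[y <-]]; last exact: udd.
by apply: (inj i z 0 dz); apply: etrans (nP _ _ _) (esym (nP _ _ _)); lia.
Qed.

Lemma uqis_cancel D (X Y : ucplx R) (t : ucmap D X) (q : ucmap X Y) (p : ucmap D Y) :
  (forall i z, p i z = q i (t i z)) -> uqis t -> uqis p -> uqis q.
Proof.
move=> pE [tinj tsur] [pinj psur]; split=> [i u y du qu|i y dy].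
  have [z [v [dz e]]] := tsur i u du.
  have [|x xE] := pinj i z (y - q i v) dz.
    rewrite pE; have -> : t (i + 1) z = u - ud X i v by rewrite e addrK.
    by rewrite !linearB qu ufunP.
  by exists (t i x + v); rewrite linearD -ufunP xE -e.
have [x [z [dx e]]] := psur i y dy.
by exists (t (i + 1) x), z; split; [rewrite -ufunP dx linear0|rewrite -pE].
Qed.

Section CoconeMap.
Variables (D : probe R) (X Q : cplx R) (t : ucmap D X).
Variables (g : ucmap D (ush Q)) (g' : ucmap X (ush Q)).
Hypothesis gE : forall i z, g i z = g' i (t i z).

Lemma cocone_mapD i x y :
  g' (i + 1) (x + ud X i y) = g' (i + 1) x + - ud Q (i + 1) (g' i y).
Proof.
apply: etrans (linearD _ _ _) _; apply: (congr1 (fun u => g' (i + 1) x + u)).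
exact (@ufunP R X (ush Q) g' i y).
Qed.

Lemma bcc_bounded :
  exists n : nat, forall i : int, (n < absz i)%N -> zero_mod (ucc g' i).
Proof.
have [m mP] := cbounded X; have [n nP] := cbounded Q.
by exists (m + n)%N => i hi [x y]; congr pair; [apply: mP|apply: nP]; lia.
Qed.

(** The cocone over the bounded replacement [X] of the probe [D]: unlike [ucc g] it is an object of
    [Kb R], and [bcc_map] compares the two. *)
Definition bcc : cplx R := Cplx (@udd _ (ucc g')) bcc_bounded.

Definition bcc_proj : cmap bcc X := cmap_of (ucc_proj g' : ucmap bcc X).

Lemma bcc_map_linear i :
  linear (fun u : ucc g i => ((t i (ucc_fst g i u), ucc_snd g i u) : ucc g' i)).
Proof. by move=> a u v; congr pair; rewrite linearP //= linearP. Qed.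

Lemma bcc_mapP i (u : ucc g i) : mklin (@bcc_map_linear (i + 1)) (ud (ucc g) i u) =
  ud bcc i (mklin (@bcc_map_linear i) u).
Proof. by congr pair; rewrite /= ?ufunP // gE. Qed.

Definition bcc_map : ucmap (ucc g) bcc :=
  @UCMap R (ucc g) bcc (fun i => mklin (@bcc_map_linear i)) bcc_mapP.

Lemma bcc_map_qis : uqis t -> uqis bcc_map.
Proof.
move=> [tinj tsur]; split.
  move=> j [x w] [y v] dz e; have [i ji] := int_succ j; subst j.
  have dx : ud D (i + 1 + 1) x = 0 := congr1 fst dz.
  have e1 : t (i + 1 + 1) x = ud X (i + 1) y := congr1 fst e.
  have e2 : w = g' (i + 1) y + ud Q (i + 1) v := congr1 snd e.
  have [x1 x1E] := tinj (i + 1) x y dx e1.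
  have [|x2 [y1 [dx2 e3]]] := tsur i (t (i + 1) x1 - y).
    by rewrite linearB -ufunP x1E e1 subrr.
  have e4 : t (i + 1) (x1 - x2) = y + ud X i y1.
    rewrite linearB; have zm (V : zmodType) (p q r s : V) : p - q = r + s -> p - r = q + s.
      by move=> h; rewrite -[p](subrK q) h addrAC [r + s]addrC addrK addrC.
    exact: zm e3.
  exists (x1 - x2, v + g' i y1); congr pair.
    by rewrite /= linearB x1E dx2 subr0.
  have e5 : g' (i + 1) (y + ud X i y1) = g' (i + 1) y + - ud Q (i + 1) (g' i y1).
    exact: cocone_mapD.
  rewrite /= [cd Q _ _]linearD e2.
  have e6 : g (i + 1) (x1 - x2) = g' (i + 1) y - ud Q (i + 1) (g' i y1).
    by rewrite -e5 -e4; exact: gE.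
  have zm2 (V : zmodType) (p q r s : V) : p = q - s -> p + (r + s) = q + r.
    by move=> ->; rewrite addrACA addNr addr0.
  exact: zm2 e6.
move=> i [y v] dz.
have dy : ud X (i + 1) y = 0 := congr1 fst dz.
have dv : g' (i + 1) y + ud Q (i + 1) v = 0 := congr1 snd dz.
have [x [z [dx e]]] := tsur i y dy.
exists (x, v - g' i z), (z, 0); split; congr pair.
- exact: dx.
- have e5 : g' (i + 1) y = g' (i + 1) (t (i + 1) x) + - ud Q (i + 1) (g' i z).
    by rewrite e; exact: cocone_mapD.
  rewrite /= gE; apply: etrans _ dv; rewrite e5 [cd Q _ _]linearB /=.
  have zm (V : zmodType) (p q r : V) : p + (q - r) = p - r + q.
    by rewrite addrCA addrC.
  exact: zm.
- exact: e.
- by rewrite /= linear0 addr0 subrK.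
Qed.

(** Rotation of the triangle: [((x, w), y)] goes to [w + g' y], with inverse [w] to [((0, w), 0)] up
    to a homotopy. So the cocone projection has a perfect cone when [Q] is perfect. *)
Lemma bcc_proj_cone : @isomorphic (Kb R) (cone bcc_proj) (cshift Q).
Proof.
pose T i := prod_mod (prod_mod (X (i + 1)) (Q (i + 1))) (X i).
have fL i : linear (fun u : T i => (u.1.2 + g' i u.2 : Q (i + 1))).
  by move=> a u v; rewrite /= [g' i _]linearP scalerDr addrACA.
have bL i : linear (fun w : Q (i + 1) => (((0, w), 0) : T i)).
  by move=> a u v; congr pair; [congr pair|]; rewrite /= scaler0 addr0.
have fP i (u : T i) : mklin (fL (i + 1)) (cd (cone bcc_proj) i u) =
    cd (cshift Q) i (mklin (fL i) u).
  have zm (V : zmodType) (p q r s : V) : s = p - r -> - (p + q) + s = - (q + r).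
    by move=> ->; rewrite !opprD [- p - q]addrC addrA addrNK.
  by rewrite /= [cd Q _ _]linearD; apply: zm; exact: cocone_mapD.
have bP i (w : Q (i + 1)) : mklin (bL (i + 1)) (cd (cshift Q) i w) =
    cd (cone bcc_proj) i (mklin (bL i) w).
  congr pair; [congr pair|]; rewrite /= ?linear0 ?oppr0 ?add0r //.
exists (@CMap R (cone bcc_proj) (cshift Q) (fun i => mklin (fL i)) fP).
exists (@CMap R (cshift Q) (cone bcc_proj) (fun i => mklin (bL i)) bP).
split; last first.
  exists (fun=> \0) => i w.
  by rewrite /= !linear0 !addr0 /mklin_fun /= linear0 addr0 subrr.
have hL i : linear (fun u : T (i + 1) => (((- u.2, 0), 0) : T i)).
  move=> a u v; congr pair; last by rewrite /= scaler0 addr0.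
  by congr pair; rewrite /= ?opprD ?scalerN // scaler0 addr0.
exists (fun i => mklin (hL i)) => i [[x w] y].
congr pair; [congr pair|]; rewrite /= /mklin_fun /=.
- rewrite linearN; have zm (V : zmodType) (p q : V) : 0 - p = - - q - (p + q).
    by rewrite opprK opprD addrCA subrr addr0 sub0r.
  exact: zm.
- rewrite linear0 addr0 linearN opprK addr0.
  by rewrite [LHS]addrC addKr.
- by rewrite linear0 !addr0 sub0r.
Qed.
End CoconeMap.

Lemma dist_of_cone (X Y Z : cplx R) (f : cmap X Y) : @isomorphic (Kb R) (cone f) Z ->
  exists (v : cmap Y Z) (w : cmap Z (cshift X)),
    dist (@Triangle (Db R) X Y Z (toDb f) (toDb v) (toDb w)).
Proof.
move=> [c [c' [c'c cc']]]; have L := Kb_laws R.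
pose v : @hom (Kb R) Y Z := c \oc cone_incl f.
pose w : @hom (Kb R) Z (cshift X) := (cone_proj f : @hom (Kb R) _ _) \oc c'.
exists v, w; exists (@Triangle (Kb R) X Y Z f v w); last first.
  exists (idm (X : Db R)), (idm (Y : Db R)), (idm (Z : Db R)).
  have L' := Db_laws R.
  have idiso (V : Db R) : is_iso (idm V) by exists (idm V); split; exact: (heq_idl L').
  split; first by split; exact: idiso.
  split.
  - exact: (heq_trans L') (heq_idl L' _) (heq_sym L' (heq_idr L' _)).
  - exact: (heq_trans L') (heq_idl L' _) (heq_sym L' (heq_idr L' _)).
  apply: (heq_trans L') (heq_congr L' (shm_id L' _) (heq_refl L' _)) _.
  exact: (heq_trans L') (heq_idl L' _) (heq_sym L' (heq_idr L' _)).
exists X, Y, f, (idm (X : Kb R)), (idm (Y : Kb R)), c'.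
have idiso (V : Kb R) : is_iso (idm V) by exists (idm V); split; exact: (heq_idl L).
split; first by split; [exact: idiso|exact: idiso|exists c].
split.
- exact: (heq_trans L) (heq_idl L _) (heq_sym L (heq_idr L _)).
- apply: (heq_trans L) (heq_assoc L _ _ _) _.
  apply: (heq_trans L) (heq_congr L c'c (heq_refl L _)) _.
  exact: (heq_trans L) (heq_idl L _) (heq_sym L (heq_idr L _)).
- apply: (heq_trans L) (heq_congr L (shm_id L _) (heq_refl L _)) _.
  exact: heq_idl.
Qed.

Lemma qis_cone_in (X Y : cplx R) (f : cmap X Y) :
  uqis f -> @cone_in (Kb R) (@acyclic R) X Y f.
Proof.
move=> /acyclic_cone_qis fac.
apply: (@ConeIn (Kb R) (@acyclic R) X Y (cone f) f (cone_incl f) (cone_proj f)) => //.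
exists X, Y, f; have L := Kb_laws R.
have idiso (V : Kb R) : is_iso (idm V) by exists (idm V); split; exact: (heq_idl L).
exists (idm (X : Kb R)), (idm (Y : Kb R)), (idm (cone f : Kb R)).
split; first by split; exact: idiso.
split.
- exact: (heq_trans L) (heq_idl L _) (heq_sym L (heq_idr L _)).
- exact: (heq_trans L) (heq_idl L _) (heq_sym L (heq_idr L _)).
- apply: (heq_trans L) (heq_congr L (shm_id L _) (heq_refl L _)) _.
  exact: (heq_trans L) (heq_idl L _) (heq_sym L (heq_idr L _)).
Qed.

Lemma bcc_proj_cone_in (X Q : cplx R) (g' : ucmap X (ush Q)) : perfect Q ->
  @cone_in (Db R) (@perfect R) (bcc g') X (toDb (bcc_proj g')).
Proof.
move=> Qp; have [v [w vw]] := dist_of_cone (bcc_proj_cone g').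
by apply: ConeIn vw _ => i; exact: Qp.
Qed.

Definition qis_inv (X Y : cplx R) (f : cmap X Y) (fq : uqis f) : @hom (Dsg R) Y X :=
  toDsg (Inv (qis_cone_in fq) : @hom (Db R) Y X).

Lemma common_truncation D (X Y : cplx R) (q : ucmap D X) (f : ucmap D Y) : uqis q ->
  exists (Z : cplx R) (t : ucmap D Z) (q' : ucmap Z X) (f' : ucmap Z Y),
    [/\ uqis t, uqis q', forall i z, q i z = q' i (t i z)
      & forall i z, f i z = f' i (t i z)].
Proof.
move=> qq; have [n nP] := uqis_exact_low qq.
have [a aP] := cbounded X; have [b bP] := cbounded Y.
(* Low enough for [D] to be exact up to degree [m] and for both [X] and [Y] to vanish there, so a
   single truncation serves both maps. *)
pose m : int := - (n + a + b + 1)%N%:Z.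
have tq : uqis (trunc_map nth D m).
  by apply: trunc_map_qis => i im; apply: nP; rewrite /m in im; lia.
have [|q' q'E] := trunc_factor nth (m := m) q.
  by move=> i im; apply: aP; rewrite /m in im; lia.
have [|f' f'E] := trunc_factor nth (m := m) f.
  by move=> i im; apply: bP; rewrite /m in im; lia.
exists (trunc nth D m), (trunc_map nth D m), q', f'; split=> //.
exact: uqis_cancel q'E tq qq.
Qed.

(* A cover D of a resolution P of T has a bounded quasi-isomorphic quotient X, and the
   cover itself becomes an isomorphism between T and X in the singularity category. *)
Lemma cover_representable (P : probe R) (T : cplx R) (pi : ucmap P T) : uqis pi ->
  forall D (rho : ucmap D P), cov rho -> exists (X : cplx R) (theta : @hom (Dsg R) T X)
    (q : ucmap D X), uqis q /\ act (Dsg_action R) theta (ucomp pi rho) q.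
Proof.
move=> piq D rho c; elim: c pi piq => {D P rho}.
- move=> P pi piq; exists T, (idm (T : Dsg R)), pi; split=> //.
  by apply/act_id; apply: loceq_hom; exact: uhom_eq.
- move=> D P rho Q Qp g c IH pi piq.
  have [X [theta [q [qq thq]]]] := IH pi piq.
  pose gs : ucmap D (cshift Q) := @UCMap R D (cshift Q) (fun i => g i) (@ufunP _ _ _ g).
  have [Z [t [q' [g' [tq q'q q'E g'E]]]]] := common_truncation gs qq.
  pose g2 : ucmap Z (ush Q) := @UCMap R Z (ush Q) (fun i => g' i) (@ufunP _ _ _ g').
  have g2E i z : g i z = g2 i (t i z) by exact: g'E.
  pose s : cmap Z X := cmap_of q'.
  have sq : uqis s by exact: q'q.
  (* Each cover step inverts two morphisms: the quasi-isomorphism from the truncation, and the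
     cocone projection with its perfect cone. *)
  pose th1 : @hom (Dsg R) T Z := qis_inv sq \oc theta.
  pose th2 : @hom (Dsg R) T (bcc g2) :=
    (Inv (bcc_proj_cone_in g2 Qp) : @hom (Dsg R) Z (bcc g2)) \oc th1.
  exists (bcc g2), th2, (bcc_map g2E); split; first exact: bcc_map_qis.
  apply: (@act_compI R (Dsg R) id (Dsg_action R) T Z (bcc g2)
    (Inv (bcc_proj_cone_in g2 Qp)) th1 (pcc Qp g) _ (ucomp t (ucc_proj g))); last first.
    by apply: loceq_hom; exact: uhom_eq.
  apply: (act_congr (uassocV _ _ _) (uhom_refl _)).
  apply: act_restr; apply: act_compI thq _.
  by apply: loceq_hom; apply: uhom_eq => i x; rewrite /= q'E.
- move=> D P rho rho' c IH h pi piq.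
  have [X [theta [q [qq thq]]]] := IH pi piq.
  exists X, theta, q; split=> //.
  by apply: act_congr thq; [exact: uhom_compl|exact: uhom_refl].
Qed.

(** The zigzag T -> X <- Z -> Y built from the cover sends the structure map of the cover to [f];
    being zero, it forces [f] to be locally zero. *)
Lemma hom_vanish_locally_trivial (P : probe R) (T Y : cplx R) (pi : ucmap P T) :
  uqis pi -> (forall f : @hom (Dsg R) T Y, f =h zerom _ _) -> locally_trivial P Y.
Proof.
move=> piq hz D rho c f.
have [X [theta [q [qq thq]]]] := cover_representable piq c.
have [Z [t [q' [f' [tq q'q q'E f'E]]]]] := common_truncation f qq.
have sq : uqis (cmap_of q') by exact: q'q.
pose phi : @hom (Dsg R) T Y := toDsg (toDb (cmap_of f')) \oc (qis_inv sq \oc theta).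
have : act (Dsg_action R) phi (ucomp pi rho) f.
  apply: (act_compI (c := t)); last first.
    by apply: loceq_hom; apply: uhom_eq => i x; rewrite /= f'E.
  apply: act_compI thq _.
  by apply: loceq_hom; apply: uhom_eq => i x; rewrite /= q'E.
by move/(act_heq (Dsg_action R) (hz phi))/act_zero.
Qed.

End Fullness.

(** * Projective resolutions of complexes *)

Section ComplexResolution.
Variables (R : nzRingType) (nth : noeth R).

Definition free_poly n : {linear freemod R n -> {poly R}} :=
  free_map (fun k : 'I_n => 'X^k : {poly R}).

Lemma free_polyE n f : free_poly n f = \poly_(k < n) (if insub k is Some i then f i else 0).
Proof.
rewrite /free_poly free_mapE poly_def; apply: eq_bigr => i _.
by rewrite valK.
Qed.

Lemma coef_free_poly n f (k : 'I_n) : (free_poly n f)`_k = f k.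
Proof. by rewrite free_polyE coef_poly ltn_ord valK. Qed.

Lemma size_free_poly n f : (size (free_poly n f) <= n)%N.
Proof. by rewrite free_polyE; exact: size_poly. Qed.

Lemma poly_free_ex n : exists g : {linear {poly R} -> freemod R n},
  forall p, g p = [ffun k : 'I_n => (p`_k : R^o)].
Proof.
apply: ex_linear => a p q; apply/ffunP=> k.
by rewrite !ffunE coefD coefZ.
Qed.

Definition poly_free n : {linear {poly R} -> freemod R n} :=
  sval (constructive_indefinite_description _ (poly_free_ex n)).

Lemma poly_freeE n p : poly_free n p = [ffun k : 'I_n => (p`_k : R^o)].
Proof. by rewrite /poly_free; case: constructive_indefinite_description. Qed.

Lemma free_polyK n f : poly_free n (free_poly n f) = f.
Proof. by apply/ffunP=> k; rewrite poly_freeE ffunE coef_free_poly. Qed.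

Lemma poly_freeK n (p : {poly R}) : (size p <= n)%N -> free_poly n (poly_free n p) = p.
Proof.
move=> hp; apply/polyP=> k; have [kn|nk] := ltnP k n.
  by rewrite (coef_free_poly _ (Ordinal kn)) poly_freeE ffunE.
rewrite !nth_default //; first exact: leq_trans hp nk.
by apply: leq_trans nk; exact: size_free_poly.
Qed.

Variable X : cplx R.

(* All terms of the resolution are submodules of polynomials of bounded size in
   the same module {poly R}, so that the differentials can be chosen one degree
   at a time without transporting along equalities of ranks. *)
Record stage (i : int) := Stage {
  st_rank : nat;
  st_d : {linear {poly R} -> {poly R}};
  st_e : {linear {poly R} -> X i}
}.

(** The second clause says that stage [i] surjects onto the pullback of the cycles of stage [i + 1]
    and [X i] over [X (i + 1)]. This yields both halves of [uqis]; the case [z = 0] lifts cycles of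
    X to cycles. *)
Definition stage_ok i (s : stage i) (s' : stage (i + 1)) :=
  (forall p : {poly R}, [/\ (size (st_d s p) <= st_rank s')%N, st_d s' (st_d s p) = 0
     & cd X i (st_e s p) = st_e s' (st_d s p)]) /\
  (forall (z : {poly R}) (x : X i), (size z <= st_rank s')%N -> st_d s' z = 0 -> cd X i x = st_e s' z ->
     exists p : {poly R}, [/\ (size p <= st_rank s)%N, st_d s p = z & st_e s p = x]).

(** The pullback [W] is finitely generated, and the new stage is free on its generators;
    coefficients of a polynomial serve as coordinates. *)
Lemma stage_step i (s' : stage (i + 1)) (s'' : stage (i + 1 + 1)) :
  stage_ok s' s'' -> exists s : stage i, stage_ok s s'.
Proof.
move=> [ok1 ok2]; pose n' := st_rank s'; pose phi := free_poly n'.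
pose M := prod_mod (freemod R n') (X i).
have WL a (u v : M) : (st_d s' (phi u.1) = 0 /\ cd X i u.2 = st_e s' (phi u.1)) ->
    (st_d s' (phi v.1) = 0 /\ cd X i v.2 = st_e s' (phi v.1)) ->
    st_d s' (phi (a *: u + v).1) = 0 /\
    cd X i (a *: u + v).2 = st_e s' (phi (a *: u + v).1).
  move=> [u1 u2] [v1 v2] /=; split.
    by rewrite [phi _]linearP [st_d _ _]linearP u1 v1 scaler0 addr0.
  by rewrite linearP [phi _]linearP [st_e _ _]linearP u2 v2.
have W0 : st_d s' (phi (0 : M).1) = 0 /\ cd X i (0 : M).2 = st_e s' (phi (0 : M).1).
  by split; rewrite /= !linear0.
pose W : subm M := Subm (sm_pred := fun u : M => st_d s' (phi u.1) = 0 /\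
   cd X i u.2 = st_e s' (phi u.1)) W0 WL.
have [n [w wP]] := nth W.
have [dd ddE] : exists d : {linear {poly R} -> {poly R}}, forall p,
    d p = \sum_(k < n) p`_k *: phi (subm_inc (w k)).1.
  apply: ex_linear => a p q; rewrite scaler_sumr -big_split; apply: eq_bigr => k _.
  by rewrite coefD coefZ scalerDl scalerA.
have [ee eeE] : exists e : {linear {poly R} -> X i}, forall p,
    e p = \sum_(k < n) p`_k *: (subm_inc (w k)).2.
  apply: ex_linear => a p q; rewrite scaler_sumr -big_split; apply: eq_bigr => k _.
  by rewrite coefD coefZ scalerDl scalerA.
have WE p : exists u : subm_sort W, dd p = phi (subm_inc u).1 /\ ee p = (subm_inc u).2.
  exists (\sum_(k < n) p`_k *: w k).
  have sumE : subm_inc (\sum_(k < n) p`_k *: w k) = \sum_(k < n) p`_k *: subm_inc (w k).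
    by rewrite linear_sum; apply: eq_bigr => k _; rewrite linearZ.
  have fstE (F : 'I_n -> M) : (\sum_(k < n) F k).1 = \sum_(k < n) (F k).1.
    exact: (raddf_sum (@fst (freemod R n') (X i))).
  have sndE (F : 'I_n -> M) : (\sum_(k < n) F k).2 = \sum_(k < n) (F k).2.
    exact: (raddf_sum (@snd (freemod R n') (X i))).
  rewrite sumE fstE sndE ddE eeE; split=> //.
  by rewrite linear_sum; apply: eq_bigr => k _; rewrite -linearZ.
exists (Stage n dd ee); split=> /= [p|z x sz dz ex].
  have [u [-> ->]] := WE p; have [u1 u2] := subm_incP u.
  by split=> //; exact: size_free_poly.
have [|u uE] := @subm_incK _ _ W (poly_free n' z, x).
  by rewrite /= poly_freeK.
have [c cE] := wP u.
have sumE : subm_inc u = \sum_(k < n) c k *: subm_inc (w k).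
  by rewrite cE linear_sum; apply: eq_bigr => k _; rewrite linearZ.
pose p := \poly_(k < n) (if insub k is Some i then c i else 0).
have pE (k : 'I_n) : p`_k = c k by rewrite coef_poly ltn_ord valK.
exists p; split; first exact: size_poly.
- rewrite ddE -[z](poly_freeK sz).
  have -> : poly_free n' z = (subm_inc u).1 by rewrite uE.
  rewrite sumE (raddf_sum (@fst (freemod R n') (X i))) linear_sum.
  by apply: eq_bigr => k _; rewrite pE -linearZ.
- rewrite eeE; have -> : x = (subm_inc u).2 by rewrite uE.
  rewrite sumE (raddf_sum (@snd (freemod R n') (X i))).
  by apply: eq_bigr => k _; rewrite pE.
Qed.

Lemma complex_resolution : exists (P : probe R) (pi : ucmap P X), uqis pi.
Proof.
have [b bP] := cbounded X.
have [||s [sP s0]] := @downward_choice stage stage_ok (fun i => Stage 0 \0 \0) b.+1%:Z.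
- move=> i hi; split=> [p|z x sz _ _] /=.
    by rewrite size_poly0; split=> //; rewrite linear0.
  exists 0; rewrite size_poly0; split=> //.
    by apply/esym/eqP; rewrite -size_poly_leq0.
  by apply/esym/bP; lia.
- exact: stage_step.
pose n i := st_rank (s i).
pose d i : {linear freemod R (n i) -> freemod R (n (i + 1))} :=
  poly_free (n (i + 1)) \o (st_d (s i) \o free_poly (n i)).
have dE i x : free_poly (n (i + 1)) (d i x) = st_d (s i) (free_poly (n i) x).
  by rewrite poly_freeK //; have [h _ _] := proj1 (sP i) (free_poly (n i) x).
have dd i x : d (i + 1) (d i x) = 0.
  rewrite {1}/d /= dE; have [_ -> _] := proj1 (sP i) (free_poly (n i) x).
  by rewrite linear0.
pose P0 := @UCplx R (fun i => freemod R (n i)) d dd.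
have P0b : exists b : int, forall i, (b < i)%R -> zero_mod (P0 i).
  exists b.+1%:Z => i hi x; apply/ffunP=> k.
  by exfalso; case: k => k; rewrite /n s0 //; lia.
pose P := @Probe R P0 (fun i => @free_projective R (n i)) P0b.
pose e i : {linear P i -> X i} := st_e (s i) \o free_poly (n i).
have eP i x : e (i + 1) (ud P i x) = ud X i (e i x).
  rewrite /e /= dE; by have [_ _ ->] := proj1 (sP i) (free_poly (n i) x).
exists P, (@UCMap R P X e eP); split=> [i z x dz ez|i x dx].
  have dz' : st_d (s (i + 1)) (free_poly (n (i + 1)) z) = 0.
    by rewrite -dE [d _ _]dz linear0.
  have [p [sp dp ep]] := proj2 (sP i) _ x (size_free_poly _) dz' (esym ez).
  exists (poly_free (n i) p).
  by rewrite /= /d /= poly_freeK // dp free_polyK.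
have sz0 : (size (0%R : {poly R}) <= st_rank (s (i + 1 + 1)%R))%N by rewrite size_poly0.
have dx0 : cd X (i + 1) x = st_e (s (i + 1 + 1)) 0 by rewrite [cd _ _ _]dx linear0.
have [p [sp dp ep]] := proj2 (sP (i + 1)) 0 x sz0 (linear0 _) dx0.
exists (poly_free (n (i + 1)) p), 0; split.
  by rewrite /= /d /= poly_freeK // dp linear0.
by rewrite /= /e /= poly_freeK // ep linear0 addr0.
Qed.

End ComplexResolution.

(** * Maps that factor through perfect complexes *)

Section Factorization.
Variable R : nzRingType.
Implicit Types (D E P : probe R).

Definition perfect_factor D (X : ucplx R) (f : ucmap D X) :=
  exists (Q : cplx R) (g : ucmap D Q) (h : ucmap Q X),
    perfect Q /\ uhom f (ucomp h g).

(** Degreewise the cocone is [D + Q]. On [Q] the map [g'] is a chain map [beta : Q -> Q']; on [D] it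
    fails to be one by [beta g], which is what makes [(- g, g')] a chain map from [D] to the cone of
    [beta]. The homotopy [k] on [Q] extends [h] over that cone, and on [D] it is the homotopy
    required. *)
Lemma perfect_factor_cocone D (X : ucplx R) (f : ucmap D X) (Q : cplx R)
    (g : ucmap D (ush Q)) (Qp : perfect Q) :
  @perfect_factor (pcc Qp g) X (ucomp f (ucc_proj g)) -> perfect_factor f.
Proof.
move=> [Q' [g' [h [Q'p [k kP]]]]].
have iL i : linear (fun w : Q i => ((0, w) : ucc g i)).
  by move=> a u v; congr pair; rewrite /= scaler0 addr0.
have jL i : linear (fun x : D i => ((x, 0) : ucc g i)).
  by move=> a u v; congr pair; rewrite /= scaler0 addr0.
pose io i : {linear Q i -> ucc g i} := mklin (iL i).
pose jo i : {linear D i -> ucc g i} := mklin (jL i).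
have bP i w : (g' (i + 1) \o io (i + 1)) (ud Q i w) = ud Q' i ((g' i \o io i) w).
  rewrite /= -(ufunP g'); congr (g' _ _).
  by congr pair; rewrite /= ?linear0 ?add0r.
pose beta : cmap Q Q' := @CMap R Q Q' (fun i => g' i \o io i) bP.
have uE i (x : D i) (w : Q i) : ((x, w) : ucc g i) = jo i x + io i w.
  by congr pair; rewrite /= ?addr0 ?add0r.
have aP i x : g' (i + 1) (jo (i + 1) (ud D i x)) =
    ud Q' i (g' i (jo i x)) - g' (i + 1) (io (i + 1) (g i x)).
  rewrite -(ufunP g') -linearB; congr (g' _ _).
  by congr pair; rewrite /= ?linear0 ?subr0 ?addr0 ?subrr.
have g2L i : linear (fun x : D i => ((- g i x, g' i (jo i x)) : cone beta i)).
  move=> a x y; congr pair; last by rewrite [jo i _]linearP linearP.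
  have zm (V : lmodType R) (p q r : V) : r = a *: p + q -> - r = a *: - p - q.
    by move=> ->; rewrite opprD scalerN.
  apply: zm; exact: linearP.
have g2P i x : mklin (g2L (i + 1)) (ud D i x) = ud (cone beta) i (mklin (g2L i) x).
  congr pair.
    congr (- _); apply: etrans (@ufunP R D (ush Q) g i x) _.
    exact: esym (linearN (cd Q (i + 1)) (g i x)).
  have zm (V : zmodType) (p q r t : V) : p = q - r -> t = - r -> p = t + q.
    by move=> -> ->; rewrite addrC.
  exact: zm (aP i x) (linearN (beta (i + 1)) (g i x)).
have kio i w : h (i + 1) (g' (i + 1) (io (i + 1) w)) =
    - (ud X i (k i (io (i + 1) w)) + k (i + 1) (io (i + 1 + 1) (ud Q (i + 1) w))).
  have := kP i (io (i + 1) w).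
  have -> : ud (pcc Qp g) (i + 1) (io (i + 1) w) = io (i + 1 + 1) (ud Q (i + 1) w).
    by congr pair; rewrite /= ?linear0 ?add0r.
  by rewrite /= linear0 sub0r => /(congr1 -%R); rewrite opprK.
have h2L i : linear (fun u : prod_mod (Q (i + 1)) (Q' i) =>
    h i u.2 - k i (io (i + 1) u.1)).
  move=> a u v; rewrite /= [h i _]linearP [io _ _]linearP [k i _]linearP.
  by rewrite scalerBr opprD addrACA.
pose h2 i : {linear cone beta i -> X i} := mklin (h2L i).
have h2P i u : h2 (i + 1) (ud (cone beta) i u) = ud X i (h2 i u).
  case: u => w y.
  have zm (V : zmodType) (A B C E F q r s : V) : A = B + C -> B = - (r + s) ->
      C = q -> E = - s -> F = q - r -> A - E = F.
    by move=> -> -> -> -> ->; rewrite opprK opprD addrAC addrNK addrC.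
  exact: (zm _ _ _ _ _ _ _ _ _ (linearD (h (i + 1)) (beta (i + 1) w) (ud Q' i y))
    (kio i w) (@ufunP R Q' X h i y)
    (etrans (congr1 (k (i + 1)) (linearN (io (i + 1 + 1)) (ud Q (i + 1) w)))
       (linearN (k (i + 1)) _))
    (linearB (ud X i) (h i y) (k i (io (i + 1) w)))).
exists (cone beta), (@UCMap R D (cone beta) (fun i => mklin (g2L i)) g2P),
  (@UCMap R (cone beta) X h2 h2P); split.
  by move=> i; apply: projective_prod; [exact: Qp|exact: Q'p].
exists (fun i => k i \o jo (i + 1)) => i x.
have := kP i (jo (i + 1) x).
have -> : ud (pcc Qp g) (i + 1) (jo (i + 1) x) =
    jo (i + 1 + 1) (ud D (i + 1) x) + io (i + 1 + 1) (g (i + 1) x).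
  by rewrite -uE; congr pair; rewrite /= linear0 addr0.
have zm (V : zmodType) (p q r s t A C : V) : A = s + t -> C = - t ->
    p - q = r + A -> p - (q - C) = r + s.
  by move=> -> -> e; rewrite opprK opprD addrA e addrA addrK.
apply: zm; first exact: linearD (k (i + 1)) _ _.
exact: etrans (congr1 (k (i + 1)) (linearN (io (i + 1 + 1)) _)) (linearN (k (i + 1)) _).
Qed.

Lemma cov_perfect_factor D P (rho : ucmap D P) : cov rho ->
  forall (X : ucplx R) (f : ucmap P X),
  perfect_factor (ucomp f rho) -> perfect_factor f.
Proof.
elim=> {D P rho}.
- move=> D X f [Q [g [h [Qp e]]]]; exists Q, g, h; split=> //.
- move=> D P rho Q Qp g c IH X f [Q' [g' [h [Q'p e]]]].
  apply: IH; apply: (@perfect_factor_cocone D X (ucomp f rho) Q g Qp).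
  exists Q', g', h; split=> //; apply: uhom_trans e; exact: uassocV.
- move=> D P rho rho' c IH e X f [Q [g [h [Qp e']]]].
  apply: IH; exists Q, g, h; split=> //; apply: uhom_trans e'; exact: uhom_compl.
Qed.

Lemma loceq_zero_perfect_factor P (X : ucplx R) (f : ucmap P X) :
  loceq f (uzero P X) -> perfect_factor f.
Proof.
move=> [D [rho [c e]]]; apply: (cov_perfect_factor c).
have zb : exists n : nat, forall i : int, (n < absz i)%N -> zero_mod (freemod R 0).
  by exists 0%N => i _ x; apply/ffunP=> -[].
have zz (x : freemod R 0) : x = 0 by apply/ffunP=> -[].
pose Z : cplx R := @Cplx R (fun=> freemod R 0) (fun=> \0) (fun _ _ => erefl) zb.
exists Z, (uzero D Z), (uzero Z X); split; first by move=> i; exact: free_projective.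
by apply: uhom_trans e _; exact: uhom_eq.
Qed.
End Factorization.

Section ExtZ.
Variables (R : nzRingType) (P : probe R).

Definition ext_vanishz (i : int) (N : fgmod R) :=
  forall phi : {linear P (i + 1) -> N}, (forall x, phi (ud P i x) = 0) ->
  exists psi : {linear P (i + 1 + 1) -> N}, forall x, phi x = psi (ud P (i + 1) x).

(** The map [g] into the bounded perfect complex is contracted upwards, starting where [Q] is zero;
    each degree costs one Ext vanishing with projective coefficients. The contraction stops at [i],
    since [Y i = 0] makes the remaining boundary terms vanish. *)
Lemma locally_trivial_ext (Y : cplx R) (i : int) (f : ucmap P Y) :
  (forall i' Q, (i' <= i)%R -> projective Q -> ext_vanishz i' Q) ->
  zero_mod (Y i) -> loceq f (uzero P Y) ->
  exists psi : {linear P (i + 1 + 1) -> Y (i + 1)},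
    forall x, f (i + 1) x = psi (ud P (i + 1) x).
Proof.
move=> EQ Yi /loceq_zero_perfect_factor[Q [g [h [Qp [k kP]]]]].
pose claim (i' : int) := exists (s : {linear P (i' + 1) -> Q i'})
  (s' : {linear P (i' + 1 + 1) -> Q (i' + 1)}),
  forall x, g (i' + 1) x = ud Q i' (s x) + s' (ud P (i' + 1) x).
have [b bP] := cbounded Q.
(* The induction starts at [- b.+2] so that degree [i' + 1] is still outside the support of [Q]. *)
have cl (n : nat) : forall i' : int, (i' <= i)%R -> i' = - b.+2%:Z + n%:Z -> claim i'.
  elim: n => [|n IH] i' i'i e.
    exists \0, \0 => x /=; rewrite linear0 addr0; apply: bP; lia.
  have [j ej] := int_succ i'; rewrite {i'}ej in i'i e *.
  have [||s [s' sE]] := IH j; [lia|lia|].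
  have [|s2 s2E] := EQ (j + 1) (Q (j + 1 + 1)) i'i (@Qp _) (g (j + 1 + 1) \- (ud Q (j + 1) \o s')).
    move=> x /=; rewrite ufunP sE linearD -[cd Q _ (cd Q _ _)]/(ud Q _ (ud Q _ _)) udd.
    by rewrite add0r subrr.
  by exists s', s2 => x; rewrite -s2E /= [RHS]addrC subrK.
have [s [s' sE]] : claim i.
  have [bi|ib] := boolP (- b.+2%:Z <= i)%R.
    by apply: (cl (absz (i + b.+2%:Z))) => //; lia.
  by exists \0, \0 => x /=; rewrite linear0 addr0; apply: bP; lia.
exists ((h (i + 1) \o s') \+ k (i + 1)) => x /=.
have := kP i x; rewrite /= (Yi (k i x)) linear0 add0r => /eqP.
rewrite subr_eq => /eqP ->; rewrite sE linearD ufunP (Yi (h i (s x))) linear0 add0r.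
exact: addrC.
Qed.

(** Describes shifts of a stalk complex without identifying its term with [W]; a section and a
    retraction suffice to carry Ext vanishing over. *)
Definition concentrated (W : fgmod R) (j : int) (Y : cplx R) :=
  (forall i, i <> j -> zero_mod (Y i)) /\
  exists (u : {linear W -> Y j}) (v : {linear Y j -> W}), forall w, v (u w) = w.

Lemma concentrated_ext (W : fgmod R) (i : int) (Y : cplx R) :
  (forall i' Q, (i' <= i)%R -> projective Q -> ext_vanishz i' Q) ->
  concentrated W (i + 1) Y -> locally_trivial P Y -> ext_vanishz i W.
Proof.
move=> EQ [Yz [u [v vu]]] tY phi zphi.
pose f0 j : {linear P j -> Y j} := \0.
pose f j : {linear P j -> Y j} := dfwith f0 (u \o phi) j.
have fE : f (i + 1) = u \o phi by rewrite /f dfwith_in.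
have f0E j : j <> i + 1 -> f j = f0 j.
  by move=> ne; rewrite /f dfwith_out //; apply/eqP => e; apply: ne.
have fP j x : f (j + 1) (ud P j x) = ud Y j (f j x).
  have -> : ud Y j (f j x) = 0.
    have [e|/eqP ne] := eqVneq j (i + 1); last by rewrite f0E //= linear0.
    by apply: Yz; rewrite e; lia.
  have [e|/eqP ne] := eqVneq j i; last by rewrite f0E //; lia.
  by subst j; rewrite fE /= zphi linear0.
have := tY P (uid P) (cov_id P) (@UCMap R P Y f fP).
move=> /(locally_trivial_ext EQ) -[|psi psiE]; first by apply: Yz; lia.
exists (v \o psi) => x; rewrite /= -psiE /= fE /= vu //.
Qed.

End ExtZ.

Section Stalk.
Variables (R : nzRingType) (nth : noeth R) (W : fgmod R).

Definition stalk_pred (i : int) (x : W) := i <> 0 -> x = 0.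
Lemma stalk_pred0 i : stalk_pred i 0. Proof. by []. Qed.
Lemma stalk_predL i a x y : stalk_pred i x -> stalk_pred i y -> stalk_pred i (a *: x + y).
Proof. by move=> hx hy ne; rewrite hx // hy // scaler0 addr0. Qed.
Definition stalk_subm i : subm W := Subm (@stalk_pred0 i) (@stalk_predL i).
Definition stalk_mod i : fgmod R := subfg nth (stalk_subm i).

Lemma stalk_zero i : i <> 0 -> zero_mod (stalk_mod i).
Proof.
move=> ne x; apply: subfg_inc_inj; rewrite linear0.
exact: (subfg_incP x ne).
Qed.

Lemma stalk_bounded : exists n : nat, forall i : int, (n < absz i)%N -> zero_mod (stalk_mod i).
Proof. by exists 0%N => i hi; apply: stalk_zero; lia. Qed.

Definition stalk : cplx R :=
  @Cplx R stalk_mod (fun i => \0) (fun _ _ => erefl) stalk_bounded.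

Lemma concentrated_stalk k : concentrated W (- k%:Z) (shift_iter k stalk).
Proof.
elim: k => [|k [IHz [u [v uv]]]].
  split; first by move=> i; exact: stalk_zero.
  have [|u uE] := @subfg_corestr R nth W (stalk_subm 0) W idfun; first by move=> x [].
  by exists u, subfg_inc => w; rewrite uE.
have e : - k%:Z = - k.+1%:Z + 1 by lia.
rewrite e in u v uv; split; last by exists u, v.
by move=> i ne; apply: IHz; lia.
Qed.
End Stalk.

(** * Silting objects of the singularity category *)

Section LowDegrees.
Variables (R : nzRingType) (P : probe R) (c : int).
Hypothesis Pex : forall i, (i < c)%R -> exact_at (ud P i) (ud P (i + 1)).

Lemma low_eq (k : nat) : c - k.+1%:Z + 1 = c - k%:Z. Proof. by lia. Qed.

(** Reindexes the exact low-degree part of [P] by [nat], so that the results on chains of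
    projectives apply. *)
Definition low_d (k : nat) : {linear P (c - k.+1%:Z) -> P (c - k%:Z)} :=
  castm P (low_eq k) \o ud P (c - k.+1%:Z).

Lemma castm_inj (i j : int) (e : i = j) x : castm P e x = 0 -> x = 0.
Proof. by move=> h; rewrite -(castmK e (esym e) x) h linear0. Qed.

Lemma low_exact k : exact_at (low_d k.+1) (low_d k).
Proof.
have e : c - k.+2%:Z + 1 = c - k.+1%:Z by lia.
have e' : c - k.+2%:Z + 1 + 1 = c - k.+1%:Z + 1 by lia.
have ik : c - k.+2%:Z < c by lia.
move=> x; split=> [/castm_inj dx|[y <-]].
  have [|y yE] := proj1 (Pex ik (castm P (esym e) x)).
    by rewrite -(castm_d (esym e) (esym e')) dx linear0.
  exists y; rewrite /= yE.
  by rewrite (castm_comp (esym e) (low_eq k.+1) erefl).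
rewrite /= -(castm_d (low_eq k.+1) e') udd !linear0 //.
Qed.

Lemma low_ext_vanish n i N : c - n.+1%:Z = i + 1 ->
  ext_vanish low_d n N <-> ext_vanishz P i N.
Proof.
move=> E; have E2 : c - n.+2%:Z = i by lia.
have E2' : c - n.+2%:Z + 1 = i + 1 by lia.
have E0 : c - n%:Z = i + 1 + 1 by lia.
have E1' : c - n.+1%:Z + 1 = i + 1 + 1 by lia.
split=> [ev phi zphi|ev phi zphi].
  have [|psi psiE] := ev (phi \o castm P E).
    move=> x /=; rewrite (castm_comp (low_eq n.+1) E E2') (castm_d E2 E2').
    exact: zphi.
  exists (psi \o castm P (esym E0)) => x /=.
  have := psiE (castm P (esym E) x); rewrite /= castmK => ->.
  rewrite -(castm_d (esym E) (esym E1')) (castm_comp (esym E1') (low_eq n) (esym E0)).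
  by [].
have [|psi psiE] := ev (phi \o castm P (esym E)).
  move=> x; have := zphi (castm P (esym E2) x).
  by rewrite /= -(castm_d (esym E2) (esym E2')) (castm_comp _ _ (esym E)).
exists (psi \o castm P E0) => x /=.
have := psiE (castm P E x); rewrite /= castmK => ->.
by rewrite -(castm_d E E1') (castm_comp (low_eq n) E0 E1').
Qed.

End LowDegrees.

Section ZeroObjects.
Variable R : nzRingType.

(** The zero endomorphism has a perfect cone, so it becomes invertible; an invertible idempotent is
    the identity. *)
Lemma perfect_zero (Z : cplx R) : perfect Z -> @zero_obj (Dsg R) Z.
Proof.
move=> Zp; have L := Dsg_laws R.
have [v [w vw]] := dist_of_cone (isomorphic_refl (Kb_laws R) (cone (cmap_zero Z Z) : Kb R)).
have c : @cone_in (Db R) (@perfect R) Z Z (toDb (cmap_zero Z Z)).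
  by apply: ConeIn vw _ => i; apply: projective_prod; exact: Zp.
pose z : @hom (Dsg R) Z Z := toDsg (toDb (cmap_zero Z Z)).
pose zi : @hom (Dsg R) Z Z := Inv c.
have zz : z \oc z =h z.
  apply: (heq_trans L (heq_sym L (LocComp _ _ _))); apply: LocHeq.
  apply: (heq_trans (Db_laws R) (heq_sym (Db_laws R) (LocComp _ _ _))); apply: LocHeq.
  exact: (@uhom_zero_compl R Z Z Z (ucmap_of (cmap_zero Z Z))).
have ziz : zi \oc z =h idm (Z : Dsg R) by exact: LocInvl.
apply: (heq_trans L (heq_sym L ziz)).
apply: (heq_trans L (heq_congr L (heq_refl L zi) (heq_sym L zz))).
apply: (heq_trans L (heq_assoc L _ _ _)).
apply: (heq_trans L (heq_congr L ziz (heq_refl L z))).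
exact: heq_idl.
Qed.

Lemma zero_obj_qis (Z T : cplx R) (q : cmap Z T) : uqis q ->
  @zero_obj (Dsg R) Z -> @zero_obj (Dsg R) T.
Proof.
move=> qq Zz; have L := Dsg_laws R.
pose s := qis_cone_in qq.
pose f : @hom (Dsg R) Z T := toDsg (toDb q).
pose g : @hom (Dsg R) T Z := toDsg (Inv s : @hom (Db R) T Z).
have fg : f \oc g =h idm (T : Dsg R).
  apply: (heq_trans L (heq_sym L (LocComp _ _ _))); apply: LocHeq.
  exact: LocInvr.
have f0 : f \oc zerom (Z : Dsg R) Z =h zerom (T : Dsg R) T \oc f.
  apply: (heq_trans L (heq_sym L (LocComp _ _ _))).
  apply: (heq_trans L _ (LocComp _ _ _)); apply: LocHeq.
  apply: (heq_trans (Db_laws R) (heq_sym (Db_laws R) (LocComp _ _ _))).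
  apply: (heq_trans (Db_laws R) _ (LocComp _ _ _)); apply: LocHeq.
  exact: (@uhom_trans R Z T (uzero Z T) (ucmap_of (cmap_comp q (cmap_zero Z Z)))
    (ucmap_of (cmap_comp (cmap_zero T T) q)) (uhom_zero_compl Z (ucmap_of q))
    (uhom_sym (uhom_zero_compr T (ucmap_of q)))).
apply: (heq_trans L (heq_sym L fg)).
apply: (heq_trans L (heq_congr L (heq_sym L (heq_idr L f)) (heq_refl L g))).
apply: (heq_trans L (heq_congr L (heq_congr L (heq_refl L f) Zz) (heq_refl L g))).
apply: (heq_trans L (heq_congr L f0 (heq_refl L g))).
apply: (heq_trans L (heq_sym L (heq_assoc L _ _ _))).
apply: (heq_trans L (heq_congr L (heq_refl L _) fg)).
exact: heq_idr.
Qed.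
End ZeroObjects.

Section SingularityCategory.
Variables (R : nzRingType) (nth : noeth R).
Hypothesis fl : forall M : fgmod R, finite_length M.
Hypothesis injdim : finite_injdim (regular_mod R).

Theorem silting_Dsg_zero (T : Dsg R) : silting T -> zero_obj T.
Proof.
move=> [Thom Tgen].
have [P [pi piq]] := complex_resolution nth T.
have ltT k : (0 < k)%N -> locally_trivial P (shift_iter k T).
  by move=> k0; apply: (hom_vanish_locally_trivial nth piq); exact: Thom.
have evT X : eventually_trivial P X.
  apply: (Tgen X); first exact: eventually_trivial_thick.
  by exists 1%N => k; exact: ltT.
have [nP nPP] := uqis_exact_low piq.
pose c : int := - nP%:Z.
have Pc i : (i < c)%R -> exact_at (ud P i) (ud P (i + 1)) by exact: nPP.
have lowp n : projective (P (c - n%:Z)) by exact: probe_proj.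
have lowex := low_exact Pc.
have [I [dI Iz]] := injdim.
(* [ext_vanishz P i] corresponds to [ext_vanish] at index [c - i - 2]; this is the offset 2 here and
   below. *)
have EQ i Q : (i <= c - dI.+2%:Z)%R -> projective Q -> ext_vanishz P i Q.
  move=> hi Qp; pose n := absz (c - i - 2)%R.
  apply/(@low_ext_vanish R P c n); first by rewrite /n; lia.
  apply: ext_vanish_projective Qp.
  by apply: (ext_vanish_injres lowp lowex Iz); rewrite /n; lia.
have EW (W : fgmod R) : exists i0, forall i, (i <= i0)%R -> ext_vanishz P i W.
  have [k0 k0P] := evT (stalk nth W).
  exists (- (k0 + absz c + dI + 2)%N%:Z) => i hi.
  (* As [i + 1] is negative, [k] shifts place the stalk of [W] in degree [i + 1]. *)
  pose k := absz (i + 1)%R.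
  apply: (@concentrated_ext R P W i (shift_iter k (stalk nth W))).
  - by move=> i' Q i'i; apply: EQ; lia.
  - have -> : i + 1 = - k%:Z by rewrite /k; lia.
    exact: concentrated_stalk.
  - by apply: k0P; rewrite /k; lia.
have [n0 n0P] : exists n0, forall n, (n0 <= n)%N -> forall N : fgmod R,
    ext_vanish (low_d P c) n N.
  apply: (ext_vanish_uniform lowp lowex (nth := nth)) => // W.
  have [i0 i0P] := EW (subfg nth W).
  exists (absz (c - i0)%R) => n hn.
  apply/(@low_ext_vanish R P c n (c - n.+2%:Z)); first by lia.
  by apply: i0P; lia.
have Eall N i : (i <= c - n0.+2%:Z)%R -> ext_vanishz P i N.
  move=> hi; apply/(@low_ext_vanish R P c (absz (c - i - 2)%R)); first by lia.
  by apply: n0P; lia.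
have [t tP] := cbounded T.
(* Low enough for Ext vanishing at [m], for exactness of [P] up to degree [m + 1], and for [T] to
   vanish in degrees at most [m + 1]. *)
pose m : int := c - (n0 + 4 + t)%N%:Z.
(* As in [syzygy_split], the corestricted differential is a cocycle whose extension splits the image
   off the next term. *)
have Im : projective (image_mod (ud P (m + 1))).
  have [g gE] := image_corestr (ud P (m + 1)).
  have [||psi psiE] := Eall (image_mod (ud P (m + 1))) m _ g.
  - by rewrite /m; lia.
  - by move=> x; apply: image_inc_inj; rewrite gE udd linear0.
  apply: (projective_retract (i := image_inc) (r := psi)) (@probe_proj R P _) => y.
  have [x e] := image_incP y.
  by rewrite -e -psiE; apply: image_inc_inj; rewrite gE.
have [|q qE] := trunc_factor nth (m := m + 1) pi.
  by move=> i him; apply: tP; rewrite /m /c in him; lia.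
have qq : uqis q.
  apply: (uqis_cancel qE) => //; apply: trunc_map_qis => i him; apply: Pc.
  by rewrite /m in him; lia.
apply: (@zero_obj_qis R (trunc nth P (m + 1)) T (cmap_of q)); first exact: qq.
by apply: perfect_zero; exact: trunc_perfect.
Qed.

End SingularityCategory.

(** * Coresolutions of Cohen-Macaulay modules *)

Section ModuleResolutions.
Variables (R : nzRingType) (nth : noeth R).

Lemma subm_free_cover (M : fgmod R) (W : subm M) :
  exists (n : nat) (v : 'I_n -> M), forall x, W x <-> exists y, free_map v y = x.
Proof.
have [n [w wP]] := nth W; exists n, (fun k => subm_inc (w k)) => x; split.
  move=> /subm_incK[u <-]; have [c ->] := wP u; exists [ffun k => c k].
  rewrite free_mapE linear_sum; apply: eq_bigr => k _.
  by rewrite ffunE linearZ.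
move=> [y <-]; rewrite free_mapE; apply: sm_sum => k _.
by apply: smZ; exact: subm_incP.
Qed.

(** The differentials are recorded as families of vectors, i.e. matrices, since they will be
    transposed. *)
Lemma free_resolution (M : fgmod R) :
  exists (p : nat -> nat) (v : forall n, 'I_(p n.+1) -> freemod R (p n))
    (e : {linear freemod R (p 0%N) -> M}),
    [/\ surjective_map e, exact_at (free_map (v 0%N)) e
      & forall n, exact_at (free_map (v n.+1)) (free_map (v n))].
Proof.
have [p0 [e es]] := fg_free_surj M.
pose state := {k : nat & subm (freemod R k)}.
have step (s : state) : exists c : {n : nat & 'I_n -> freemod R (tag s)},
    forall x, tagged s x <-> exists y, free_map (tagged c) y = x.
  have [n [v vP]] := subm_free_cover (M := freemod R (tag s)) (tagged s).
  by exists (Tagged (fun n => 'I_n -> freemod R (tag s)) v).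
have [c cP] := choice_fun step.
pose next (s : state) : state :=
  Tagged (fun k => subm (freemod R k)) (ker_subm (free_map (tagged (c s)))).
pose s0 : state := Tagged (fun k => subm (freemod R k)) (ker_subm e).
pose s := fix s n : state := if n is n'.+1 then next (s n') else s0.
exists (fun n => tag (s n)), (fun n => tagged (c (s n))), e; split=> //.
  exact: (cP s0).
by move=> n; exact: (cP (s n.+1)).
Qed.

Definition free_projres (M : fgmod R) (p : nat -> nat)
    (v : forall n, 'I_(p n.+1) -> freemod R (p n)) (e : {linear freemod R (p 0%N) -> M})
    (es : surjective_map e) (ex0 : exact_at (free_map (v 0%N)) e)
    (exS : forall n, exact_at (free_map (v n.+1)) (free_map (v n))) :
  projective_resolution M :=
  @ProjRes R M (fun n => freemod R (p n)) (fun n => free_map (v n)) e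
    (fun n => @free_projective R (p n)) es ex0 exS.

Lemma ex_projres (M : fgmod R) : inhabited (projective_resolution M).
Proof.
have [p [v [e [es ex0 exS]]]] := free_resolution M.
by split; exact: free_projres es ex0 exS.
Qed.

Definition splice_mod (P : nat -> fgmod R) (F : fgmod R) (n : nat) : fgmod R :=
  if n is n'.+1 then P n' else F.

Definition splice_d (P : nat -> fgmod R) (d : forall n, {linear P n.+1 -> P n})
    (F : fgmod R) (i : {linear P 0%N -> F}) n :
    {linear splice_mod P F n.+1 -> splice_mod P F n} :=
  match n with 0%N => i | n'.+1 => d n' end.

(** The case [j = 0] is [cohen_macaulay], and each syzygy lowers [j] by one. *)
Definition gorenstein_dim_le (j : nat) (M : fgmod R) :=
  forall n, (j <= n)%N -> extS_vanishes n M (regular_mod R).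

(** Any resolution of [N] spliced with [F] is a resolution of [M], with indices moved by one. *)
Lemma gorenstein_dim_syzygy j (N F M : fgmod R) (i : {linear N -> F})
    (p : {linear F -> M}) : projective F -> injective i -> exact_at i p ->
  surjective_map p -> gorenstein_dim_le j.+1 M -> gorenstein_dim_le j N.
Proof.
move=> Fp ii ex ps gM n jn P.
have proj' k : projective (splice_mod P F k).
  by case: k => [//|k]; exact: pr_proj.
have ex0 : exact_at (splice_d (pr_d P) (i \o pr_aug P) 0) p.
  move=> x; split=> [/ex[y <-]|[y <-]].
    by have [z <-] := pr_surj P y; exists z.
  by apply/ex; exists (pr_aug P y).
have exS k : exact_at (splice_d (pr_d P) (i \o pr_aug P) k.+1)
    (splice_d (pr_d P) (i \o pr_aug P) k).
  case: k => [|k]; last exact: (pr_exactS P k).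
  move=> x; split=> [/= ix|[y <-] /=].
    by apply/(pr_exact0 P x); apply: ii; rewrite linear0.
  by rewrite (exact_comp0 (pr_exact0 P)) linear0.
pose P' : projective_resolution M := @ProjRes R M (splice_mod P F)
  (splice_d (pr_d P) (i \o pr_aug P)) p proj' ps ex0 exS.
exact: (gM n.+1 _ P').
Qed.

Lemma injdim_gorenstein_dim : finite_injdim (regular_mod R) ->
  exists d, forall M, gorenstein_dim_le d M.
Proof.
move=> [I [d Id]]; exists d => M n dn P.
exact: (ext_vanish_injres (pr_proj P) (pr_exactS P) Id).
Qed.

(** The sequence continues to the right forever, so each image is a [D]-th syzygy of a later image,
    where [D] bounds the degrees of nonzero Ext into the regular module. *)
Lemma image_cohen_macaulay (G : nat -> fgmod R) (d : forall n, {linear G n -> G n.+1}) :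
  finite_injdim (regular_mod R) -> (forall n, projective (G n)) ->
  (forall n, exact_at (d n) (d n.+1)) ->
  forall n, cohen_macaulay (image_mod (d n)).
Proof.
move=> /injdim_gorenstein_dim[D DP] Gp dex.
have key k : forall n, (k <= D)%N -> gorenstein_dim_le (D - k) (image_mod (d n)).
  elim: k => [|k IH] n kD; first by rewrite subn0.
  have [q qE] := image_corestr (d n.+1).
  apply: (@gorenstein_dim_syzygy _ _ (G n.+1) (image_mod (d n.+1)) image_inc q) => //.
  - exact: image_inc_inj.
  - move=> x; split=> [qx|[y <-]].
      have [|y <-] := proj1 (dex n x); first by rewrite -qE qx linear0.
      by have [r rE] := image_corestr (d n); exists (r y).
    have [z <-] := image_incP y; apply: image_inc_inj.
    by rewrite qE linear0; exact: exact_comp0 (dex n) z.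
  - move=> y; have [x xE] := image_incP y; exists x.
    by apply: image_inc_inj; rewrite qE.
  - have -> : (D - k.+1).+1 = (D - k)%N by lia.
    by apply: IH; lia.
move=> n m; have := key D n (leqnn D); rewrite subnn; exact.
Qed.
End ModuleResolutions.

(* An anti-isomorphism R -> S makes the transpose of a matrix over R the matrix of
   the dual map between free S-modules. *)
Section Transpose.
Variables (R S : nzRingType) (tau : R -> S) (sig : S -> R).
Hypothesis tauK : cancel tau sig.
Hypothesis sigK : cancel sig tau.
Hypothesis tauD : forall x y, tau (x + y) = tau x + tau y.
Hypothesis tauM : forall x y, tau (x * y) = tau y * tau x.

Definition transpose p q (v : 'I_p -> freemod R q) : 'I_q -> freemod S p :=
  fun j => [ffun i => (tau (v i j) : S^o)].

Lemma tau0 : tau 0 = 0.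
Proof. by apply: (@addrI _ (tau 0)); rewrite -tauD !addr0. Qed.

Lemma tau_sum (I : Type) (r : seq I) (F : I -> R) :
  tau (\sum_(i <- r) F i) = \sum_(i <- r) tau (F i).
Proof.
elim: r => [|i r IH]; first by rewrite !big_nil tau0.
by rewrite !big_cons tauD IH.
Qed.

Definition functional q (w : freemod S q) : {linear freemod R q -> regular_mod R} :=
  free_map (fun i => (sig (w i) : R^o)).

Lemma functionalE q w f : tau (@functional q w f) = \sum_i (w i : S) * tau (f i).
Proof.
rewrite /functional free_mapE (tau_sum (I := 'I_q)); apply: eq_bigr => i _.
by rewrite tauM sigK.
Qed.

Lemma functional_ex q (phi : {linear freemod R q -> regular_mod R}) :
  exists w, phi =1 functional w.
Proof.
exists [ffun i => (tau (phi (free_basis R i)) : S^o)].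
by apply: free_ext => i; rewrite /functional free_map_basis ffunE tauK.
Qed.

Lemma functional_transpose p q (v : 'I_p -> freemod R q) (w : freemod S q) x :
  functional w (free_map v x) = functional (free_map (transpose v) w) x.
Proof.
apply: (free_ext (f := functional w \o free_map v)) => i /=.
apply: (can_inj tauK); rewrite free_map_basis functionalE.
rewrite /functional free_map_basis sigK free_mapE sum_ffunE.
by apply: eq_bigr => j _; rewrite !ffunE.
Qed.

Lemma functional_inj q (w w' : freemod S q) : functional w =1 functional w' -> w = w'.
Proof.
move=> h; apply/ffunP=> i; have := h (free_basis R i).
by rewrite /functional !free_map_basis => /(can_inj sigK).
Qed.

(** The second hypothesis is exactness of the dual complex; identifying functionals on R^q with S^q
    turns precomposition into the transpose. *)
Lemma transpose_exact p q r (v : 'I_p -> freemod R q) (v' : 'I_q -> freemod R r) :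
  (forall x, free_map v' (free_map v x) = 0) ->
  (forall phi : {linear freemod R q -> regular_mod R},
     (forall x, phi (free_map v x) = 0) ->
     exists psi : {linear freemod R r -> regular_mod R},
       forall x, phi x = psi (free_map v' x)) ->
  exact_at (free_map (transpose v')) (free_map (transpose v)).
Proof.
move=> v'v ext w; split=> [tw|[u <-]].
  have [x|psi psiE] := ext (functional w).
    by rewrite functional_transpose tw /functional free_mapE big1 // => i _;
       rewrite ffunE -tau0 tauK scaler0.
  have [u uE] := functional_ex psi; exists u; apply: functional_inj => x.
  by rewrite -functional_transpose -uE psiE.
apply: functional_inj => x.
rewrite -!functional_transpose v'v linear0 /functional free_mapE big1 // => i _.
by rewrite ffunE -tau0 tauK scaler0.
Qed.

End Transpose.

Section Cosyzygy.
Variables (R S : nzRingType) (tau : R -> S) (sig : S -> R).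
Hypothesis tauK : cancel tau sig.
Hypothesis sigK : cancel sig tau.
Hypothesis tauD : forall x y, tau (x + y) = tau x + tau y.
Hypothesis tauM : forall x y, tau (x * y) = tau y * tau x.
Hypothesis nthR : noeth R.
Hypothesis nthS : noeth S.
Hypothesis injR : finite_injdim (regular_mod R).
Hypothesis injS : finite_injdim (regular_mod S).

Let sigD x y : sig (x + y) = sig x + sig y.
Proof. by apply: (can_inj tauK); rewrite tauD !sigK. Qed.

Let sigM x y : sig (x * y) = sig y * sig x.
Proof. by apply: (can_inj tauK); rewrite tauM !sigK. Qed.

(* Dualizing a free resolution of X, continuing it to the left by a free resolution
   of its first kernel, and dualizing back gives a coresolution of X by free modules;
   finiteness of the injective dimension on either side provides the exactness. *)
Lemma cohen_macaulay_cosyzygy (X : fgmod R) : cohen_macaulay X ->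
  exists (F C : fgmod R) (i : {linear X -> F}) (p : {linear F -> C}),
    [/\ projective F, cohen_macaulay C, injective i, exact_at i p & surjective_map p].
Proof.
move=> Xcm; have [p [v [e [es ex0 exS]]]] := free_resolution nthR X.
pose P := free_projres es ex0 exS.
pose G n := freemod S (p n).
pose d n : {linear G n -> G n.+1} := free_map (transpose tau (v n)).
have dex n : exact_at (d n) (d n.+1).
  apply: (transpose_exact tauK sigK tauD tauM).
    exact: exact_comp0 (exS n).
  exact: (Xcm n P).
(* Here the finite injective dimension over [S] is used; it makes the second dualization exact. *)
have Yp : cohen_macaulay (image_mod (d 1%N)).
  by apply: image_cohen_macaulay => // n; exact: free_projective.
pose Y0 := subfg nthS (ker_subm (d 0%N)).
have [h [w [f [fs fx0 fxS]]]] := free_resolution nthS Y0.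
(* Ranks of a free resolution of the image of [d 1]: first [G 1], then [G 0], then a resolution of
   the kernel of [d 0]. *)
pose l n : nat := match n with 0 => p 1 | 1 => p 0 | n.+2 => h n end.
pose vl n : 'I_(l n.+1) -> freemod S (l n) :=
  match n with
  | 0 => transpose tau (v 0%N)
  | 1 => fun k => subfg_inc (f (free_basis S k))
  | n.+2 => w n
  end.
have vl1 : free_map (vl 1%N) =1 subfg_inc \o f.
  by apply: (free_ext (f := free_map (vl 1%N)) (g := subfg_inc \o f)) => k; rewrite free_map_basis.
have vlex n : exact_at (free_map (vl n.+1)) (free_map (vl n)).
  case: n => [|[|n]]; last exact: fxS.
    move=> x; split=> [dx|[y <-]].
      have [u uE] := subfg_incK nthS (W := ker_subm (d 0%N)) dx.
      by have [y yE] := fs u; exists y; rewrite vl1 /= yE.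
    by rewrite vl1; exact: subfg_incP (f y).
  move=> x; rewrite vl1 /=; split=> [fx|[y <-]].
    by apply/fx0; apply: subfg_inc_inj; rewrite fx linear0.
  by rewrite (exact_comp0 fx0) linear0.
have [q qE] := image_corestr (d 1%N).
have qs : surjective_map q.
  move=> y; have [x xE] := image_incP y; exists x.
  by apply: image_inc_inj; rewrite qE.
have qex : exact_at (free_map (vl 0%N)) q.
  move=> x; split=> [qx|[y <-]].
    by apply/(dex 0%N); rewrite -qE qx linear0.
  by apply: image_inc_inj; rewrite qE linear0; exact: exact_comp0 (dex 0%N) y.
pose L := @free_projres S _ l vl q qs qex vlex.
pose H n := freemod R (l n).
pose c n : {linear H n -> H n.+1} := free_map (transpose sig (vl n)).
have cex n : exact_at (c n) (c n.+1).
  apply: (transpose_exact sigK tauK sigD sigM).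
    exact: exact_comp0 (vlex n).
  exact: (Yp n L).
(* Transposing twice returns the presentation of [X], so [X] is the cokernel of [c 0], and exactness
   at [H 1] embeds it into [H 2]. *)
have c0 : c 0%N =1 free_map (v 0%N).
  apply: free_ext => k; rewrite /c !free_map_basis.
  by apply/ffunP=> j; rewrite !ffunE tauK.
have Ccm : cohen_macaulay (image_mod (c 2%N)).
  by apply: image_cohen_macaulay => // n; exact: free_projective.
have [r rE] := image_corestr (c 2%N).
have [i iE] : exists i : {linear X -> H 2%N}, forall u, i (e u) = c 1%N u.
  have [i iP] : exists i : {linear X -> H 2%N}, forall x, exists u, x = e u /\ i x = c 1%N u.
    apply: (linear_of_rel (rho := fun x y => exists u, x = e u /\ y = c 1%N u)).
    - by move=> x; have [u <-] := es x; exists (c 1%N u), u.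
    - move=> a x x' y y' [u [-> ->]] [u' [-> ->]]; exists (a *: u + u').
      by rewrite !linearP.
    - move=> y [u [/esym/ex0[t tE] ->]].
      by rewrite -tE -c0; exact: exact_comp0 (cex 0%N) t.
  exists i => u; have [u' [eu ->]] := iP (e u).
  apply/eqP; rewrite -subr_eq0 -linearB; apply/eqP/(cex 0%N).
  have [|t tE] := proj1 (ex0 (u' - u)); first by rewrite linearB -eu subrr.
  by exists t; rewrite c0.
exists (H 2%N), (image_mod (c 2%N)), i, r; split=> //.
- exact: free_projective.
- apply: ker_sub0 => x; have [u <-] := es x; rewrite iE => /(cex 0%N)[t tE].
  by apply/ex0; exists t; rewrite -c0.
- move=> x; split=> [rx|[y <-]].
    have [|u <-] := proj1 (cex 1%N x); first by rewrite -rE rx linear0.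
    by exists (e u); rewrite iE.
  have [u <-] := es y; apply: image_inc_inj; rewrite iE rE linear0.
  exact: exact_comp0 (cex 1%N) u.
- move=> y; have [x xE] := image_incP y; exists x.
  by apply: image_inc_inj; rewrite rE.
Qed.
End Cosyzygy.

(** * Silting objects of the stable category *)

Section StableSilting.
Variables (R : nzRingType) (nth : noeth R).
Hypothesis fl : forall M : fgmod R, finite_length M.
Hypothesis injdim : finite_injdim (regular_mod R).
Hypothesis cosyz : forall X : fgmod R, cohen_macaulay X ->
  exists (F C : fgmod R) (i : {linear X -> F}) (p : {linear F -> C}),
    [/\ projective F, cohen_macaulay C, injective i, exact_at i p & surjective_map p].

Lemma cosyzygyP (X : cmmod R) : is_cosyzygy (cosyzygy X).
Proof.
rewrite /cosyzygy; apply: epsilon_spec.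
have [F [C [i [p [Fp Ccm ii ex ps]]]]] := cosyz (@cmmodP _ X).
by exists (@CosyzData R X F (CMMod Ccm) i p).
Qed.

Variables (T : cmmod R) (P : projective_resolution T).
Local Notation ev := (ext_vanish (pr_d P)).

Lemma resolution_dd n x : pr_d P n (pr_d P n.+1 x) = 0.
Proof. exact: exact_comp0 (pr_exactS P n) x. Qed.

Lemma ext_vanish_cm_projective n Q : projective Q -> ev n Q.
Proof. by apply: ext_vanish_projective; exact: (@cmmodP _ T n P). Qed.

Section ShortExact.
Variables (X Q C : fgmod R) (i : {linear X -> Q}) (p : {linear Q -> C}).
Hypotheses (Qp : projective Q) (ii : injective i) (ex : exact_at i p).
Hypothesis ps : surjective_map p.

(** [T] is Cohen-Macaulay, so Ext(T, Q) = 0 and the connecting map from Ext^{n+1}(T, C) to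
    Ext^{n+2}(T, X) is injective; [ext_vanish_kernel] is its surjectivity. *)
Lemma ext_vanish_cokernel n : ev n.+1 X -> ev n C.
Proof.
move=> E phi zphi.
have [|f fE] := @projective_lift _ _ _ _ p phi (pr_proj P n.+1).
  by move=> x; exact: ps.
have [|chi chiE] := @projective_lift _ _ _ _ i (f \o pr_d P n.+1) (pr_proj P n.+2).
  by move=> x; apply/ex; rewrite /= fE zphi.
have [|chi' chi'E] := E chi.
  by move=> x; apply: ii; rewrite chiE /= resolution_dd !linear0.
have [|psi psiE] := @ext_vanish_cm_projective n _ Qp (f \- (i \o chi')).
  by move=> x; rewrite /= -chi'E chiE subrr.
exists (p \o psi) => x; rewrite /= -psiE /= linearB fE.
by rewrite (exact_comp0 ex) subr0.
Qed.

Lemma ext_vanish_kernel n : ev n C -> ev n.+1 X.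
Proof.
move=> E phi zphi.
have [|psi psiE] := @ext_vanish_cm_projective n.+1 _ Qp (i \o phi).
  by move=> x; rewrite /= zphi linear0.
have [|chi chiE] := E (p \o psi).
  by move=> x; rewrite /= -psiE /= (exact_comp0 ex).
have [|f fE] := @projective_lift _ _ _ _ p chi (pr_proj P n); first by move=> x; exact: ps.
have [|om omE] := @projective_lift _ _ _ _ i (psi \- (f \o pr_d P n)) (pr_proj P n.+1).
  by move=> x; apply/ex; rewrite /= linearB fE -chiE subrr.
exists om => x; apply: ii; rewrite omE /= resolution_dd linear0 subr0.
exact: psiE.
Qed.

(** Ext^1(T, X) is a quotient of the stable Hom(T, C): a map to [C] through a projective lifts to
    [Q], and subtracting the lift from [psi] gives values in [X]. *)
Lemma ext_vanish_kernel0 :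
  (forall f : {linear T -> C}, stable_eq f \0) -> ev 0 X.
Proof.
move=> hz phi zphi.
have [|psi psiE] := @ext_vanish_cm_projective 0 _ Qp (i \o phi).
  by move=> x; rewrite /= zphi linear0.
have [f fE] : exists f : {linear T -> C}, forall u, f (pr_aug P u) = p (psi u).
  have [f fP] : exists f : {linear T -> C}, forall x, exists u,
      x = pr_aug P u /\ f x = p (psi u).
    apply: (linear_of_rel (rho := fun x y => exists u, x = pr_aug P u /\ y = p (psi u))).
    - by move=> x; have [u <-] := pr_surj P x; exists (p (psi u)), u.
    - move=> a x x' y y' [u [-> ->]] [u' [-> ->]]; exists (a *: u + u').
      by rewrite !linearP.
    - move=> y [u [/esym/(pr_exact0 P)[t <-] ->]].
      by rewrite -psiE /= (exact_comp0 ex).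
  exists f => u; have [u' [eu ->]] := fP (pr_aug P u).
  apply/eqP; rewrite -subr_eq0 -!linearB.
  have [|t <-] := proj1 (pr_exact0 P (u' - u)); first by rewrite linearB -eu subrr.
  by rewrite -psiE /= (exact_comp0 ex).
have [P' [a [b [P'p abE]]]] := hz f.
have abE' x : b (a x) = f x by apply: etrans (esym (abE x)) (subr0 _).
have [|b' b'E] := @projective_lift _ _ _ _ p b P'p; first by move=> x; exact: ps.
have [|om omE] := @projective_lift _ _ _ _ i (psi \- (b' \o (a \o pr_aug P))) (pr_proj P 0).
  by move=> x; apply/ex; rewrite /= linearB b'E /= abE' fE subrr.
exists om => x; apply: ii; rewrite omE /=.
have -> : pr_aug P (pr_d P 0 x) = 0 by exact: exact_comp0 (pr_exact0 P) x.
have -> : b' (a 0) = 0 by rewrite !linear0.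
rewrite subr0; exact: psiE.
Qed.
End ShortExact.

Definition ext_eventually (X : fgmod R) := exists n0, forall n, (n0 <= n)%N -> ev n X.

(** The composite differs from the identity by a map through a projective, into which Ext from [T]
    vanishes. *)
Lemma ext_vanish_stable_retract n (X Y : fgmod R) (i : {linear X -> Y})
    (p : {linear Y -> X}) : stable_eq (p \o i) idfun -> ev n Y -> ev n X.
Proof.
move=> [Q [a [b [Qp abE]]]] E phi zphi.
have [|psi psiE] := E (i \o phi); first by move=> x; rewrite /= zphi linear0.
have [|chi chiE] := @ext_vanish_cm_projective n _ Qp (a \o phi).
  by move=> x; rewrite /= zphi linear0.
exists ((p \o psi) \- (b \o chi)) => x /=.
by rewrite -psiE -chiE /= -abE /= subKr.
Qed.

Lemma ext_eventually_retract (X Y : stCM R) :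
  retract X Y -> ext_eventually Y -> ext_eventually X.
Proof.
move=> [i [p pi]] [n0 n0P]; exists n0 => n hn.
exact: ext_vanish_stable_retract pi (n0P n hn).
Qed.

Lemma ext_eventually_shift (X : stCM R) : ext_eventually X <-> ext_eventually (sh X).
Proof.
have [Qp ii ex ps] := cosyzygyP X.
split=> -[n0 n0P].
  exists n0 => n hn; apply: (ext_vanish_cokernel Qp ii ex ps); apply: n0P; lia.
exists n0.+1 => -[//|n] hn; apply: (ext_vanish_kernel Qp ii ex ps); exact: n0P.
Qed.

(** A pushout of X -> I(X) gives the exact sequence 0 -> X -> I(X) + Y -> Z -> 0, whose long exact
    sequence is followed on cocycles. *)
Lemma ext_vanish_pushout n (X Y Z : cmmod R) (u : {linear X -> Y})
    (v : {linear Y -> Z}) (w : {linear Z -> cm_shift X}) :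
  pushout_triangle u v w -> ev n.+1 X -> ev n Y -> ev n Z.
Proof.
have [Qp ii ex ps] := cosyzygyP X; set c := cosyzygy X in Qp ii ex ps *.
move=> [j [jv js _ _]] EX EY phi zphi.
have [f fE] : exists f : {linear prod_mod (cs_mid c) Y -> Z},
    forall z, f z = j z.1 + v z.2.
  by apply: ex_linear => a x y; rewrite /= !linearP scalerDr addrACA.
have [|g gE] := @projective_lift _ _ _ _ f phi (pr_proj P n.+1).
  by move=> x; have [e [y e']] := js (phi x); exists (e, y); rewrite fE e'.
have [e eE] : exists e : {linear P n.+1 -> cs_mid c}, forall x, e x = (g x).1.
  by apply: ex_linear => a x y; rewrite linearP.
have [y yE] : exists y : {linear P n.+1 -> Y}, forall x, y x = (g x).2.
  by apply: ex_linear => a x z; rewrite linearP.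
have gd x : exists t, e (pr_d P n.+1 x) = cs_inj c t /\ y (pr_d P n.+1 x) = - u t.
  by apply/jv; rewrite eE yE -fE gE zphi.
have [|chi chiE] := @projective_lift _ _ _ _ (cs_inj c) (e \o pr_d P n.+1) (pr_proj P n.+2).
  by move=> x; have [t [h _]] := gd x; exists t.
have uchi x : y (pr_d P n.+1 x) = - u (chi x).
  by have [t [h ->]] := gd x; congr (- u _); apply: ii; rewrite chiE -h.
have [|chi' chi'E] := EX chi.
  by move=> x; apply: ii; rewrite chiE /= resolution_dd !linear0.
have [|p1 p1E] := @ext_vanish_cm_projective n _ Qp (e \- (cs_inj c \o chi')).
  by move=> x; rewrite /= -chi'E chiE subrr.
have [|p2 p2E] := EY (y \+ (u \o chi')).
  by move=> x; rewrite /= -chi'E uchi addNr.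
exists ((j \o p1) \+ (v \o p2)) => x.
have jz : j (cs_inj c (chi' x)) + v (- u (chi' x)) = 0 by apply/jv; exists (chi' x).
rewrite -gE fE -eE -yE /= -p1E -p2E /= linearB linearD.
move: jz; rewrite linearN => /eqP; rewrite subr_eq0 => /eqP ->.
by rewrite addrACA addNr addr0.
Qed.

Lemma ext_eventually_thick : @thick_subcat (stCM R) ext_eventually.
Proof.
split.
- move=> X Y iXY; apply: ext_eventually_retract.
  by apply: retract_iso; exact: isomorphic_sym.
- exact: ext_eventually_shift.
- move=> t [X [Y [Z [u [v [w [po [a [b [c [[ia ib ic] _]]]]]]]]]]] tX tY.
  apply: (ext_eventually_retract (Y := Z)); first by apply: retract_iso; exists c.
  have [n0 n0P] : ext_eventually X.
    apply: ext_eventually_retract tX; apply: retract_iso.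
    by apply: isomorphic_sym; exists a.
  have [m0 m0P] : ext_eventually Y.
    apply: ext_eventually_retract tY; apply: retract_iso.
    by apply: isomorphic_sym; exists b.
  exists (maxn n0 m0) => n; rewrite geq_max => /andP[hn hm].
  by apply: (ext_vanish_pushout po); [apply: n0P; lia|exact: m0P].
- by move=> X Y /retract_summand; exact: ext_eventually_retract.
Qed.

(** Ext^{n+2}(T, T[k]) comes from Ext^{n+1}(T, T[k+1]) and Ext^1(T, T[k]) from stable Hom(T,
    T[k+1]); the induction needs all [k] at once. *)
Lemma ext_vanish_shifts : (forall i, (0 < i)%N ->
    forall f : @hom (stCM R) T (iter i (@sh (stCM R)) T), f =h zerom _ _) ->
  forall n k, ev n (iter k (@cm_shift R) T).
Proof.
move=> hz; elim=> [|n IH] k.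
  have [Qp ii ex ps] := cosyzygyP (iter k (@cm_shift R) T).
  apply: (ext_vanish_kernel0 Qp ii ex ps) => f.
  exact: (hz k.+1 isT f).
have [Qp ii ex ps] := cosyzygyP (iter k (@cm_shift R) T).
by apply: (ext_vanish_kernel Qp ii ex ps); exact: (IH k.+1).
Qed.

(** Thick generation reaches Cohen-Macaulay modules only. Any other module has a Cohen-Macaulay
    syzygy, and vanishing passes from a syzygy to the module. *)
Lemma ext_eventually_all : (forall X : cmmod R, ext_eventually X) ->
  forall X : fgmod R, ext_eventually X.
Proof.
move=> cmP; have [d dP] := injdim_gorenstein_dim injdim.
suff key j : forall X, gorenstein_dim_le j X -> ext_eventually X by move=> X; exact: (key d X).
elim: j => [|j IH] X gX.
  have Xcm : cohen_macaulay X by move=> n; exact: gX.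
  exact: (cmP (CMMod Xcm)).
have [k [p ps]] := fg_free_surj X.
pose N := subfg nth (ker_subm p); pose i : {linear N -> freemod R k} := subfg_inc.
have ii : injective i by exact: subfg_inc_inj.
have ex : exact_at i p.
  move=> x; split=> [px|[y <-]]; last exact: (subfg_incP y).
  exact: (subfg_incK nth (W := ker_subm p) px).
have Fp := @free_projective R k.
have [n0 n0P] := IH N (gorenstein_dim_syzygy Fp ii ex ps gX).
exists n0 => n hn; apply: (ext_vanish_cokernel Fp ii ex ps); apply: n0P; lia.
Qed.

(** A high syzygy is projective. As [T] is Cohen-Macaulay, Ext from [T] into a projective syzygy
    vanishes, so the sequences of the resolution split one after the other down to [T]. *)
Lemma ext_eventually_projective :
  (forall X : fgmod R, ext_eventually X) -> projective T.
Proof.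
move=> evP.
have [n0 n0P] : exists n0, forall n, (n0 <= n)%N -> forall N : fgmod R, ev n N.
  apply: (ext_vanish_uniform (pr_proj P) (pr_exactS P) (nth := nth) fl) => W.
  exact: evP.
have Kp m : forall n, (n0 - m <= n)%N -> projective (image_mod (pr_d P n)).
  elim: m => [|m IH] n hn.
    by apply: (syzygy_projective (pr_proj P) (pr_exactS P)); apply: n0P; lia.
  have [e eE] := image_corestr (pr_d P n).
  apply: (cosyzygy_projective (pr_proj P) (pr_exactS P) (n := n.+1) (e := e)).
  - by apply: ext_vanish_cm_projective; apply: IH; lia.
  - by move=> y; have [x xE] := image_incP y; exists x; apply: image_inc_inj; rewrite eE.
  - move=> x; split=> [ex|[y <-]].
      by apply/(pr_exactS P n); rewrite -eE ex linear0.
    by apply: image_inc_inj; rewrite eE linear0; exact: resolution_dd.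
apply: (cosyzygy_projective (pr_proj P) (pr_exactS P) (n := 0%N) (e := pr_aug P)).
- by apply: ext_vanish_cm_projective; apply: (Kp n0); lia.
- exact: pr_surj.
- exact: (pr_exact0 P).
Qed.

End StableSilting.

Lemma silting_stCM_zero (R : nzRingType) (nth : noeth R)
    (fl : forall M : fgmod R, finite_length M)
    (injdim : finite_injdim (regular_mod R))
    (cosyz : forall X : fgmod R, cohen_macaulay X ->
      exists (F C : fgmod R) (i : {linear X -> F}) (p : {linear F -> C}),
        [/\ projective F, cohen_macaulay C, injective i, exact_at i p & surjective_map p])
    (T : stCM R) : silting T -> zero_obj T.
Proof.
move=> [Thom Tgen]; have [P] := ex_projres nth (T : cmmod R).
have Tp : projective (T : cmmod R).
  apply: (ext_eventually_projective nth fl (P := P)).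
  apply: (ext_eventually_all nth injdim) => X.
  apply: (Tgen X (@ext_eventually R T P)); first exact: ext_eventually_thick.
  by exists 0%N => n _; exact: (@ext_vanish_shifts R cosyz T P Thom n 0%N).
(* The identity factors through the projective module [T] itself. *)
exists (T : cmmod R), idfun, idfun; split=> // x.
exact: subr0.
Qed.
Theorem theorem1 (K : closedFieldType) (A : falgType K)
    (A_basic : basic_algebra A) (A_indec : indecomposable_algebra A) :
  (finite_injdim (right_regular A) ->
     ~ exists T : Dsg A^c, silting T /\ ~ zero_obj T) /\
  (iwanaga_gorenstein A ->
     ~ exists T : stCM A^c, silting T /\ ~ zero_obj T).

Proof.
(* Scalars are central, so multiplication by [iota a] is the vector space action on both [A] and
   [A^c]. *)
pose iota (a : K) : A := a *: 1.
have scaleA (a : K) (x : A) : a *: x = iota a * x by rewrite -scalerAl mul1r.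
have scaleAc (a : K) (x : A) : a *: x = (iota a : A^c) * (x : A^c).
  by rewrite -[RHS]/(x * iota a) -scalerAr mulr1.
have nth : noeth A^c.
  exact: (@finite_dim_noeth K A A^c iota id id (fun _ => erefl) (fun _ _ => erefl) scaleAc).
have nthA : noeth A.
  exact: (@finite_dim_noeth K A A iota id id (fun _ => erefl) (fun _ _ => erefl) scaleA).
have fl (M : fgmod A^c) : finite_length M.
  exact: (@finite_dim_length K A A^c iota id id (fun _ => erefl) (fun _ _ => erefl) scaleAc).
split=> [injR [T [sT nT]]|[injR injL] [T [sT nT]]].
  exact/nT/(silting_Dsg_zero nth fl injR).
apply/nT/(silting_stCM_zero nth fl injR) => // X.
(* [A^c] has the same elements as [A] with reversed multiplication, so the identity is the
   anti-isomorphism. *)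
apply: (@cohen_macaulay_cosyzygy A^c A id id) => //.
Qed.
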